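(* Let $X$ and $U$ be Banach spaces, let $\tau>0$, let $A$ be the generator of a strongly continuous semigroup $T(t)$ on $X$, and let $B_0:U\to X$ and $F:X\to U$ be bounded linear operators. Let $\omega\in\mathbb{R}$. Suppose that the nominal sampled-data system $$\dot x(t)=Ax(t)+B_0u(t)\quad \forall t\ge 0,\qquad x(0)=x^0\in X,\qquad u(k\tau+t)=Fx(k\tau)\quad \forall t\in[0,\tau),\ \forall k\in\mathbb{Z}_+,$$ is exponentially stable with decay rate greater than $\omega$ and that $T(t)$ is an analytic semigroup. Then there exist $\alpha,\beta>0$ such that for every linear operator $D:\mathrm{dom}(D)\subset X\to X$ satisfying $\mathrm{dom}(A)\subset\mathrm{dom}(D)$ and $$\|Dx\|\le\alpha\|Ax\|+\beta\|x\|\qquad\forall x\in\mathrm{dom}(A),$$ the perturbed sampled-data system $$\dot x(t)=(A+D)x(t)+B_0u(t)\quad \forall t\ge 0,\qquad x(0)=x^0\in X,\qquad u(k\tau+t)=Fx(k\tau)\quad \forall t\in[0,\tau),\ \forall k\in\mathbb{Z}_+,$$ is also exponentially stable with decay rate greater than $\omega$.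
   Context: $\mathbb{Z}_+$ is the set of nonnegative integers. Set $B:=B_0F$, a bounded linear operator on $X$. Solution: if $G$ is the generator of a strongly continuous semigroup $S(t)$ on $X$, the solution of the sampled-data system with generator $G$ (i.e. $\dot x=Gx+B_0u$, $u(k\tau+t)=Fx(k\tau)$ for $t\in[0,\tau)$, $k\in\mathbb{Z}_+$) and initial state $x^0\in X$ is the function $x:[0,\infty)\to X$ defined recursively by $x(0)=x^0$ and $$x(k\tau+t)=S(t)x(k\tau)+\int_0^t S(s)Bx(k\tau)\,ds\qquad \forall t\in(0,\tau],\ \forall k\in\mathbb{Z}_+.$$ The nominal system corresponds to $G=A$, $S=T$. The perturbed system corresponds to $G=A+D$ with $\mathrm{dom}(A+D):=\mathrm{dom}(A)$ and $S=T_D$, the strongly continuous semigroup generated by $A+D$. It is known that, when $A$ generates an analytic semigroup, $A+D$ generates a (strongly continuous, analytic) semigroup for all such $D$ provided $\alpha,\beta>0$ are sufficiently small; the constants $\alpha,\beta$ in the claim are understood to be such that this holds. Exponential stability: the sampled-data system is exponentially stable with decay rate greater than $\omega$ if there exist $M\ge1$ and $\widetilde\omega>\omega$ such that for all $x^0\in X$ the solution satisfies $\|x(t)\|\le Me^{-\widetilde\omega t}\|x^0\|$ for all $t\ge0$. Analytic semigroup: for $\delta\in(0,\pi/2]$, a family $(T(z))$ of bounded operators indexed by $\{z\in\mathbb{C}\setminus\{0\}:|\arg z|<\delta\}\cup\{0\}$ is an analytic semigroup of angle $\delta$ if $T(0)=I$, $T(z_1+z_2)=T(z_1)T(z_2)$,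 $z\mapsto T(z)$ is analytic in the open sector, and $T(z)x\to x$ as $z\to0$ within $\{|\arg z|\le\delta'\}$ for all $x\in X$ and $0<\delta'<\delta$. A strongly continuous semigroup is analytic if it extends to an analytic semigroup of some angle $\delta\in(0,\pi/2]$. *)

(* Defs.v *)
From Stdlib Require Import Reals Lra Lia ClassicalChoice.
From Coquelicot Require Import Coquelicot.
Open Scope R_scope.

(** Banach spaces are complex: objects of [CompleteNormedModule C_AbsRing].
    Coquelicot's Riemann integral of a function [R -> V] asks for a real
    Banach space [V], so [realify X] restricts the scalars of [X] to [R].  Its
    carrier, additive group, uniform structure and norm are those of [X]. *)

Section Realify.

Context (X : CompleteNormedModule C_AbsRing).

Let rscal (r : R) (x : X) : X := scal (RtoC r : C_AbsRing) x.

Lemma realify_scal_assoc (r s : R) (x : X) :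
  rscal r (rscal s x) = rscal (mult r s) x.
Proof.
unfold rscal; rewrite scal_assoc; f_equal.
change (Cmult (RtoC r) (RtoC s) = RtoC (r * s)).
now rewrite RtoC_mult.
Qed.

Lemma realify_scal_one (x : X) : rscal one x = x.
Proof. exact (scal_one x). Qed.

Lemma realify_scal_distr_l (r : R) (x y : X) :
  rscal r (plus x y) = plus (rscal r x) (rscal r y).
Proof. exact (scal_distr_l (RtoC r : C_AbsRing) x y). Qed.

Lemma realify_scal_distr_r (r s : R) (x : X) :
  rscal (plus r s) x = plus (rscal r x) (rscal s x).
Proof.
etransitivity; [|exact (scal_distr_r (RtoC r : C_AbsRing) (RtoC s) x)].
unfold rscal; f_equal.
change (RtoC (r + s) = Cplus (RtoC r) (RtoC s)).
now rewrite RtoC_plus.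
Qed.

Lemma realify_norm_scal (r : R) (x : X) : norm (rscal r x) <= abs r * norm x.
Proof.
unfold rscal.
eapply Rle_trans; [exact (norm_scal (V := X) (RtoC r : C_AbsRing) x) |].
change (Cmod (RtoC r) * norm x <= Rabs r * norm x).
rewrite Cmod_R; apply Rle_refl.
Qed.

Definition realify_ModuleSpace_mixin :=
  ModuleSpace.Mixin R_Ring X rscal realify_scal_assoc realify_scal_one
    realify_scal_distr_l realify_scal_distr_r.

Definition realify_ModuleSpace : ModuleSpace R_Ring :=
  ModuleSpace.Pack R_Ring X
    (ModuleSpace.Class R_Ring X (AbelianGroup.class X)
       realify_ModuleSpace_mixin) X.

Definition realify_NormedModuleAux : NormedModuleAux R_AbsRing :=
  NormedModuleAux.Pack R_AbsRing X
    (NormedModuleAux.Class R_AbsRing X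
       (ModuleSpace.class R_Ring realify_ModuleSpace)
       (UniformSpace.class X)) X.

Definition realify_NormedModule_mixin :=
  NormedModule.Mixin R_AbsRing realify_NormedModuleAux (@norm _ X)
    (@norm_factor _ X) (@norm_triangle _ X) realify_norm_scal
    (@norm_compat1 _ X) (@norm_compat2 _ X) (@norm_eq_zero _ X).

Definition realify_NormedModule : NormedModule R_AbsRing :=
  NormedModule.Pack R_AbsRing X
    (NormedModule.Class R_AbsRing X
       (NormedModuleAux.class R_AbsRing realify_NormedModuleAux)
       realify_NormedModule_mixin) X.

Definition realify : CompleteNormedModule R_AbsRing :=
  CompleteNormedModule.Pack R_AbsRing X
    (CompleteNormedModule.Class R_AbsRing X
       (NormedModule.class R_AbsRing realify_NormedModule)
       (CompleteNormedModule.mixin C_AbsRing X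
          (CompleteNormedModule.class C_AbsRing X))) X.

End Realify.

(** Unbounded operators: only the values of [app] on [dom] are meaningful. *)
Record poperator (X : NormedModule C_AbsRing) := POperator {
  dom : X -> Prop;
  app :> X -> X
}.
Arguments POperator {X} _ _.
Arguments dom {X} _ _.
Arguments app {X} _ _.

Definition linear_operator {X : NormedModule C_AbsRing} (D : poperator X) :=
  dom D zero /\
  (forall x y, dom D x -> dom D y ->
     dom D (plus x y) /\ D (plus x y) = plus (D x) (D y)) /\
  (forall (c : C_AbsRing) x, dom D x ->
     dom D (scal c x) /\ D (scal c x) = scal c (D x)).

(** The sum [A + D] with domain [dom A]. *)
Definition perturbed {X : NormedModule C_AbsRing} (A D : poperator X) :
    poperator X :=
  POperator (dom A) (fun x => plus (A x) (D x)).

(** Semigroups are functions on [R] whose values at negative times are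
    irrelevant; [is_linear] is Coquelicot's "linear and bounded". *)
Definition C0_semigroup {X : NormedModule C_AbsRing} (S : R -> X -> X) :=
  (forall t, 0 <= t -> is_linear (S t)) /\
  (forall x, S 0 x = x) /\
  (forall s t x, 0 <= s -> 0 <= t -> S (s + t) x = S s (S t x)) /\
  (forall x, filterlim (fun t => S t x) (at_right 0) (locally x)).

Definition is_generator {X : NormedModule C_AbsRing} (G : poperator X)
    (S : R -> X -> X) :=
  forall x y : X,
    (dom G x /\ G x = y) <->
    filterlim
      (fun h : R => scal (RtoC (/ h) : C_AbsRing) (minus (S h x) x))
      (at_right 0) (locally y).

Definition is_arg (z : C) (theta : R) :=
  - PI < theta <= PI /\
  z = (Cmod z * cos theta, Cmod z * sin theta).

Definition open_sector (delta : R) (z : C) :=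
  z <> RtoC 0 /\ exists theta, is_arg z theta /\ Rabs theta < delta.

Definition closed_sector (delta : R) (z : C) :=
  z <> RtoC 0 /\ exists theta, is_arg z theta /\ Rabs theta <= delta.

(** [S] is complex differentiable at [z] for the operator norm; the inequality
    says that [S (z + h) - S z - h L] has operator norm at most
    [eps * Cmod h]. *)
Definition op_derivable {X : NormedModule C_AbsRing} (S : C -> X -> X)
    (z : C) :=
  exists L : X -> X, is_linear L /\
    forall eps : posreal, exists d : posreal,
      forall h : C, Cmod h < d -> forall x : X,
        norm (minus (minus (S (z + h)%C x) (S z x)) (scal (h : C_AbsRing) (L x)))
          <= eps * Cmod h * norm x.

Definition analytic_family {X : NormedModule C_AbsRing} (delta : R)
    (S : C -> X -> X) :=
  let index z := open_sector delta z \/ z = RtoC 0 in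
  (forall z, index z -> is_linear (S z)) /\
  (forall x, S (RtoC 0) x = x) /\
  (forall z1 z2 x, index z1 -> index z2 ->
     S (z1 + z2)%C x = S z1 (S z2 x)) /\
  (forall z, open_sector delta z -> op_derivable S z) /\
  (forall x delta', 0 < delta' < delta ->
     filterlim (fun z => S z x)
       (within (closed_sector delta') (locally (RtoC 0)))
       (locally x)).

Definition analytic_semigroup {X : NormedModule C_AbsRing}
    (S : R -> X -> X) :=
  C0_semigroup S /\
  exists (delta : R) (Sz : C -> X -> X),
    0 < delta <= PI / 2 /\ analytic_family delta Sz /\
    forall t x, 0 <= t -> Sz (RtoC t) x = S t x.

(** [x] is the solution of [x' = G x + B0 u], [u (k tau + t) = F (x (k tau))],
    with initial state [x0], where [G] generates [S]; only the restriction of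
    [x] to nonnegative times is determined.  The integrand is continuous when
    [S] is strongly continuous, so [RInt] is then the genuine integral. *)
Definition is_solution {X U : CompleteNormedModule C_AbsRing}
    (S : R -> X -> X) (B0 : U -> X) (F : X -> U) (tau : R) (x0 : X)
    (x : R -> X) :=
  x 0 = x0 /\
  forall (k : nat) (t : R), 0 < t <= tau ->
    x (INR k * tau + t) =
      plus (S t (x (INR k * tau)))
        (RInt (V := realify X) (fun s => S s (B0 (F (x (INR k * tau))))) 0 t).

Definition exp_stable {X U : CompleteNormedModule C_AbsRing}
    (S : R -> X -> X) (B0 : U -> X) (F : X -> U) (tau omega : R) :=
  exists M omega' : R, 1 <= M /\ omega < omega' /\
    forall (x0 : X) (x : R -> X), is_solution S B0 F tau x0 x ->
      forall t, 0 <= t -> norm (x t) <= M * exp (- omega' * t) * norm x0.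

(** Existence and uniqueness of the solution. *)

Lemma sampling_interval (tau t : R) : 0 < tau -> 0 < t ->
  exists k : nat, 0 < t - INR k * tau <= tau.
Proof.
intros Htau Ht.
assert (H : forall n : nat, t <= INR n * tau ->
          exists k : nat, 0 < t - INR k * tau <= tau).
{ induction n as [|n IH]; intros Hn.
  - simpl in Hn; lra.
  - destruct (Rle_dec t (INR n * tau)) as [Hle|Hgt]; [now apply IH|].
    exists n; rewrite S_INR in Hn; lra. }
destruct (nfloor_ex (t / tau)) as [n [_ Hn]].
{ apply Rlt_le, Rdiv_lt_0_compat; assumption. }
apply (H (S n)); rewrite S_INR.
apply (Rmult_lt_compat_r tau) in Hn; [|assumption].
unfold Rdiv in Hn; rewrite Rmult_assoc, Rinv_l, Rmult_1_r in Hn; lra.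
Qed.

Lemma sampling_interval_unique (tau s t : R) (k l : nat) :
  0 < s <= tau -> 0 < t <= tau -> INR k * tau + s = INR l * tau + t ->
  k = l /\ s = t.
Proof.
intros Hs Ht H.
assert (Hkl : k = l).
{ destruct (Nat.lt_trichotomy k l) as [Hlt|[Heq|Hgt]]; [exfalso|exact Heq|exfalso].
  - apply le_INR in Hlt; rewrite S_INR in Hlt.
    apply (Rmult_le_compat_r tau) in Hlt; lra.
  - apply le_INR in Hgt; rewrite S_INR in Hgt.
    apply (Rmult_le_compat_r tau) in Hgt; lra. }
subst l; split; [reflexivity | lra].
Qed.

Lemma solution_unique {X U : CompleteNormedModule C_AbsRing}
    (S : R -> X -> X) (B0 : U -> X) (F : X -> U) (tau : R) (x0 : X)
    (x y : R -> X) :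
  0 < tau -> is_solution S B0 F tau x0 x -> is_solution S B0 F tau x0 y ->
  forall t, 0 <= t -> x t = y t.
Proof.
intros Htau [Hx0 Hx] [Hy0 Hy].
assert (Hk : forall k : nat, x (INR k * tau) = y (INR k * tau)).
{ induction k as [|k IH].
  - simpl; rewrite Rmult_0_l; congruence.
  - replace (INR (Datatypes.S k) * tau) with (INR k * tau + tau)
      by (rewrite S_INR; ring).
    rewrite Hx, Hy, IH by lra; reflexivity. }
intros t Ht; destruct (Req_dec t 0) as [->|Hne]; [congruence|].
destruct (sampling_interval tau t Htau) as [k Hkt]; [lra|].
replace t with (INR k * tau + (t - INR k * tau)) by ring.
rewrite Hx, Hy, Hk by exact Hkt; reflexivity.
Qed.

Lemma solution_exists {X U : CompleteNormedModule C_AbsRing}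
    (S : R -> X -> X) (B0 : U -> X) (F : X -> U) (tau : R) (x0 : X) :
  0 < tau -> exists x, is_solution S B0 F tau x0 x.
Proof.
intros Htau.
pose (step := fun (t : R) (v : X) =>
  plus (S t v) (RInt (V := realify X) (fun s => S s (B0 (F v))) 0 t) : X).
pose (grid := fun k : nat => Nat.iter k (step tau) x0).
assert (Hfun : forall t, exists v : X,
   (t <= 0 -> v = x0) /\
   forall k : nat, 0 < t - INR k * tau <= tau ->
     v = step (t - INR k * tau) (grid k)).
{ intros t; destruct (Rle_dec t 0) as [Hle|Hgt].
  - exists x0; split; [trivial|].
    intros k Hk.
    assert (0 <= INR k * tau)
      by (apply Rmult_le_pos; [apply pos_INR | lra]); lra.
  - destruct (sampling_interval tau t Htau) as [k Hk]; [lra|].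
    exists (step (t - INR k * tau) (grid k)); split; [lra|].
    intros l Hl.
    destruct (sampling_interval_unique tau _ _ k l Hk Hl) as [<- _];
      [ring | reflexivity]. }
destruct (choice _ Hfun) as [x Hx].
assert (Hgrid : forall k : nat, x (INR k * tau) = grid k).
{ intros [|k].
  - simpl; rewrite Rmult_0_l; apply Hx; lra.
  - replace (INR (Datatypes.S k) * tau) with (INR k * tau + tau)
      by (rewrite S_INR; ring).
    destruct (Hx (INR k * tau + tau)) as [_ H].
    rewrite (H k) by lra.
    replace (INR k * tau + tau - INR k * tau) with tau by ring.
    reflexivity. }
exists x; split; [apply Hx; lra|].
intros k t Ht; rewrite Hgrid.
destruct (Hx (INR k * tau + t)) as [_ H].
rewrite (H k) by lra.
replace (INR k * tau + t - INR k * tau) with t by ring.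
reflexivity.
Qed.

(* Main.v *)
(** Shift [A] so that its semigroup decays on a sector.  Laplace transforms along
    the rays of the sector bound [(mu - h A)^-1] by [K / (|mu| + |h|)] for all
    [h] in the sector and all [mu] with positive real part, and a Neumann series
    carries this over to [G = A + D], with resolvents at distance
    [O(eta) / |mu|], where [eta] is small with [alpha] and [beta].

    The semigroup of [G] is the limit of the powers [J ^ n] of
    [J = (1 - (z / n) G)^-1].  They are bounded because [J] satisfies Ritt's
    condition [|(1 - w J)^-1| <= K / |1 - w|] on the unit disc: averaging
    [w ^ -n (1 - w J)^-1] over the [N]-th roots of unity (scaled by a radius
    [r < 1]) recovers [J ^ n] up to a term that vanishes as [N] grows, and one
    summation by parts makes the average absolutely bounded, because
    [|1 - w|^-2] has mean at most [3 / (1 - r ^ 2)].  A second summation by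
    parts bounds [n J ^ n (1 - J)], which gives analyticity, and comparing the
    averages for two operators shows that the semigroups of [A] and [A + D]
    differ by [O(eta)] in norm.  So do the one-period maps of the two
    sampled-data systems, and geometric decay of powers is stable under small
    perturbations. *)

Require Import Defs.
From Stdlib Require Import Reals.
From Coquelicot Require Import Coquelicot.
From Stdlib Require Import Lra Lia List ClassicalChoice Classical ClassicalEpsilon.
Open Scope R_scope.

(** The structures are given explicitly, because inference may otherwise pick
    operations that are convertible but not syntactically equal. *)
Declare Scope vec_scope.
Delimit Scope vec_scope with V.
Notation "x + y" :=
  (@plus (CompleteNormedModule.AbelianMonoid C_AbsRing _) x y) : vec_scope.
Notation "x - y" :=
  (@minus (CompleteNormedModule.AbelianGroup C_AbsRing _) x y) : vec_scope.
Notation "c '*:' x" :=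
  (@scal _ (CompleteNormedModule.ModuleSpace C_AbsRing _) c%C x)
  (at level 40, left associativity) : vec_scope.
Notation "0" := (@zero (CompleteNormedModule.AbelianMonoid C_AbsRing _)) : vec_scope.

(** * Deciding linear identities in a complex vector space *)

Inductive vexp :=
  | VAtom (n : nat) | VZero | VPlus (e f : vexp) | VOpp (e : vexp)
  | VMinus (e f : vexp) | VScal (c : C) (e : vexp).

Section LinearIdentities.
Context {X : NormedModule C_AbsRing}.

Fixpoint vdenote (env : list X) (e : vexp) : X :=
  match e with
  | VAtom n => nth n env zero
  | VZero => zero
  | VPlus e f => plus (vdenote env e) (vdenote env f)
  | VOpp e => opp (vdenote env e)
  | VMinus e f => minus (vdenote env e) (vdenote env f)
  | VScal c e => scal (c : C_AbsRing) (vdenote env e)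
  end.

Fixpoint vcoef (e : vexp) (i : nat) : C :=
  match e with
  | VAtom n => if Nat.eqb n i then RtoC 1 else RtoC 0
  | VZero => RtoC 0
  | VPlus e f => (vcoef e i + vcoef f i)%C
  | VOpp e => (- vcoef e i)%C
  | VMinus e f => (vcoef e i - vcoef f i)%C
  | VScal c e => (c * vcoef e i)%C
  end.

Fixpoint vcomb (env : list X) (c : nat -> C) : X :=
  match env with
  | nil => zero
  | cons x l => plus (scal (c O : C_AbsRing) x) (vcomb l (fun i => c (S i)))
  end.

Lemma vcomb_ext env : forall c d, (forall i, (i < length env)%nat -> c i = d i) ->
  vcomb env c = vcomb env d.
Proof.
induction env as [|x l IH]; intros c d H; simpl; [reflexivity|].
f_equal; [rewrite H by (simpl; lia); reflexivity|].
apply IH; intros i Hi; apply H; simpl; lia.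
Qed.

Lemma plus_swap4 (a b c d : X) :
  plus (plus a b) (plus c d) = plus (plus a c) (plus b d).
Proof.
rewrite <- !plus_assoc; f_equal; rewrite !plus_assoc; f_equal; apply plus_comm.
Qed.

Lemma scal_0C (x : X) : scal (RtoC 0 : C_AbsRing) x = zero.
Proof. exact (scal_zero_l x). Qed.

Lemma scal_1C (x : X) : scal (RtoC 1 : C_AbsRing) x = x.
Proof. exact (scal_one x). Qed.

Lemma vcomb_zero env : forall c, (forall i, c i = RtoC 0) -> vcomb env c = zero.
Proof.
induction env as [|x l IH]; intros c H; simpl; [reflexivity|].
rewrite H, IH, scal_0C by (intros; apply H).
apply plus_zero_l.
Qed.

Lemma vcomb_plus env : forall c d,
  vcomb env (fun i => (c i + d i)%C) = plus (vcomb env c) (vcomb env d).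
Proof.
induction env as [|x l IH]; intros c d; simpl; [now rewrite plus_zero_l|].
rewrite (scal_distr_r (c O : C_AbsRing) (d O) x : scal (Cplus (c O) (d O) : C_AbsRing) x = _).
rewrite (IH (fun i => c (S i)) (fun i => d (S i))); apply plus_swap4.
Qed.

Lemma vcomb_scal env k : forall c,
  vcomb env (fun i => (k * c i)%C) = scal (k : C_AbsRing) (vcomb env c).
Proof.
induction env as [|x l IH]; intros c; simpl; [symmetry; exact (scal_zero_r (k : C_AbsRing))|].
rewrite (scal_distr_l (k : C_AbsRing)), <- IH.
f_equal; symmetry; exact (scal_assoc (k : C_AbsRing) (c O) x).
Qed.

Lemma vcomb_opp env c : vcomb env (fun i => (- c i)%C) = opp (vcomb env c).
Proof.
etransitivity; [|exact (scal_opp_one (vcomb env c))].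
etransitivity; [|apply (vcomb_scal env (Copp (RtoC 1)))]; apply vcomb_ext; intros; ring.
Qed.

Lemma vcomb_atom env : forall n, 
  vcomb env (fun i => if Nat.eqb n i then RtoC 1 else RtoC 0) = nth n env zero.
Proof.
induction env as [|x l IH]; intros [|n]; simpl; try reflexivity.
- rewrite (vcomb_zero l), scal_1C by reflexivity; apply plus_zero_r.
- rewrite IH, scal_0C; apply plus_zero_l.
Qed.

Lemma vdenote_comb env e : vdenote env e = vcomb env (vcoef e).
Proof.
induction e; simpl.
- symmetry; apply vcomb_atom.
- symmetry; now apply vcomb_zero.
- rewrite IHe1, IHe2; symmetry; apply vcomb_plus.
- rewrite IHe; symmetry; apply vcomb_opp.
- rewrite IHe1, IHe2; unfold minus; rewrite <- vcomb_opp; symmetry.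
  apply vcomb_plus.
- rewrite IHe; symmetry; apply vcomb_scal.
Qed.

Fixpoint vsame (n : nat) (e f : vexp) : Prop :=
  match n with
  | O => True
  | S n => vcoef e n = vcoef f n /\ vsame n e f
  end.

Lemma vsame_denote env e f : vsame (length env) e f ->
  vdenote env e = vdenote env f.
Proof.
intros H; rewrite !vdenote_comb; apply vcomb_ext.
revert H; generalize (length env) as n; induction n as [|n IH]; intros H i Hi; [lia|].
destruct H as [H1 H2]; destruct (Nat.eq_dec i n) as [->|Hn]; [exact H1|].
apply IH; [exact H2 | lia].
Qed.

End LinearIdentities.

Ltac v_index x env :=
  lazymatch env with
  | cons ?y ?l => 
    match constr:(Set) with
    | _ => let _ := match constr:(Set) with _ => constr_eq x y end in constr:(O)
    | _ => let n := v_index x l in constr:(S n)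
    end
  end.

Ltac v_mem x env :=
  lazymatch env with
  | nil => constr:(false)
  | cons ?y ?l => 
    match constr:(Set) with
    | _ => let _ := match constr:(Set) with _ => constr_eq x y end in constr:(true)
    | _ => v_mem x l
    end
  end.

Ltac v_atoms t env :=
  lazymatch t with
  | plus ?a ?b => let env := v_atoms a env in v_atoms b env
  | minus ?a ?b => let env := v_atoms a env in v_atoms b env
  | opp ?a => v_atoms a env
  | scal _ ?a => v_atoms a env
  | zero => env
  | _ => lazymatch v_mem t env with
         | true => env
         | false => constr:(cons t env)
         end
  end.

Ltac v_reify t env :=
  lazymatch t with
  | plus ?a ?b => let a := v_reify a env in let b := v_reify b env in
      constr:(VPlus a b)
  | minus ?a ?b => let a := v_reify a env in let b := v_reify b env in
      constr:(VMinus a b)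
  | opp ?a => let a := v_reify a env in constr:(VOpp a)
  | scal ?c ?a => let a := v_reify a env in constr:(VScal c a)
  | zero => constr:(VZero)
  | _ => let n := v_index t env in constr:(VAtom n)
  end.

Ltac v_prep :=
  lazymatch goal with
  | |- @eq ?T ?a ?b =>
    let env := v_atoms a (@nil T) in
    let env := v_atoms b env in
    let ea := v_reify a env in
    let eb := v_reify b env in
    change (vdenote env ea = vdenote env eb);
    apply vsame_denote;
    cbn [length vsame vcoef Nat.eqb]; repeat split
  end.

Ltac vec := v_prep; ring.
Ltac vecf := v_prep; field.

Section Basics.
Context {X : CompleteNormedModule C_AbsRing}.
Implicit Types x y z : X.

(** Copies of Coquelicot's lemmas for the operations inferred on a
    [CompleteNormedModule]; [rewrite] and [lra] do not see through the
    difference with those inferred on a [NormedModule]. *)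
Lemma norm_triangleX x y : norm (x + y)%V <= norm x + norm y.
Proof. exact (norm_triangle x y). Qed.

Lemma norm_oppX x : norm (opp x) = norm x.
Proof. exact (norm_opp x). Qed.

Lemma norm_zeroX : norm (0%V : X) = 0.
Proof. exact (@norm_zero _ X). Qed.

Lemma norm_minus_diag x : norm (x - x)%V = 0.
Proof. replace (x - x)%V with (0%V : X) by vec; apply norm_zeroX. Qed.

Lemma norm_scalC (c : C) x : norm (c *: x)%V = Cmod c * norm x.
Proof.
apply Rle_antisym; [exact (norm_scal (c : C_AbsRing) x)|].
destruct (Ceq_dec c (RtoC 0)) as [->|Hc].
- rewrite Cmod_0, Rmult_0_l; apply norm_ge_0.
- assert (H : norm x <= Cmod (/ c) * norm (c *: x)%V).
  { replace x with (/ c *: (c *: x))%V at 1 by (vecf; exact Hc).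
    exact (norm_scal (/ c : C_AbsRing)%C _). }
  rewrite Cmod_inv in H by exact Hc.
  apply Cmod_gt_0 in Hc.
  apply (Rmult_le_compat_l (Cmod c)) in H; [|lra].
  rewrite <- Rmult_assoc, Rinv_r, Rmult_1_l in H by lra; exact H.
Qed.

Lemma norm_plus_le x y a b : norm x <= a -> norm y <= b -> norm (x + y)%V <= a + b.
Proof. intros; generalize (norm_triangleX x y); lra. Qed.

Lemma norm_minus_le x y a b : norm x <= a -> norm y <= b -> norm (x - y)%V <= a + b.
Proof. intros; unfold minus; apply norm_plus_le; [|rewrite norm_oppX]; assumption. Qed.

Lemma norm_minus_sym x y : norm (x - y)%V = norm (y - x)%V.
Proof. rewrite <- norm_oppX; f_equal; vec. Qed.

Lemma norm_scal_le (c : C) x a b : Cmod c <= a -> norm x <= b ->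
  norm (c *: x)%V <= a * b.
Proof.
intros; rewrite norm_scalC; apply Rmult_le_compat; trivial.
apply Cmod_ge_0. apply norm_ge_0.
Qed.

Lemma eq_of_norm x y : norm (x - y)%V <= 0 -> x = y.
Proof.
intros H; assert (H0 : norm (x - y)%V = 0).
{ apply Rle_antisym; [exact H | apply norm_ge_0]. }
apply norm_eq_zero in H0.
replace x with ((x - y) + y)%V by vec; rewrite H0; vec.
Qed.

Lemma eq_of_small x y : (forall eps, 0 < eps -> norm (x - y)%V <= eps) -> x = y.
Proof. intros H; apply eq_of_norm, le_epsilon; intros; rewrite Rplus_0_l; auto. Qed.

Definition lin (f : X -> X) :=
  (forall x y, f (x + y)%V = (f x + f y)%V) /\
  (forall c x, f (c *: x)%V = (c *: f x)%V).

Definition bnd (f : X -> X) (K : R) := forall x, norm (f x) <= K * norm x.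

Lemma lin_plus f x y : lin f -> f (x + y)%V = (f x + f y)%V.
Proof. intros H; apply H. Qed.

Lemma lin_scal f c x : lin f -> f (c *: x)%V = (c *: f x)%V.
Proof. intros H; apply H. Qed.

Lemma lin_zero f : lin f -> f 0%V = 0%V.
Proof.
intros H; replace (0%V : X) with (RtoC 0 *: (0 : X))%V at 1 by vec.
rewrite lin_scal by exact H; vec.
Qed.

Lemma lin_minus f x y : lin f -> f (x - y)%V = (f x - f y)%V.
Proof.
intros H; replace (x - y)%V with (x + RtoC (-1) *: y)%V by vec.
rewrite lin_plus, lin_scal by exact H; vec.
Qed.

Lemma lin_comp f g : lin f -> lin g -> lin (fun x => f (g x)).
Proof.
intros Hf Hg; split; intros.
- now rewrite (lin_plus g), (lin_plus f).
- now rewrite (lin_scal g), (lin_scal f).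
Qed.

Lemma lin_scal_comp c f : lin f -> lin (fun x => c *: f x)%V.
Proof.
intros Hf; split; intros.
- rewrite (lin_plus f) by exact Hf; vec.
- rewrite (lin_scal f) by exact Hf; vec.
Qed.

Lemma bnd_scal_comp c f K : bnd f K -> bnd (fun x => c *: f x)%V (Cmod c * K).
Proof.
intros Hf x; rewrite norm_scalC, Rmult_assoc.
apply Rmult_le_compat_l; [apply Cmod_ge_0 | apply Hf].
Qed.

Lemma lin_iter f n : lin f -> lin (Nat.iter n f).
Proof.
intros Hf; induction n as [|n IH]; [now split|].
now apply (lin_comp f (Nat.iter n f)).
Qed.

Lemma lin_of_is_linear (f : X -> X) : is_linear f -> lin f.
Proof. intros H; split; intros; [apply H|]. exact (linear_scal f H c x). Qed.

Lemma is_linear_of_lin (f : X -> X) K : lin f -> bnd f K -> is_linear f.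
Proof.
intros H HK; split; [apply H| intros; apply (proj2 H) |].
exists (Rabs K + 1); split; [generalize (Rabs_pos K); lra|].
intros x; eapply Rle_trans; [apply HK|].
apply Rmult_le_compat_r; [apply norm_ge_0|].
generalize (Rle_abs K); lra.
Qed.

Lemma bnd_of_is_linear (f : X -> X) : is_linear f -> exists K, 0 < K /\ bnd f K.
Proof. intros H; exact (linear_norm f H). Qed.

Lemma bnd_le f K K' x : bnd f K -> 0 <= K -> norm x <= K' -> norm (f x) <= K * K'.
Proof.
intros H HK Hx; eapply Rle_trans; [apply H|]; now apply Rmult_le_compat_l.
Qed.

Lemma bnd_iter f K n : 0 <= K -> bnd f K -> bnd (Nat.iter n f) (K ^ n).
Proof.
intros HK Hf; induction n as [|n IH]; intros x; simpl; [lra|].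
eapply Rle_trans; [apply Hf|]; rewrite Rmult_assoc.
apply Rmult_le_compat_l; [exact HK | apply IH].
Qed.

Lemma iter_comm (f g : X -> X) n x : (forall y, f (g y) = g (f y)) ->
  Nat.iter n f (g x) = g (Nat.iter n f x).
Proof. intros H; induction n as [|n IH]; simpl; [reflexivity|]. now rewrite IH, H. Qed.

Lemma iter_add (f : X -> X) m n x :
  Nat.iter (m + n) f x = Nat.iter m f (Nat.iter n f x).
Proof. induction m as [|m IH]; simpl; congruence. Qed.

Lemma iter_S_r (f : X -> X) n x : Nat.iter (S n) f x = Nat.iter n f (f x).
Proof. now rewrite <- Nat.add_1_r, iter_add. Qed.

Fixpoint vsum (f : nat -> X) (n : nat) : X :=
  match n with O => 0%V | S n => (vsum f n + f n)%V end.

Fixpoint rsum (f : nat -> R) (n : nat) : R :=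
  match n with O => 0 | S n => rsum f n + f n end.

Lemma vsum_ext f g n : (forall i, (i < n)%nat -> f i = g i) -> vsum f n = vsum g n.
Proof.
induction n as [|n IH]; intros H; simpl; [reflexivity|].
now rewrite IH, H by (intros; try apply H; lia).
Qed.

Lemma vsum_norm f g n : (forall i, (i < n)%nat -> norm (f i) <= g i) ->
  norm (vsum f n) <= rsum g n.
Proof.
induction n as [|n IH]; intros H; simpl; [rewrite norm_zeroX; lra|].
apply norm_plus_le; [apply IH; intros; apply H; lia | apply H; lia].
Qed.

Lemma vsum_scal c f n : vsum (fun i => c *: f i)%V n = (c *: vsum f n)%V.
Proof. induction n as [|n IH]; simpl; [vec|]. rewrite IH; vec. Qed.

Lemma vsum_plus f g n : vsum (fun i => f i + g i)%V n = (vsum f n + vsum g n)%V.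
Proof. induction n as [|n IH]; simpl; [vec|]. rewrite IH; vec. Qed.

Lemma vsum_minus f g n : vsum (fun i => f i - g i)%V n = (vsum f n - vsum g n)%V.
Proof. induction n as [|n IH]; simpl; [vec|]. rewrite IH; vec. Qed.

Lemma vsum_lin E f n : lin E -> vsum (fun i => E (f i)) n = E (vsum f n).
Proof.
intros HE; induction n as [|n IH]; simpl; [now rewrite lin_zero|].
now rewrite IH, lin_plus.
Qed.

Lemma vsum_shift f n : (vsum (fun i => f (S i)) n + f O = vsum f n + f n)%V.
Proof.
induction n as [|n IH]; simpl; [reflexivity|].
transitivity ((vsum (fun i => f (S i)) n + f O) + f (S n))%V; [vec|].
rewrite IH; vec.
Qed.

Lemma vsum_cyclic f n : f n = f O -> vsum (fun i => f (S i)) n = vsum f n.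
Proof.
intros H; generalize (vsum_shift f n); rewrite H; intros E.
replace (vsum (fun i => f (S i)) n) with ((vsum (fun i => f (S i)) n + f O) - f O)%V by vec.
rewrite E; vec.
Qed.

Definition tends {I} (F : (I -> Prop) -> Prop) (f : I -> X) (l : X) :=
  forall eps, 0 < eps -> F (fun i => norm (f i - l)%V < eps).

Lemma tends_filterlim {I} (F : (I -> Prop) -> Prop) {FF : Filter F} f l :
  tends F f l <-> filterlim f F (locally l).
Proof.
rewrite (filterlim_locally_ball_norm (K := C_AbsRing) f l); split.
- intros H eps; exact (H eps (cond_pos eps)).
- intros H eps Heps; exact (H (mkposreal eps Heps)).
Qed.

Section Tends.
Context {I : Type} (F : (I -> Prop) -> Prop) {FF : Filter F}.

Lemma tends_ext f g l : (forall i, f i = g i) -> tends F f l -> tends F g l.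
Proof.
intros H Hf eps Heps; eapply filter_imp; [|exact (Hf eps Heps)].
intros i; simpl; now rewrite H.
Qed.

Lemma tends_const l : tends F (fun _ => l) l.
Proof.
intros eps Heps; apply filter_forall; intros _.
now rewrite norm_minus_diag.
Qed.

Lemma tends_plus f g l m : tends F f l -> tends F g m ->
  tends F (fun i => f i + g i)%V (l + m)%V.
Proof.
intros Hf Hg eps Heps.
assert (He2 : 0 < eps / 2) by lra.
generalize (filter_and _ _ (Hf _ He2) (Hg _ He2)); apply filter_imp; intros i [H1 H2].
replace (f i + g i - (l + m))%V with ((f i - l) + (g i - m))%V by vec.
eapply Rle_lt_trans; [apply norm_triangleX|]; lra.
Qed.

Lemma tends_scal (c : C) f l : tends F f l -> tends F (fun i => c *: f i)%V (c *: l)%V.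
Proof.
intros Hf eps Heps.
assert (Hc := Cmod_ge_0 c).
assert (He2 : 0 < eps / (Cmod c + 1)) by (apply Rdiv_lt_0_compat; lra).
generalize (Hf _ He2); apply filter_imp; intros i H1.
replace (c *: f i - c *: l)%V with (c *: (f i - l))%V by vec.
rewrite norm_scalC.
apply Rle_lt_trans with ((Cmod c) * (eps / (Cmod c + 1))).
- apply Rmult_le_compat_l; lra.
- apply Rlt_le_trans with ((Cmod c + 1) * (eps / (Cmod c + 1))); [|right; field; lra].
  apply Rmult_lt_compat_r; lra.
Qed.

Lemma tends_minus f g l m : tends F f l -> tends F g m ->
  tends F (fun i => f i - g i)%V (l - m)%V.
Proof.
intros Hf Hg; replace (l - m)%V with (l + RtoC (-1) *: m)%V by vec.
apply (tends_ext (fun i => f i + RtoC (-1) *: g i)%V); [intros; vec|].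
apply tends_plus, tends_scal; assumption.
Qed.

Lemma tends_lin E K f l : lin E -> bnd E K -> tends F f l ->
  tends F (fun i => E (f i)) (E l).
Proof.
intros HE HK Hf eps Heps.
assert (He2 : 0 < eps / (Rabs K + 1)) by (generalize (Rabs_pos K); intros; apply Rdiv_lt_0_compat; lra).
generalize (Hf _ He2); apply filter_imp; intros i H1.
rewrite <- lin_minus by exact HE.
eapply Rle_lt_trans; [apply HK|].
apply Rle_lt_trans with ((Rabs K) * (eps / (Rabs K + 1))).
- apply Rle_trans with (Rabs K * norm (f i - l)%V).
  + apply Rmult_le_compat_r; [apply norm_ge_0|]; apply Rle_abs.
  + apply Rmult_le_compat_l; [apply Rabs_pos|]; lra.
- generalize (Rabs_pos K); intros HKp.
  apply Rlt_le_trans with ((Rabs K + 1) * (eps / (Rabs K + 1))); [|right; field; lra].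
  apply Rmult_lt_compat_r; lra.
Qed.

Lemma tends_opnorm (P : I -> X -> X) K f l m : 0 < K -> (forall i, lin (P i)) ->
  F (fun i => bnd (P i) K) -> tends F f l -> tends F (fun i => P i l) m ->
  tends F (fun i => P i (f i)) m.
Proof.
intros HK HP HB Hf Hm eps Heps.
assert (He1 : 0 < eps / 2) by lra.
assert (He2 : 0 < eps / 2 / K) by (apply Rdiv_lt_0_compat; lra).
generalize (filter_and _ _ HB (filter_and _ _ (Hf _ He2) (Hm _ He1))).
apply filter_imp; intros i [H1 [H2 H3]].
replace (P i (f i) - m)%V with (P i (f i - l) + (P i l - m))%V.
- eapply Rle_lt_trans; [apply norm_triangleX|].
  generalize (bnd_le _ _ _ _ H1 (Rlt_le _ _ HK) (Rlt_le _ _ H2)).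
  replace (K * (eps / 2 / K)) with (eps / 2) by (field; lra); lra.
- rewrite (lin_minus (P i)) by apply HP; vec.
Qed.

Lemma tends_scal_fun (a : I -> C) b f l :
  (forall eps, 0 < eps -> F (fun i => Cmod (a i - b) < eps)) -> tends F f l ->
  tends F (fun i => a i *: f i)%V (b *: l)%V.
Proof.
intros Ha Hf eps Heps.
assert (Hb := Cmod_ge_0 b); assert (Hl := norm_ge_0 l).
assert (H1 : 0 < eps / 2 / (Cmod b + 1)) by (apply Rdiv_lt_0_compat; lra).
assert (H2 : 0 < Rmin 1 (eps / 2 / (norm l + 1))).
{ apply Rmin_glb_lt; [lra | apply Rdiv_lt_0_compat; lra]. }
generalize (filter_and _ _ (Hf _ H1) (Ha _ H2)); apply filter_imp; intros i [B1 B2].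
apply Rmin_Rgt_l in B2; destruct B2 as [B2 B3].
replace (a i *: f i - b *: l)%V with (a i *: (f i - l) + (a i - b) *: l)%V by vec.
assert (B4 : Cmod (a i) <= Cmod b + 1).
{ replace (a i) with (b + (a i - b))%C by ring.
  eapply Rle_trans; [apply Cmod_triangle|]; lra. }
eapply Rle_lt_trans; [apply norm_triangleX|]; rewrite !norm_scalC.
assert (B5 : Cmod (a i) * norm (f i - l)%V <= (Cmod b + 1) * (eps / 2 / (Cmod b + 1))).
{ apply Rle_trans with ((Cmod b + 1) * norm (f i - l)%V).
  - apply Rmult_le_compat_r; [apply norm_ge_0 | exact B4].
  - apply Rmult_le_compat_l; lra. }
assert (B6 : Cmod (a i - b) * norm l < (eps / 2 / (norm l + 1)) * (norm l + 1)).
{ apply Rle_lt_trans with (Cmod (a i - b) * (norm l + 1)).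
  - apply Rmult_le_compat_l; [apply Cmod_ge_0 | lra].
  - apply Rmult_lt_compat_r; lra. }
replace ((Cmod b + 1) * (eps / 2 / (Cmod b + 1))) with (eps / 2) in B5 by (field; lra).
replace (eps / 2 / (norm l + 1) * (norm l + 1)) with (eps / 2) in B6 by (field; lra).
lra.
Qed.

End Tends.

Section TendsProper.
Context {I : Type} (F : (I -> Prop) -> Prop) {FF : ProperFilter F}.

Lemma tends_le f l C : tends F f l -> F (fun i => norm (f i) <= C) -> norm l <= C.
Proof.
intros Hf HC; apply le_epsilon; intros eps Heps.
destruct (filter_ex _ (filter_and _ _ (Hf _ Heps) HC)) as [i [H1 H2]].
replace l with (f i - (f i - l))%V by vec.
eapply Rle_trans; [apply (norm_minus_le _ _ _ _ H2 (Rlt_le _ _ H1))|]; lra.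
Qed.

Lemma tends_unique f l m : tends F f l -> tends F f m -> l = m.
Proof.
intros Hl Hm; apply eq_of_small; intros eps Heps.
apply (tends_le (fun i => f i - f i)%V); [now apply (tends_minus F)|].
apply filter_forall; intros i; rewrite norm_minus_diag; lra.
Qed.

Lemma tends_Cauchy (f : I -> X) :
  (forall eps, 0 < eps -> exists P, F P /\ forall u v, P u -> P v ->
     norm (f u - f v)%V < eps) -> exists l, tends F f l.
Proof.
intros H.
assert (Hc : forall eps : posreal, exists P, F P /\
   forall u v, P u -> P v -> ball (f u) eps (f v)).
{ intros eps; destruct (H eps (cond_pos eps)) as [P [HP1 HP2]].
  exists P; split; [exact HP1|]; intros u v Hu Hv.
  exact (norm_compat1 (V := CompleteNormedModule.NormedModule C_AbsRing X) (f u) (f v) eps (HP2 v u Hv Hu)). }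
apply (filterlim_locally_cauchy (U := X) f) in Hc; destruct Hc as [l Hl].
exists l; apply tends_filterlim; [apply FF | exact Hl].
Qed.

End TendsProper.

Lemma geom_small C eps : 0 < eps -> exists N, forall n, (N <= n)%nat -> C / 2 ^ n < eps.
Proof.
intros Heps.
destruct (Pow_x_infinity 2) with (b := Rabs C / eps + 1) as [N HN];
  [rewrite Rabs_right; lra|].
exists N; intros n Hn; specialize (HN n Hn).
assert (H2 : 0 < 2 ^ n) by (apply pow_lt; lra).
rewrite Rabs_right in HN by lra.
apply (Rmult_lt_reg_r (2 ^ n)); [exact H2|].
unfold Rdiv; rewrite Rmult_assoc, Rinv_l, Rmult_1_r by lra.
apply Rle_lt_trans with (Rabs C); [apply Rle_abs|].
replace (Rabs C) with (eps * (Rabs C / eps)) by (field; lra).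
apply Rmult_lt_compat_l; lra.
Qed.

Lemma geom_telescope (u : nat -> X) C N k :
  (forall n, norm (u (S n) - u n)%V <= C / 2 ^ n) -> 0 <= C ->
  norm (u (k + N)%nat - u N)%V <= 2 * C / 2 ^ N - 2 * C / 2 ^ (k + N).
Proof.
intros H HC; induction k as [|k IH]; simpl.
- rewrite norm_minus_diag; lra.
- replace (u (S (k + N)) - u N)%V with ((u (S (k + N)) - u (k + N)%nat) + (u (k + N)%nat - u N))%V by vec.
  eapply Rle_trans; [apply norm_plus_le; [apply H | apply IH]|].
  assert (0 < 2 ^ (k + N)) by (apply pow_lt; lra).
  right; field; split; apply Rgt_not_eq, pow_lt; lra.
Qed.

Lemma geom_converges (u : nat -> X) C :
  (forall n, norm (u (S n) - u n)%V <= C / 2 ^ n) ->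
  exists l, tends eventually u l /\ forall n, norm (l - u n)%V <= 2 * C / 2 ^ n.
Proof.
intros H.
assert (HC : 0 <= C).
{ generalize (H O) (norm_ge_0 (u 1%nat - u O)%V); simpl; lra. }
assert (H' : forall N n, (N <= n)%nat -> norm (u n - u N)%V <= 2 * C / 2 ^ N).
{ intros N n Hn; replace n with ((n - N) + N)%nat by lia.
  eapply Rle_trans; [apply (geom_telescope u C); assumption|].
  assert (0 <= 2 * C / 2 ^ (n - N + N)).
  { apply Rmult_le_pos; [lra|]; left; apply Rinv_0_lt_compat, pow_lt; lra. }
  lra. }
destruct (tends_Cauchy eventually u) as [l Hl].
- intros eps Heps; destruct (geom_small (2 * C) (eps / 2)) as [N HN]; [lra|].
  exists (fun n => (N <= n)%nat); split; [now exists N|].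
  intros m n Hm Hn; replace (u m - u n)%V with ((u m - u N) - (u n - u N))%V by vec.
  eapply Rle_lt_trans; [apply norm_minus_le; apply H'; assumption|].
  generalize (HN N (le_n N)); lra.
- exists l; split; [exact Hl|]; intros n.
  apply (tends_le eventually (fun m => u m - u n)%V).
  + apply (tends_minus eventually); [exact Hl | apply (tends_const eventually)].
  + exists n; intros m Hm; now apply H'.
Qed.

Lemma near_identity_surjective (V : X -> X) q : lin V -> bnd V q -> q <= / 2 ->
  forall y, exists x, (x - V x)%V = y.
Proof.
intros HV Hq Hq2 y.
pose (u := fun n => Nat.iter n (fun x => y + V x)%V y).
destruct (geom_converges u (norm y)) as [l [Hl _]].
- intros n; induction n as [|n IH]; simpl.
  + replace (y + V y - y)%V with (V y) by vec.
    generalize (Hq y) (norm_ge_0 y); nra.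
  + replace (y + V (y + V (u n)) - (y + V (u n)))%V with (V (u (S n) - u n)%V).
    2: { rewrite lin_minus by exact HV; unfold u; simpl; vec. }
    eapply Rle_trans; [apply Hq|].
    apply Rle_trans with (/ 2 * (norm y / 2 ^ n)).
    * generalize (norm_ge_0 (u (S n) - u n)%V); nra.
    * right; field; apply pow_nonzero; lra.
- exists l.
  assert (E : (y + V l)%V = l).
  { apply (tends_unique eventually (fun n => u (S n))).
    - apply (tends_plus eventually); [apply (tends_const eventually)|].
      now apply (tends_lin eventually V q).
    - intros eps Heps; destruct (Hl eps Heps) as [N HN]; exists N.
      intros n Hn; apply HN; lia. }
  rewrite <- E at 1; vec.
Qed.

(** Gliding hump (after Sokal): since [2 T xi = T (x + xi) - T (x - xi)], one
    of [x + xi], [x - xi] has a large image when [xi] does. *)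
Lemma uniform_boundedness {I} (T : I -> X -> X) :
  (forall i, lin (T i)) -> (forall i, exists K, bnd (T i) K) ->
  (forall x, exists C, forall i, norm (T i x) <= C) ->
  exists M, forall i, bnd (T i) M.
Proof.
intros HT HB HP; apply NNPP; intros Hn.
assert (Hbig : forall k r, 0 < r -> exists i xi, norm xi <= r /\ k <= norm (T i xi)).
{ intros k r Hr; apply NNPP; intros Hk; apply Hn.
  exists (Rabs k / r); intros i x.
  destruct (Req_dec (norm x) 0) as [H0|H0].
  - assert (x = 0%V) as -> by exact (norm_eq_zero x H0).
    rewrite lin_zero, norm_zeroX by apply HT; lra.
  - generalize (norm_ge_0 x); intros H1.
    apply Rnot_lt_le; intros H; apply Hk.
    exists i, (RtoC (r / norm x) *: x)%V.
    assert (Hp : 0 < r / norm x) by (apply Rdiv_lt_0_compat; lra).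
    rewrite lin_scal, !norm_scalC, Cmod_R, Rabs_right by (try apply HT; lra).
    split; [right; field; lra|].
    apply Rle_trans with (Rabs k); [apply Rle_abs|].
    apply Rle_trans with (r / norm x * (Rabs k / r * norm x)); [right; field; lra|].
    apply Rmult_le_compat_l; lra. }
assert (Hstep : forall s : nat * (X * R), exists t : X * R,
   0 < snd (snd s) -> 0 < snd t <= snd (snd s) / 2 /\
   norm (fst t - fst (snd s))%V <= snd (snd s) /\
   exists i, INR (fst s) <= norm (T i (fst t)) /\
     forall y, norm y <= 2 * snd t -> norm (T i y) <= 1).
{ intros [k [x r]]; simpl.
  destruct (Rle_dec r 0) as [Hr|Hr]; [exists (x, r); lra|].
  destruct (Hbig (INR k) r) as (i & xi & H1 & H2); [lra|].
  destruct (HB i) as [K HK].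
  assert (Hx : exists x', norm (x' - x)%V <= r /\ INR k <= norm (T i x')).
  { destruct (Rle_dec (INR k) (norm (T i (x + xi)%V))) as [H3|H3].
    - exists (x + xi)%V; split; [|exact H3].
      now replace (x + xi - x)%V with xi by vec.
    - exists (x - xi)%V; split.
      + replace (x - xi - x)%V with (opp xi) by vec; now rewrite norm_oppX.
      + apply Rnot_lt_le; intros H4.
        assert (H5 : (T i (x + xi) - T i (x - xi) = RtoC 2 *: T i xi)%V).
        { rewrite lin_plus, lin_minus by apply HT; vec. }
        assert (H6 : norm (T i (x + xi) - T i (x - xi))%V <=
           norm (T i (x + xi)%V) + norm (T i (x - xi)%V)).
        { apply norm_minus_le; lra. }
        rewrite H5, norm_scalC, Cmod_R, Rabs_right in H6; lra. }
  destruct Hx as (x' & H3 & H4).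
  assert (Hp : 0 < / (2 * (Rabs K + 1))) by
    (apply Rinv_0_lt_compat; generalize (Rabs_pos K); lra).
  exists (x', Rmin (r / 2) (/ (2 * (Rabs K + 1)))); simpl; intros _; repeat split.
  - apply Rmin_glb_lt; lra.
  - apply Rmin_l.
  - exact H3.
  - exists i; split; [exact H4|]; intros y Hy.
    eapply Rle_trans; [apply HK|].
    assert (H5 : norm y <= / (Rabs K + 1)).
    { eapply Rle_trans; [exact Hy|].
      eapply Rle_trans; [apply Rmult_le_compat_l; [lra | apply Rmin_r]|].
      right; field; generalize (Rabs_pos K); lra. }
    generalize (Rabs_pos K) (Rle_abs K) (norm_ge_0 y); intros.
    apply Rle_trans with ((Rabs K + 1) * norm y); [apply Rmult_le_compat_r; lra|].
    apply Rle_trans with ((Rabs K + 1) * / (Rabs K + 1)); [apply Rmult_le_compat_l; lra|].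
    rewrite Rinv_r; lra. }
destruct (choice _ Hstep) as [f Hf].
pose (s := fix s n := match n with O => (0%V : X, 1) | S n => f (n, s n) end).
assert (Hr : forall n, 0 < snd (s n) <= 1 / 2 ^ n).
{ induction n as [|n IH]; [simpl; lra|].
  destruct (Hf (n, s n)) as [H1 _]; [apply IH|]; simpl snd in H1.
  change (s (S n)) with (f (n, s n)).
  split; [apply H1|]; eapply Rle_trans; [apply H1|].
  simpl.
  replace (1 / (2 * 2 ^ n)) with (1 / 2 ^ n / 2) by (field; apply pow_nonzero; lra).
  lra. }
destruct (geom_converges (fun n => fst (s n)) 1) as [x [Hx _]].
{ intros n; destruct (Hf (n, s n)) as [_ [H1 _]]; [apply Hr|].
  eapply Rle_trans; [exact H1 | apply Hr]. }
destruct (HP x) as [C HC].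
destruct (nfloor_ex (Rabs C + 1)) as [k0 Hk0]; [generalize (Rabs_pos C); lra|].
set (k := S (S k0)).
assert (Hk : Rabs C + 1 < INR k - 1) by (unfold k; rewrite !S_INR; lra).
destruct (Hf (k, s k)) as [_ [_ [i [H1 H2]]]]; [apply Hr|].
assert (Hd : norm (x - fst (s (S k)))%V <= 2 * snd (s (S k))).
{ apply (tends_le eventually (fun n => fst (s n) - fst (s (S k)))%V).
  - apply (tends_minus eventually); [exact Hx | apply (tends_const eventually)].
  - exists (S k); intros n Hkn.
    enough (Hj : forall j, norm (fst (s (j + S k)%nat) - fst (s (S k)))%V <=
       2 * snd (s (S k)) - 2 * snd (s (j + S k)%nat)).
    { specialize (Hj (n - S k)%nat); replace (n - S k + S k)%nat with n in Hj by lia.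
      generalize (proj1 (Hr n)); lra. }
    induction j as [|j IH]; [simpl (0 + _)%nat; rewrite norm_minus_diag; lra|].
    destruct (Hf (j + S k, s (j + S k))%nat) as [H3 [H4 _]]; [apply Hr|].
    simpl snd in H3, H4; simpl fst in H4.
    replace (fst (s (S j + S k)%nat) - fst (s (S k)))%V with
      ((fst (s (S j + S k)%nat) - fst (s (j + S k)%nat)) + (fst (s (j + S k)%nat) - fst (s (S k))))%V by vec.
    eapply Rle_trans; [apply norm_plus_le; [exact H4 | exact IH]|].
    change (s (S j + S k)%nat) with (f ((j + S k)%nat, s (j + S k)%nat)); lra. }
specialize (H2 _ Hd).
assert (H1' : INR k <= norm (T i (fst (s (S k))))) by exact H1.
rewrite lin_minus in H2 by apply HT.
assert (H3 : norm (T i (fst (s (S k)))) <= norm (T i x) + 1).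
{ replace (T i (fst (s (S k)))) with (T i x - (T i x - T i (fst (s (S k)))))%V by vec.
  apply norm_minus_le; [lra | exact H2]. }
generalize (HC i) (Rle_abs C); lra.
Qed.

End Basics.

(** * Power boundedness under Ritt's resolvent condition *)

Lemma one_plus_inv_pow_le (n : nat) : (1 <= n)%nat -> (1 + / INR n) ^ n <= 3.
Proof.
intros Hn; assert (H : 0 < INR n) by (apply lt_0_INR; lia).
apply Rle_trans with (exp 1); [|apply exp_le_3].
replace 1 with (INR n * / INR n) at 2 by (field; lra).
apply Rle_trans with (exp (/ INR n) ^ n).
- apply pow_incr; split; [|apply exp_ineq1_le].
  generalize (Rinv_0_lt_compat _ H); lra.
- rewrite <- (Rpower_pow n) by apply exp_pos.
  unfold Rpower; rewrite ln_exp; right; reflexivity.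
Qed.

Definition om (N : nat) : C := (cos (2 * PI / INR N), sin (2 * PI / INR N)).

Lemma cis_pow t n : ((cos t, sin t) ^ n)%C = (cos (INR n * t), sin (INR n * t)).
Proof.
induction n as [|n IH].
- simpl; rewrite Rmult_0_l, cos_0, sin_0; reflexivity.
- rewrite Cpow_S, IH, S_INR, Rmult_plus_distr_r, Rmult_1_l, Rplus_comm.
  rewrite cos_plus, sin_plus; unfold Cmult; simpl; f_equal; ring.
Qed.

Lemma om_pow_N N : (1 <= N)%nat -> (om N ^ N)%C = RtoC 1.
Proof.
intros HN; unfold om; rewrite cis_pow.
replace (INR N * (2 * PI / INR N)) with (2 * PI)
  by (field; apply not_0_INR; lia).
now rewrite cos_2PI, sin_2PI.
Qed.

Lemma Cmod_om N : Cmod (om N) = 1.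
Proof.
unfold om, Cmod; simpl fst; simpl snd.
generalize (sin2_cos2 (2 * PI / INR N)); unfold Rsqr; intros H.
replace (_ ^ 2 + _ ^ 2) with 1 by (rewrite <- H; ring); apply sqrt_1.
Qed.

Lemma om_pow_neq_1 N p : (0 < p < N)%nat -> (om N ^ p)%C <> RtoC 1.
Proof.
intros Hp H; unfold om in H; rewrite cis_pow in H.
injection H as H1 H2.
assert (HN : 0 < INR N) by (apply lt_0_INR; lia).
assert (Hp0 : 0 < INR p) by (apply lt_0_INR; lia).
assert (HpN : INR p < INR N) by (apply lt_INR; lia).
set (t := INR p * (2 * PI / INR N)) in *.
assert (Ht : 0 < t / 2 < PI).
{ assert (E : t / 2 = PI * (INR p / INR N)) by (unfold t; field; lra).
  assert (0 < INR p / INR N < 1).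
  { split; [now apply Rdiv_lt_0_compat|].
    apply (Rmult_lt_reg_r (INR N)); [lra|]; field_simplify; lra. }
  rewrite E; generalize PI_RGT_0; intros; nra. }
generalize (sin_gt_0 _ (proj1 Ht) (proj2 Ht)); intros Hs.
replace t with (2 * (t / 2)) in H1 by field.
rewrite cos_2a_sin in H1; nra.
Qed.

Lemma Cmod_1_sub_om_pow N n : (6 * n <= N)%nat ->
  Cmod (1 - om N) * INR n / 2 <= Cmod (1 - om N ^ n).
Proof.
intros Hn.
assert (H : forall k, (k <= n)%nat -> exists s, (1 - om N ^ k = (1 - om N) * s)%C /\
   INR k / 2 <= Re s).
{ induction k as [|k IH]; intros Hk.
  - exists (RtoC 0); split; [simpl; ring | simpl; lra].
  - destruct IH as [s [Hs1 Hs2]]; [lia|].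
    exists (s + om N ^ k)%C; split.
    + rewrite Cpow_S; transitivity ((1 - om N ^ k) + om N ^ k * (1 - om N))%C; [ring|].
      rewrite Hs1; ring.
    + rewrite S_INR; change (Re (s + om N ^ k)) with (Re s + Re (om N ^ k)).
      enough (/ 2 <= Re (om N ^ k)) by lra.
      unfold om; rewrite cis_pow; simpl Re.
      assert (HN : 0 < INR N) by (apply lt_0_INR; lia).
      assert (Hk6 : 6 * INR k <= INR N).
      { replace 6 with (INR 6) by (simpl; lra); rewrite <- mult_INR; apply le_INR; lia. }
      generalize (pos_INR k) PI_RGT_0; intros.
      replace (/ 2) with (cos (PI / 3)) by (rewrite cos_PI3; lra).
      assert (E : INR k * (2 * PI / INR N) = PI / 3 * (6 * INR k / INR N)) by (field; lra).
      assert (0 <= 6 * INR k / INR N <= 1).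
      { split; [apply Rmult_le_pos; [lra | left; now apply Rinv_0_lt_compat]|].
        apply (Rmult_le_reg_r (INR N)); [lra|]; field_simplify; lra. }
      rewrite E; apply cos_decr_1; nra. }
destruct (H n (le_n n)) as [s [Hs1 Hs2]].
rewrite Hs1, Cmod_mult; unfold Rdiv; rewrite Rmult_assoc.
apply Rmult_le_compat_l; [apply Cmod_ge_0|].
eapply Rle_trans; [exact Hs2|].
eapply Rle_trans; [apply Rle_abs | apply re_le_Cmod].
Qed.

Lemma Cmod_1_minus w : Cmod w < 1 -> 0 < Cmod (1 - w).
Proof.
intros H; generalize (Cmod_triangle (1 - w)%C w).
replace (1 - w + w)%C with (RtoC 1) by ring; rewrite Cmod_1; lra.
Qed.

Section Ritt.
Context {X : CompleteNormedModule C_AbsRing}.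
Implicit Types x y z : X.

Record ritt (K : R) (E : X -> X) (Rw : C -> X -> X) : Prop := {
  ritt_ge_1 : 1 <= K;
  ritt_lin : lin E;
  ritt_bnd : bnd E K;
  ritt_Rlin : forall w, Cmod w < 1 -> lin (Rw w);
  ritt_eq : forall w x, Cmod w < 1 -> Rw w x = (x + w *: E (Rw w x))%V;
  ritt_comm : forall w x, Cmod w < 1 -> E (Rw w x) = Rw w (E x);
  ritt_Rbnd : forall w, Cmod w < 1 -> bnd (Rw w) (K / Cmod (1 - w))
}.

Section OneOperator.
Variables (K : R) (E : X -> X) (Rw : C -> X -> X).
Hypothesis H : ritt K E Rw.

Lemma ritt_left_inverse w x : Cmod w < 1 -> Rw w (x - w *: E x)%V = x.
Proof.
intros Hw; assert (Hl := ritt_Rlin _ _ _ H w Hw).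
rewrite lin_minus, lin_scal by exact Hl.
rewrite (ritt_eq _ _ _ H w x Hw) at 1.
rewrite <- (ritt_comm _ _ _ H w x Hw); vec.
Qed.

Lemma ritt_Rcomm v w x : Cmod v < 1 -> Cmod w < 1 -> Rw v (Rw w x) = Rw w (Rw v x).
Proof.
intros Hv Hw; assert (Hlv := ritt_Rlin _ _ _ H v Hv).
rewrite <- (ritt_left_inverse w (Rw v (Rw w x))) by exact Hw.
f_equal; rewrite (ritt_comm _ _ _ H v) by exact Hv.
rewrite <- lin_scal, <- lin_minus by exact Hlv; f_equal.
rewrite (ritt_eq _ _ _ H w x Hw) at 1; vec.
Qed.

Lemma ritt_resolvent v w x : Cmod v < 1 -> Cmod w < 1 ->
  (Rw v x - Rw w x = (v - w) *: E (Rw v (Rw w x)))%V.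
Proof.
intros Hv Hw; assert (Hlv := ritt_Rlin _ _ _ H v Hv).
rewrite (ritt_comm _ _ _ H v) by exact Hv.
set (u := Rw w x).
assert (Hx : x = ((u - v *: E u) + (v - w) *: E u)%V).
{ unfold u; rewrite (ritt_eq _ _ _ H w x Hw) at 1; vec. }
rewrite Hx at 1; rewrite (lin_plus (Rw v)), (lin_scal (Rw v)) by exact Hlv.
rewrite ritt_left_inverse by exact Hv; vec.
Qed.

End OneOperator.

Section RootsOfUnity.
Variables (N : nat) (r : R).
Hypothesis HN : (1 <= N)%nat.
Hypothesis Hr : 0 < r < 1.

Definition wt (j : nat) : C := (RtoC r * om N ^ j)%C.

Lemma wt_S j : wt (S j) = (om N * wt j)%C.
Proof. unfold wt; rewrite Cpow_S; ring. Qed.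

Lemma Cmod_wt j : Cmod (wt j) = r.
Proof.
unfold wt; rewrite Cmod_mult, Cmod_pow, Cmod_om, pow1, Cmod_R, Rabs_right; lra.
Qed.

Lemma wt_lt_1 j : Cmod (wt j) < 1.
Proof. rewrite Cmod_wt; lra. Qed.

Lemma wt_N : wt N = wt 0.
Proof. unfold wt; now rewrite om_pow_N by exact HN. Qed.

Lemma wt_pow_N j : (wt j ^ N)%C = RtoC (r ^ N).
Proof.
unfold wt; rewrite Cpow_mult_l, <- RtoC_pow, <- Cpow_mult_r, Nat.mul_comm.
rewrite Cpow_mult_r, om_pow_N, Cpow_1_l by exact HN; ring.
Qed.

Lemma vsum_wt_pow p x : (0 < p < N)%nat -> vsum (fun j => wt j ^ p *: x)%V N = 0%V.
Proof.
intros Hp; set (S0 := vsum _ N).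
assert (Hs : (om N ^ p *: S0 = S0)%V).
{ unfold S0 at 2; rewrite <- vsum_cyclic.
  2: { now rewrite wt_N. }
  unfold S0; rewrite <- vsum_scal; apply vsum_ext; intros j _.
  rewrite wt_S, Cpow_mult_l; vec. }
assert (Hne : (om N ^ p - 1)%C <> RtoC 0).
{ intros H0; apply (om_pow_neq_1 N p Hp).
  replace (om N ^ p)%C with ((om N ^ p - 1) + 1)%C by ring; rewrite H0; ring. }
replace S0 with (/ (om N ^ p - 1) *: (om N ^ p *: S0 - S0))%V by (vecf; exact Hne).
rewrite Hs; vec.
Qed.

Section Moments.
Variables (K : R) (E : X -> X) (Rw : C -> X -> X).
Hypothesis H : ritt K E Rw.

Definition mom p x := vsum (fun j => wt j ^ p *: Rw (wt j) x)%V N.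

Lemma mom_step p x : (0 < p < N)%nat -> mom p x = E (mom (S p) x).
Proof.
intros Hp; unfold mom.
rewrite <- vsum_lin by apply H.
transitivity (vsum (fun j => wt j ^ p *: x + E (wt j ^ S p *: Rw (wt j) x))%V N).
- apply vsum_ext; intros j _.
  rewrite (ritt_eq _ _ _ H) at 1 by apply wt_lt_1.
  rewrite (lin_scal E), Cpow_S by apply H; vec.
- rewrite vsum_plus, vsum_wt_pow by exact Hp; vec.
Qed.

Lemma vsum_const x n : vsum (fun _ => x) n = (RtoC (INR n) *: x)%V.
Proof.
induction n as [|n IH]; simpl vsum; [simpl; vec|].
rewrite IH, S_INR, RtoC_plus; vec.
Qed.

Lemma mom_0 x : mom 0 x = (RtoC (INR N) *: x + E (mom 1 x))%V.
Proof.
unfold mom; rewrite <- vsum_lin by apply H.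
rewrite <- vsum_const, <- vsum_plus; apply vsum_ext; intros j _.
rewrite (ritt_eq _ _ _ H) at 1 by apply wt_lt_1.
rewrite (lin_scal E) by apply H; simpl Cpow; vec.
Qed.

Lemma mom_N x : mom N x = (RtoC (r ^ N) *: mom 0 x)%V.
Proof.
unfold mom; rewrite <- vsum_scal; apply vsum_ext; intros j _.
rewrite wt_pow_N; simpl Cpow; vec.
Qed.

Lemma mom_iter n x : (n < N)%nat -> mom (N - n) x = Nat.iter n E (mom N x).
Proof.
induction n as [|n IH]; intros Hn; [now rewrite Nat.sub_0_r|].
rewrite mom_step by lia.
replace (S (N - S n)) with (N - n)%nat by lia; rewrite IH by lia; reflexivity.
Qed.

Lemma mom_0_eq x :
  mom 0 x = (RtoC (INR N) *: x + RtoC (r ^ N) *: Nat.iter N E (mom 0 x))%V.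
Proof.
rewrite mom_0 at 1; f_equal.
assert (HlE : lin E) by apply H.
rewrite <- (lin_scal (Nat.iter N E)), <- mom_N by (apply lin_iter; exact HlE).
destruct N as [|[|m]] eqn:EN; [lia | reflexivity |].
rewrite <- EN in *.
replace 1%nat with (N - (S m))%nat by lia; rewrite mom_iter by lia.
rewrite EN; reflexivity.
Qed.

Lemma mom_identity n x : (0 < n < N)%nat ->
  (RtoC (INR N * r ^ N) *: Nat.iter n E x =
     mom (N - n) x - RtoC (r ^ N) *: Nat.iter N E (mom (N - n) x))%V.
Proof.
intros Hn; assert (HlE : lin E) by apply H.
rewrite mom_iter, mom_N by lia.
rewrite (lin_scal (Nat.iter n E)) by (apply lin_iter; exact HlE).
rewrite (lin_scal (Nat.iter N E)) by (apply lin_iter; exact HlE).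
rewrite <- iter_add, Nat.add_comm, iter_add.
assert (E0 := mom_0_eq x).
set (m0 := mom 0 x) in *.
transitivity (RtoC (r ^ N) *: Nat.iter n E (m0 - RtoC (r ^ N) *: Nat.iter N E m0))%V.
- replace (m0 - RtoC (r ^ N) *: Nat.iter N E m0)%V with (RtoC (INR N) *: x)%V.
  + rewrite (lin_scal (Nat.iter n E)), RtoC_mult by (apply lin_iter; exact HlE); vec.
  + rewrite E0 at 1; vec.
- rewrite (lin_minus (Nat.iter n E)), (lin_scal (Nat.iter n E))
    by (apply lin_iter; exact HlE); vec.
Qed.

Definition mom2 p x :=
  vsum (fun j => wt j ^ p *: E (Rw (wt j) (Rw (wt (S j)) x)))%V N.

Definition mom3 p x :=
  vsum (fun j => wt j ^ p *:
    E (E (Rw (wt j) (Rw (wt (S j)) (Rw (wt (S (S j))) x)))))%V N.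

Lemma wt_cyclic p (c : C -> X) :
  vsum (fun j => wt (S j) ^ p *: c (wt (S j)))%V N = vsum (fun j => wt j ^ p *: c (wt j))%V N.
Proof.
apply (vsum_cyclic (fun j => wt j ^ p *: c (wt j))%V).
now rewrite wt_N.
Qed.

(** Summation by parts: the resolvent identity turns the difference of two
    neighbouring resolvents into a small multiple of their product. *)
Lemma mom_parts p x : 
  ((om N ^ p - 1) *: mom p x = ((1 - om N) * om N ^ p) *: mom2 (S p) x)%V.
Proof.
transitivity (om N ^ p *: mom p x - mom p x)%V; [vec|].
unfold mom at 2; rewrite <- (wt_cyclic p (fun w => Rw w x)).
unfold mom, mom2; rewrite <- !vsum_scal, <- vsum_minus.
apply vsum_ext; intros j _.
transitivity (wt (S j) ^ p *: (Rw (wt j) x - Rw (wt (S j)) x))%V.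
{ rewrite wt_S, !Cpow_mult_l; vec. }
rewrite (ritt_resolvent K E Rw H) by apply wt_lt_1.
rewrite wt_S, Cpow_mult_l, Cpow_S; vec.
Qed.

Lemma mom2_parts p x : 
  ((om N ^ p - 1) *: mom2 p x = ((1 - om N ^ 2) * om N ^ p) *: mom3 (S p) x)%V.
Proof.
transitivity (om N ^ p *: mom2 p x - mom2 p x)%V; [vec|].
unfold mom2 at 2.
rewrite (vsum_ext _ (fun j => wt j ^ p *: E (Rw (wt j) (Rw (om N * wt j)%C x)))%V)
  by (intros; rewrite wt_S; reflexivity).
rewrite <- (wt_cyclic p (fun w => E (Rw w (Rw (om N * w)%C x)))).
unfold mom2, mom3; rewrite <- !vsum_scal, <- vsum_minus.
apply vsum_ext; intros j _.
rewrite <- (wt_S (S j)).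
assert (HlE : lin E) by apply H.
rewrite (ritt_Rcomm K E Rw H (wt j)) by apply wt_lt_1.
transitivity (wt (S j) ^ p *: E (Rw (wt (S j)) (Rw (wt j) x - Rw (wt (S (S j))) x)))%V.
{ rewrite (lin_minus (Rw (wt (S j)))) by apply (ritt_Rlin _ _ _ H _ (wt_lt_1 _)).
  rewrite (lin_minus E) by exact HlE.
  rewrite wt_S, !Cpow_mult_l; vec. }
rewrite (ritt_resolvent K E Rw H) by apply wt_lt_1.
rewrite (lin_scal (Rw (wt (S j)))) by apply (ritt_Rlin _ _ _ H _ (wt_lt_1 _)).
rewrite <- (ritt_comm _ _ _ H) by apply wt_lt_1.
rewrite (ritt_Rcomm K E Rw H (wt (S j)) (wt j)) by apply wt_lt_1.
rewrite (lin_scal E) by exact HlE.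
rewrite !wt_S, Cpow_mult_l, Cpow_S; simpl Cpow; vec.
Qed.

End Moments.
End RootsOfUnity.
End Ritt.

Lemma Cmod_sqr_alt z : Cmod z ^ 2 = fst z ^ 2 + snd z ^ 2.
Proof. exact (Cmod2_alt z). Qed.

Lemma Re_inv_1_minus (w : C) : Cmod w < 1 ->
  / Cmod (1 - w) ^ 2 = (2 * Re (/ (1 - w)) - 1) / (1 - Cmod w ^ 2).
Proof.
intros Hw; assert (H1 := Cmod_1_minus w Hw); assert (Hw0 := Cmod_ge_0 w).
assert (H2 : 1 - Cmod w ^ 2 <> 0) by nra.
assert (H3 : Cmod (1 - w) ^ 2 <> 0) by nra.
assert (H4 : Re (/ (1 - w)) = (1 - Re w) / Cmod (1 - w) ^ 2).
{ rewrite Cmod_sqr_alt; destruct w as [a b]; simpl; unfold Rdiv; f_equal; ring. }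
assert (H5 : 2 * (1 - Re w) - Cmod (1 - w) ^ 2 = 1 - Cmod w ^ 2).
{ rewrite !Cmod_sqr_alt; destruct w as [a b]; simpl; ring. }
rewrite H4; replace (2 * ((1 - Re w) / Cmod (1 - w) ^ 2) - 1)
  with ((2 * (1 - Re w) - Cmod (1 - w) ^ 2) / Cmod (1 - w) ^ 2) by (field; nra).
rewrite H5; field; split; [nra | exact H2].
Qed.

Lemma rsum_le f g n : (forall i, (i < n)%nat -> f i <= g i) -> rsum f n <= rsum g n.
Proof.
induction n as [|n IH]; intros H; simpl; [lra|].
apply Rplus_le_compat; [apply IH; intros; apply H; lia | apply H; lia].
Qed.

Lemma rsum_ext f g n : (forall i, (i < n)%nat -> f i = g i) -> rsum f n = rsum g n.
Proof.
induction n as [|n IH]; intros H; simpl; [reflexivity|].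
now rewrite IH, H by (intros; try apply H; lia).
Qed.

Lemma rsum_shift f n : rsum (fun i => f (S i)) n + f O = rsum f n + f n.
Proof. induction n as [|n IH]; simpl; [reflexivity|]; lra. Qed.

Lemma rsum_scal c f n : rsum (fun i => c * f i) n = c * rsum f n.
Proof. induction n as [|n IH]; simpl; [ring|]. rewrite IH; ring. Qed.

Lemma rsum_plus f g n : rsum (fun i => f i + g i) n = rsum f n + rsum g n.
Proof. induction n as [|n IH]; simpl; [ring|]. rewrite IH; ring. Qed.

Lemma scalar_ritt :
  ritt (X := C_CompleteNormedModule) 1 (fun z => z) (fun w z => (/ (1 - w) * z)%C).
Proof.
assert (Hne : forall w, Cmod w < 1 -> (1 - w)%C <> RtoC 0).
{ intros w Hw; apply Cmod_gt_0, Cmod_1_minus, Hw. }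
split.
- lra.
- now split.
- intros x; rewrite Rmult_1_l; apply Rle_refl.
- intros w Hw; split; intros.
  + change (/ (1 - w) * (x + y) = / (1 - w) * x + / (1 - w) * y)%C; ring.
  + change (/ (1 - w) * (c * x) = c * (/ (1 - w) * x))%C; ring.
- intros w x Hw.
  change (/ (1 - w) * x = x + w * (/ (1 - w) * x))%C; field; now apply Hne.
- reflexivity.
- intros w Hw x; unfold Rdiv; rewrite Rmult_1_l, <- Cmod_inv by now apply Hne.
  right; exact (Cmod_mult (/ (1 - w)) x).
Qed.

Section Estimates.
Variables (N : nat) (r : R).
Hypothesis HN : (1 <= N)%nat.
Hypothesis Hr : 0 < r < 1.
Hypothesis HrN : r ^ N <= / 2.
Local Notation w := (wt N r).

Lemma sum_Re_inv :
  rsum (fun j => Re (/ (1 - w j))) N = INR N / (1 - r ^ N).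
Proof.
assert (H := mom_0_eq (X := C_CompleteNormedModule) N r HN Hr _ _ _ scalar_ritt (RtoC 1)).
set (m := mom N r (fun v z => (/ (1 - v) * z)%C) 0 (RtoC 1 : C_CompleteNormedModule)) in H.
assert (Hid : forall n (z : C), Nat.iter n (fun z : C => z) z = z).
{ induction n as [|n IH]; intros z; [reflexivity | apply IH]. }
rewrite Hid in H.
change (m = RtoC (INR N) * RtoC 1 + RtoC (r ^ N) * m)%C in H.
assert (HR : rsum (fun j => Re (/ (1 - w j))) N = Re m).
{ assert (Hs : forall (f : nat -> C_CompleteNormedModule) n,
     Re (vsum f n) = rsum (fun j => Re (f j)) n).
  { intros f; induction n as [|n IH]; [reflexivity|].
    simpl; rewrite <- IH; reflexivity. }
  unfold m, mom; rewrite Hs; apply rsum_ext; intros j _; f_equal.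
  change (/ (1 - w j) = w j ^ 0 * (/ (1 - w j) * 1))%C; simpl Cpow; ring. }
rewrite HR; apply (f_equal Re) in H.
apply (Rmult_eq_reg_r (1 - r ^ N)); [|lra].
unfold Rdiv; rewrite Rmult_assoc, Rinv_l by lra.
destruct m as [a b]; simpl Re in *; simpl in H; lra.
Qed.

Lemma sum_inv_sqr : rsum (fun j => / Cmod (1 - w j) ^ 2) N <= 3 * INR N / (1 - r ^ 2).
Proof.
rewrite (rsum_ext _ (fun j => (2 / (1 - r ^ 2)) * Re (/ (1 - w j)) + (- / (1 - r ^ 2)))).
2: { intros j _; rewrite Re_inv_1_minus by (apply wt_lt_1; assumption).
     rewrite Cmod_wt by assumption; field; nra. }
rewrite rsum_plus, rsum_scal, sum_Re_inv.
assert (Hc : forall c n, rsum (fun _ => c) n = INR n * c).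
{ intros c; induction n as [|n IH]; [simpl; ring|]; rewrite S_INR; simpl rsum; rewrite IH; ring. }
rewrite Hc.
assert (0 < r ^ N) by (apply pow_lt; lra).
assert (HI : INR N / (1 - r ^ N) <= 2 * INR N).
{ apply (Rmult_le_reg_r (1 - r ^ N)); [lra|].
  unfold Rdiv; rewrite Rmult_assoc, Rinv_l by lra.
  generalize (pos_INR N); nra. }
assert (Hr2 : 0 < / (1 - r ^ 2)) by (apply Rinv_0_lt_compat; nra).
unfold Rdiv; nra.
Qed.

Lemma sum_inv_pair k l :
  rsum (fun j => / (Cmod (1 - w (j + k)) * Cmod (1 - w (j + l)))) N <= 3 * INR N / (1 - r ^ 2).
Proof.
assert (Hpos : forall j, 0 < Cmod (1 - w j)).
{ intros j; apply Cmod_1_minus, wt_lt_1; assumption. }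
assert (Hk : forall k, rsum (fun j => / Cmod (1 - w (j + k)) ^ 2) N <= 3 * INR N / (1 - r ^ 2)).
{ clear k l; induction k as [|k IH].
  - erewrite rsum_ext; [apply sum_inv_sqr|]; intros; now rewrite Nat.add_0_r.
  - rewrite (rsum_ext _ (fun j => (fun j => / Cmod (1 - w (j + k)) ^ 2) (S j)))
      by (intros; simpl; do 4 f_equal; f_equal; f_equal; lia).
    assert (E := rsum_shift (fun j => / Cmod (1 - w (j + k)) ^ 2) N).
    assert (E2 : w (N + k) = w (0 + k)).
    { unfold wt; rewrite Cpow_add_r, om_pow_N by exact HN; simpl Nat.add; ring. }
    cbv beta in E; rewrite E2 in E; lra. }
eapply Rle_trans.
- apply (rsum_le _ (fun j => / 2 * / Cmod (1 - w (j + k)) ^ 2 + / 2 * / Cmod (1 - w (j + l)) ^ 2)).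
  intros j _; rewrite Rinv_mult, <- !pow_inv.
  generalize (/ Cmod (1 - w (j + k))) (/ Cmod (1 - w (j + l))); intros a b; generalize (pow2_ge_0 (a - b)); simpl; nra.
- rewrite rsum_plus, !rsum_scal; generalize (Hk k) (Hk l); lra.
Qed.

Context {X : CompleteNormedModule C_AbsRing}.

Lemma weighted_sum_bound p k l (c : nat -> X) B :
  (forall j, norm (c j) <= B / (Cmod (1 - w (j + k)) * Cmod (1 - w (j + l)))) ->
  norm (vsum (fun j => w j ^ p *: c j)%V N) <= r ^ p * B * (3 * INR N / (1 - r ^ 2)).
Proof.
intros Hc.
assert (HB : 0 <= B).
{ assert (H := Hc O); assert (H0 := norm_ge_0 (c O)).
  assert (H1 : 0 < Cmod (1 - w (0 + k)) * Cmod (1 - w (0 + l))).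
  { apply Rmult_lt_0_compat; apply Cmod_1_minus, wt_lt_1; assumption. }
  apply (Rmult_le_compat_r _ _ _ (Rlt_le _ _ H1)) in H.
  unfold Rdiv in H; rewrite Rmult_assoc, Rinv_l, Rmult_1_r in H by lra; nra. }
eapply Rle_trans.
- apply (vsum_norm _ (fun j => r ^ p * B * / (Cmod (1 - w (j + k)) * Cmod (1 - w (j + l))))).
  intros j _; rewrite norm_scalC, Cmod_pow, Cmod_wt, Rmult_assoc by assumption.
  apply Rmult_le_compat_l; [apply pow_le; lra | apply Hc].
- rewrite rsum_scal; apply Rmult_le_compat_l.
  + apply Rmult_le_pos; [apply pow_le; lra | exact HB].
  + apply sum_inv_pair.
Qed.

Lemma om_neq_1 n : (1 <= n)%nat -> (6 * n <= N)%nat -> 0 < Cmod (1 - om N).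
Proof.
intros Hn H6; apply Cmod_gt_0; intros H0.
apply (om_pow_neq_1 N 1); [lia|].
simpl Cpow; replace (om N) with (RtoC 1 - (1 - om N))%C by ring; rewrite H0; ring.
Qed.

Lemma parts_coef n : (1 <= n)%nat -> (6 * n <= N)%nat ->
  Cmod (1 - om N) * INR n / 2 <= Cmod (om N ^ (N - n) - 1).
Proof.
intros Hn H6; eapply Rle_trans; [apply Cmod_1_sub_om_pow, H6|].
right; replace (1 - om N ^ n)%C with (om N ^ n * (om N ^ (N - n) - 1))%C.
- rewrite Cmod_mult, Cmod_pow, Cmod_om, pow1; ring.
- transitivity (om N ^ (n + (N - n)) - om N ^ n)%C; [rewrite Cpow_add_r; ring|].
  replace (n + (N - n))%nat with N by lia; now rewrite om_pow_N.
Qed.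

Lemma parts_bound n (d : R) (x y : X) (c : C) B :
  (1 <= n)%nat -> (6 * n <= N)%nat ->
  ((om N ^ (N - n) - 1) *: x = c *: y)%V -> 
  Cmod c <= d * Cmod (1 - om N) -> norm y <= B ->
  norm x <= 2 * d / INR n * B.
Proof.
intros Hn H6 Heq Hc Hy.
assert (H1 := om_neq_1 n Hn H6).
assert (Hn0 : 0 < INR n) by (apply lt_0_INR; lia).
apply (f_equal (fun v : X => norm v)) in Heq; rewrite !norm_scalC in Heq.
assert (H2 := parts_coef n Hn H6).
assert (H3 : Cmod (1 - om N) * INR n / 2 * norm x <= d * Cmod (1 - om N) * B).
{ eapply Rle_trans; [apply Rmult_le_compat_r; [apply norm_ge_0 | exact H2]|].
  rewrite Heq; apply Rmult_le_compat; trivial; [apply Cmod_ge_0 | apply norm_ge_0]. }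
apply (Rmult_le_reg_l (Cmod (1 - om N) * INR n / 2)); [nra|].
eapply Rle_trans; [exact H3|]; right; field; lra.
Qed.

End Estimates.

Lemma cancel_powers (N n : nat) r a c :
  (1 <= n <= N)%nat -> 0 < r < 1 -> 0 <= c ->
  INR N * r ^ N * a <= r ^ S (N - n) * c * (3 * INR N / (1 - r ^ 2)) ->
  r ^ n * a <= 3 * c / (1 - r ^ 2).
Proof.
intros Hn Hr Hc H.
assert (HN : 0 < INR N) by (apply lt_0_INR; lia).
assert (Hp : 0 < r ^ (N - n)) by (apply pow_lt; lra).
assert (Hr2 : 0 < / (1 - r ^ 2)) by (apply Rinv_0_lt_compat; nra).
replace N with (n + (N - n))%nat in H at 2 by lia.
rewrite pow_add in H; simpl pow in H at 3.
apply (Rmult_le_reg_l (INR N * r ^ (N - n))); [nra|].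
apply Rle_trans with (r * r ^ (N - n) * c * (3 * INR N / (1 - r ^ 2))).
- eapply Rle_trans; [|exact H]; right; ring.
- unfold Rdiv.
  replace (r * r ^ (N - n) * c * (3 * INR N * / (1 - r ^ 2))) with
    (r * (r ^ (N - n) * c * (3 * INR N * / (1 - r ^ 2)))) by ring.
  replace (INR N * r ^ (N - n) * (3 * c * / (1 - r ^ 2))) with
    (1 * (r ^ (N - n) * c * (3 * INR N * / (1 - r ^ 2)))) by ring.
  apply Rmult_le_compat_r; [|lra].
  repeat apply Rmult_le_pos; lra.
Qed.

Section RittBounds.
Context {X : CompleteNormedModule C_AbsRing}.
Implicit Types x y z : X.

Section OneOperator.
Variables (K : R) (E : X -> X) (Rw : C -> X -> X).
Hypothesis H : ritt K E Rw.

Lemma ritt_R_le v x a : Cmod v < 1 -> norm x <= a ->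
  norm (Rw v x) <= K * a / Cmod (1 - v).
Proof.
intros Hv Hx; eapply Rle_trans; [apply (ritt_Rbnd _ _ _ H v Hv)|].
assert (Hv1 := Cmod_1_minus v Hv); assert (HK := ritt_ge_1 _ _ _ H).
replace (K * a / Cmod (1 - v)) with (K / Cmod (1 - v) * a) by (field; lra).
apply Rmult_le_compat_l; [|exact Hx].
apply Rmult_le_pos; [lra | left; now apply Rinv_0_lt_compat].
Qed.

Lemma ritt_E_le x a : norm x <= a -> norm (E x) <= K * a.
Proof.
intros Hx; assert (HK := ritt_ge_1 _ _ _ H).
apply bnd_le; [apply H | lra | exact Hx].
Qed.

Lemma ritt_EI_le v x a : Cmod v < 1 -> norm x <= a ->
  norm (v *: (Rw v x - E (Rw v x)))%V <= (1 + K) * a.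
Proof.
intros Hv Hx; assert (Hv1 := Cmod_1_minus v Hv).
replace (v *: (Rw v x - E (Rw v x)))%V with (x - (1 - v) *: Rw v x)%V.
- replace ((1 + K) * a) with (a + Cmod (1 - v) * (K * a / Cmod (1 - v))) by (field; lra).
  apply norm_minus_le; [exact Hx|].
  apply norm_scal_le; [apply Rle_refl|]; now apply ritt_R_le.
- assert (He := ritt_eq _ _ _ H v x Hv).
  replace (v *: (Rw v x - E (Rw v x)))%V with (v *: Rw v x - (x + v *: E (Rw v x)) + x)%V by vec.
  rewrite <- He; vec.
Qed.

Section Moments.
Variables (N n : nat) (r q : R).
Hypothesis Hr : 0 < r < 1.
Hypothesis HrN : r ^ N <= / 2.
Hypothesis Hn : (1 <= n)%nat.
Hypothesis HnN : (6 * n <= N)%nat.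
Hypothesis Hq : 0 <= q.
Hypothesis HqN : forall y, r ^ N * norm (Nat.iter N E y) <= q * norm y.
Local Notation w := (wt N r).

Let HN : (1 <= N)%nat. Proof. lia. Qed.

Lemma Cmod_w1 j : Cmod (w j) < 1.
Proof. now apply wt_lt_1. Qed.

Lemma Cmod_w2 j : 0 < Cmod (1 - w j).
Proof. apply Cmod_1_minus, Cmod_w1. Qed.

Lemma Cmod_phase d p : Cmod (d * om N ^ p) = Cmod d.
Proof. rewrite Cmod_mult, Cmod_pow, Cmod_om, pow1; ring. Qed.

Lemma mom_bound x : norm (mom N r Rw (N - n) x) <=
  2 / INR n * (r ^ S (N - n) * (K ^ 3 * norm x) * (3 * INR N / (1 - r ^ 2))).
Proof.
replace (2 / INR n) with (2 * 1 / INR n) by (unfold Rdiv; ring).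
eapply (parts_bound N HN); [exact Hn | exact HnN | | |].
- apply (mom_parts N r HN Hr K E Rw H).
- rewrite Cmod_phase; lra.
- apply (weighted_sum_bound N r HN Hr HrN _ 0 1); intros j.
  rewrite Nat.add_0_r, Nat.add_1_r.
  eapply Rle_trans.
  + apply ritt_E_le, ritt_R_le; [apply Cmod_w1|].
    apply ritt_R_le; [apply Cmod_w1 | apply Rle_refl].
  + right; field; split; apply Rgt_not_eq, Cmod_w2.
Qed.

Lemma iter_mom_bound (L : X -> X) x b :
  (forall i y, Nat.iter i E (L y) = L (Nat.iter i E y)) -> lin L -> 
  norm (L (mom N r Rw (N - n) x)) <= b ->
  INR N * r ^ N * norm (L (Nat.iter n E x)) <= (1 + q) * b.
Proof.
intros HLE HL Hb; assert (HrN0 : 0 < r ^ N) by (apply pow_lt; lra).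
assert (HI := mom_identity N r HN Hr K E Rw H n x).
assert (HI' := HI ltac:(lia)); clear HI.
apply (f_equal L) in HI'.
rewrite (lin_scal L), (lin_minus L), (lin_scal L) in HI' by exact HL.
rewrite <- (HLE N) in HI'.
apply (f_equal (fun v : X => norm v)) in HI'; rewrite norm_scalC, Cmod_R, Rabs_right in HI'.
2: { apply Rle_ge, Rmult_le_pos; [apply pos_INR | lra]. }
rewrite HI'; replace ((1 + q) * b) with (b + q * b) by ring.
apply norm_minus_le; [exact Hb|].
rewrite norm_scalC, Cmod_R, Rabs_right by lra.
eapply Rle_trans; [apply HqN|]; now apply Rmult_le_compat_l.
Qed.

Lemma power_bound_aux x :
  r ^ n * norm (Nat.iter n E x) <= 6 * (1 + q) * K ^ 3 / (INR n * (1 - r ^ 2)) * norm x.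
Proof.
assert (HK := ritt_ge_1 _ _ _ H).
assert (Hn0 : 0 < INR n) by (apply lt_0_INR; lia).
replace (6 * (1 + q) * K ^ 3 / (INR n * (1 - r ^ 2)) * norm x) with
  (3 * (2 * (1 + q) * K ^ 3 / INR n * norm x) / (1 - r ^ 2)) by (field; split; nra).
apply (cancel_powers N n); [lia | exact Hr | |].
- apply Rmult_le_pos; [|apply norm_ge_0].
  apply Rmult_le_pos; [|left; now apply Rinv_0_lt_compat].
  apply Rmult_le_pos; [lra | apply pow_le; lra].
- eapply Rle_trans.
  + apply (iter_mom_bound (fun y => y) x); [reflexivity | now split | apply mom_bound].
  + right; field; split; nra.
Qed.

Lemma regularity_aux x : (2 <= n)%nat ->
  r ^ n * norm (Nat.iter n E x - E (Nat.iter n E x))%V <=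
   24 * (1 + q) * (1 + K) * K ^ 4 / (INR n * INR (n - 1) * (1 - r ^ 2)) * norm x.
Proof.
intros Hn2; assert (HK := ritt_ge_1 _ _ _ H).
assert (Hn0 : 0 < INR n) by (apply lt_0_INR; lia).
assert (Hn1 : 0 < INR (n - 1)) by (apply lt_0_INR; lia).
assert (HlE : lin E) by apply H.
pose (L := fun y => (y - E y)%V).
assert (HLl : lin L).
{ unfold L; split; intros; [rewrite (lin_plus E) by exact HlE | rewrite (lin_scal E) by exact HlE]; vec. }
replace (24 * (1 + q) * (1 + K) * K ^ 4 / (INR n * INR (n - 1) * (1 - r ^ 2)) * norm x) with
  (3 * (8 * (1 + q) * (1 + K) * K ^ 4 / (INR n * INR (n - 1)) * norm x) / (1 - r ^ 2)) by (field; repeat split; nra).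
apply (cancel_powers N n); [lia | exact Hr | |].
- apply Rmult_le_pos; [|apply norm_ge_0].
  apply Rmult_le_pos; [|left; apply Rinv_0_lt_compat; nra].
  apply Rmult_le_pos; [nra | apply pow_le; lra].
- eapply Rle_trans.
  + apply (iter_mom_bound L x); [|exact HLl|].
    { intros i y; unfold L; rewrite (lin_minus (Nat.iter i E)) by (apply lin_iter, HlE).
      f_equal; apply iter_comm; reflexivity. }
    eapply (parts_bound N HN n 1); [exact Hn | exact HnN | | |].
    { assert (HP := f_equal L (mom_parts N r HN Hr K E Rw H (N - n) x)).
      rewrite !(lin_scal L) in HP by exact HLl; exact HP. }
    { rewrite Cmod_phase; lra. }
    replace (S (N - n)) with (N - (n - 1))%nat by lia.
    eapply (parts_bound N HN (n - 1) 2); [lia | lia | | |].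
    { assert (HP := f_equal L (mom2_parts N r HN Hr K E Rw H (N - (n - 1)) x)).
      rewrite !(lin_scal L) in HP by exact HLl; exact HP. }
    { rewrite Cmod_phase.
      replace (1 - om N ^ 2)%C with ((1 - om N) * (1 + om N))%C by ring.
      rewrite Cmod_mult, (Rmult_comm 2); apply Rmult_le_compat_l; [apply Cmod_ge_0|].
      eapply Rle_trans; [apply Cmod_triangle|]; rewrite Cmod_1, Cmod_om; lra. }
    unfold mom3, L.
    assert (HV : forall M f, (vsum f M - E (vsum f M))%V = vsum (fun j => f j - E (f j))%V M).
    { intros M f; rewrite vsum_minus, vsum_lin by exact HlE; reflexivity. }
    rewrite HV.
    rewrite (vsum_ext _ (fun j => w j ^ (N - (n - 1)) *: (w j *: 
       (Rw (w j) (E (E (Rw (w (S j)) (Rw (w (S (S j))) x))))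
        - E (Rw (w j) (E (E (Rw (w (S j)) (Rw (w (S (S j))) x))))))))%V).
    2: { intros j _; rewrite !(ritt_comm _ _ _ H) by apply Cmod_w1.
         rewrite (lin_scal E) by exact HlE.
         rewrite !(ritt_comm _ _ _ H) by apply Cmod_w1.
         rewrite Cpow_S; vec. }
    apply (weighted_sum_bound N r HN Hr HrN _ 1 2); intros j.
    replace (j + 1)%nat with (S j) by lia; replace (j + 2)%nat with (S (S j)) by lia.
    eapply Rle_trans.
    { apply ritt_EI_le; [apply Cmod_w1|].
      apply ritt_E_le, ritt_E_le, ritt_R_le; [apply Cmod_w1|].
      apply ritt_R_le; [apply Cmod_w1 | apply Rle_refl]. }
    instantiate (1 := (1 + K) * K ^ 4 * norm x).
    right; field; split; apply Rgt_not_eq, Cmod_w2.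
  + replace (S (N - n)) with (N - (n - 1))%nat by lia.
    right; field; repeat split; nra.
Qed.

End Moments.

Lemma pow_small (c x eps : R) : 0 <= x < 1 -> 0 < eps ->
  exists N0, forall N, (N0 <= N)%nat -> c * x ^ N <= eps.
Proof.
intros Hx Heps.
destruct (pow_lt_1_zero x) with (y := eps / (Rabs c + 1)) as [N0 HN0].
- rewrite Rabs_right; lra.
- apply Rdiv_lt_0_compat; [exact Heps|]; generalize (Rabs_pos c); lra.
- exists N0; intros N HN; specialize (HN0 N HN).
  rewrite Rabs_right in HN0 by (apply Rle_ge, pow_le; lra).
  generalize (Rabs_pos c) (Rle_abs c) (pow_le x N (proj1 Hx)); intros.
  apply Rle_trans with ((Rabs c + 1) * x ^ N); [nra|].
  apply Rle_trans with ((Rabs c + 1) * (eps / (Rabs c + 1))); [nra|].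
  right; field; lra.
Qed.

Definition growth_le r := exists c, forall n x, r ^ n * norm (Nat.iter n E x) <= c * norm x.

Lemma growth_le_mono r r' : 0 <= r' <= r -> growth_le r -> growth_le r'.
Proof.
intros Hr [c Hc]; exists c; intros n x; eapply Rle_trans; [|apply Hc].
apply Rmult_le_compat_r; [apply norm_ge_0 | now apply pow_incr].
Qed.

Lemma growth_le_eventually r r' q : 0 < r < r' -> r < 1 -> growth_le r' -> 0 < q ->
  exists N0, forall N, (N0 <= N)%nat -> r ^ N <= / 2 /\
    forall y, r ^ N * norm (Nat.iter N E y) <= q * norm y.
Proof.
intros Hr Hr1 [c Hc] Hq.
destruct (pow_small 1 r (/ 2)) as [N1 HN1]; [lra | lra |].
assert (Hx : 0 <= r / r' < 1).
{ split; [apply Rmult_le_pos; [|left; apply Rinv_0_lt_compat]; lra|].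
  apply (Rmult_lt_reg_r r'); [lra|]; field_simplify; lra. }
destruct (pow_small c (r / r') q Hx Hq) as [N2 HN2].
exists (max N1 N2); intros N HN; split.
- generalize (HN1 N ltac:(lia)); lra.
- intros y.
  replace (r ^ N) with ((r / r') ^ N * r' ^ N).
  + apply Rle_trans with ((r / r') ^ N * (c * norm y)).
    * rewrite Rmult_assoc; apply Rmult_le_compat_l; [apply pow_le; lra | apply Hc].
    * generalize (HN2 N ltac:(lia)) (norm_ge_0 y); nra.
  + rewrite <- Rpow_mult_distr; f_equal; field; lra.
Qed.

Lemma growth_le_of_power r n : 0 < r -> (1 <= n)%nat ->
  (forall x, r ^ n * norm (Nat.iter n E x) <= norm x) -> growth_le r.
Proof.
intros Hr Hn Hb; assert (HK := ritt_ge_1 _ _ _ H).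
exists ((1 + r * K) ^ n); intros m x.
rewrite (Nat.div_mod_eq m n).
set (a := (m / n)%nat); set (b := (m mod n)%nat).
assert (Hb2 : (b < n)%nat) by (apply Nat.mod_upper_bound; lia).
rewrite (Nat.mul_comm n a), iter_add, pow_add.
apply Rle_trans with (r ^ b * norm (Nat.iter b E x)).
- generalize (Nat.iter b E x) as y; intros y.
  rewrite Rmult_assoc, (Rmult_comm (r ^ b)), <- Rmult_assoc, Rmult_comm.
  apply Rmult_le_compat_l; [apply pow_le; lra|].
  clear Hb2; clearbody a; revert y; induction a as [|a IH]; intros y; [simpl; lra|].
  simpl Nat.mul; rewrite pow_add, iter_add, Rmult_assoc.
  eapply Rle_trans; [|apply (IH y)].
  rewrite <- Rmult_assoc, (Rmult_comm (r ^ n)), Rmult_assoc.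
  apply Rmult_le_compat_l; [apply pow_le; lra | apply Hb].
- apply Rle_trans with ((r * K) ^ b * norm x).
  + rewrite Rpow_mult_distr, Rmult_assoc.
    apply Rmult_le_compat_l; [apply pow_le; lra|].
    apply bnd_iter; [lra | apply H].
  + apply Rmult_le_compat_r; [apply norm_ge_0|].
    apply Rle_trans with ((1 + r * K) ^ b).
    * apply pow_incr; nra.
    * apply Rle_pow; [nra | lia].
Qed.

(** The a priori bound [power_bound_aux] needs [r ^ N E ^ N] to be small for
    large [N].  It decays like [1 / n], so it lets [r] grow by a fixed factor. *)
Lemma growth_le_lt_1 r0 : 0 < r0 < 1 -> growth_le r0.
Proof.
intros Hr0; assert (HK := ritt_ge_1 _ _ _ H).
set (A := 12 * K ^ 3 / (1 - r0 ^ 2)).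
assert (HA : 0 < A).
{ apply Rdiv_lt_0_compat; [|nra]; apply Rmult_lt_0_compat; [lra | apply pow_lt; lra]. }
destruct (nfloor_ex (6 * A)) as [n1 [_ Hn1]]; [lra|].
set (n := S n1); assert (Hn : 6 * A <= INR n) by (unfold n; rewrite S_INR; lra).
assert (Hn0 : 0 < INR n) by lra.
assert (Hi : 0 < / INR n) by now apply Rinv_0_lt_compat.
assert (Hstep : forall r r1, growth_le r -> 0 < r1 < r -> r <= r0 ->
   growth_le ((1 + / INR n) * r1)).
{ intros r r1 Hgr Hr1 Hr.
  apply (growth_le_of_power _ n); [nra | unfold n; lia |]; intros x.
  destruct (growth_le_eventually r1 r 1 Hr1) as [N0 HN0]; [lra | exact Hgr | lra |].
  destruct (HN0 (max N0 (6 * n))) as [HN1 HN2]; [lia|].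
  assert (HP := power_bound_aux (max N0 (6 * n)) n r1 1 ltac:(lra) HN1 ltac:(unfold n; lia)
     ltac:(lia) ltac:(lra) HN2 x).
  assert (HP2 : 6 * (1 + 1) * K ^ 3 / (INR n * (1 - r1 ^ 2)) <= / 6).
  { apply Rle_trans with (A / INR n).
    - replace (A / INR n) with (12 * K ^ 3 / (INR n * (1 - r0 ^ 2)))
        by (unfold A; field; split; nra).
      unfold Rdiv; replace (6 * (1 + 1)) with 12 by ring.
      apply Rmult_le_compat_l; [apply Rmult_le_pos; [lra | apply pow_le; lra]|].
      apply Rinv_le_contravar; [apply Rmult_lt_0_compat; [lra | nra]|]; apply Rmult_le_compat_l; [lra | nra].
    - apply (Rmult_le_reg_r (INR n)); [lra|]; unfold Rdiv.
      rewrite Rmult_assoc, Rinv_l by lra; lra. }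
  assert (HP3 := one_plus_inv_pow_le n ltac:(unfold n; lia)).
  rewrite Rpow_mult_distr, Rmult_assoc.
  assert (0 <= r1 ^ n * norm (Nat.iter n E x)).
  { apply Rmult_le_pos; [apply pow_le; lra | apply norm_ge_0]. }
  generalize (norm_ge_0 x); intros.
  apply Rle_trans with (3 * (r1 ^ n * norm (Nat.iter n E x))); nra. }
pose (rho := fun k => / K * (1 + / (2 * INR n)) ^ k).
assert (Hi2 : 0 < / (2 * INR n)) by (apply Rinv_0_lt_compat; lra).
assert (HKi : 0 < / K) by (apply Rinv_0_lt_compat; lra).
assert (Hrho : forall k, 0 < rho k).
{ intros k; apply Rmult_lt_0_compat; [exact HKi | apply pow_lt; lra]. }
assert (Hind : forall k, growth_le (Rmin r0 (rho k))).
{ induction k as [|k IH].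
  - apply (growth_le_mono (/ K)).
    { split; [apply Rmin_glb; [lra | apply Rlt_le, Hrho] |].
      eapply Rle_trans; [apply Rmin_r|]; unfold rho; simpl; lra. }
    exists 1; intros m x; rewrite Rmult_1_l.
    apply Rle_trans with ((/ K) ^ m * (K ^ m * norm x)).
    + apply Rmult_le_compat_l; [apply pow_le; lra|]; apply bnd_iter; [lra | apply H].
    + rewrite <- Rmult_assoc, <- Rpow_mult_distr, Rinv_l, pow1 by lra; lra.
  - destruct (Rle_dec r0 (rho k)) as [Hle|Hgt].
    + apply (growth_le_mono r0).
      * split; [apply Rmin_glb; [lra | apply Rlt_le, Hrho] | apply Rmin_l].
      * now rewrite Rmin_left in IH.
    + rewrite Rmin_right in IH by lra.
      apply (growth_le_mono (rho (S k))).
      * split; [apply Rmin_glb; [lra | apply Rlt_le, Hrho] | apply Rmin_r].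
      * replace (rho (S k)) with ((1 + / INR n) * (rho k * (1 + / (2 * INR n)) / (1 + / INR n))).
        2: { unfold rho; rewrite <- tech_pow_Rmult.
             generalize ((1 + / (2 * INR n)) ^ k); intros; field; lra. }
        apply (Hstep (rho k)); [exact IH | | lra].
        assert (Hlt : (1 + / (2 * INR n)) / (1 + / INR n) < 1).
        { apply (Rmult_lt_reg_r (1 + / INR n)); [lra|]; unfold Rdiv.
          rewrite Rmult_assoc, Rinv_l by lra; rewrite Rinv_mult; lra. }
        generalize (Hrho k); unfold Rdiv in *; rewrite Rmult_assoc; intros Hk.
        split; [|nra]; apply Rmult_lt_0_compat; [exact Hk|].
        apply Rmult_lt_0_compat; [lra | apply Rinv_0_lt_compat; lra]. }
destruct (Pow_x_infinity (1 + / (2 * INR n))) with (b := K) as [k Hk].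
{ rewrite Rabs_right; lra. }
specialize (Hk k (le_n k)); rewrite Rabs_right in Hk by (apply Rle_ge, pow_le; lra).
specialize (Hind k); rewrite Rmin_left in Hind; [exact Hind|].
unfold rho; apply Rle_trans with 1; [lra|].
apply Rle_trans with (/ K * K); [rewrite Rinv_l; lra|].
apply Rmult_le_compat_l; lra.
Qed.

Lemma radius_choice n : (1 <= n)%nat ->
  exists r, 0 < r < 1 /\ 1 <= 3 * r ^ n /\ / (1 - r ^ 2) <= INR n + 1.
Proof.
intros Hn; assert (Hn0 : 0 < INR n) by (apply lt_0_INR; lia).
assert (Hn1 : 0 < / INR n) by now apply Rinv_0_lt_compat.
assert (Hr : 0 < / (1 + / INR n) < 1).
{ split; [apply Rinv_0_lt_compat; lra|].
  rewrite <- Rinv_1; apply Rinv_lt_contravar; lra. }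
exists (/ (1 + / INR n)); split; [exact Hr | split].
- rewrite pow_inv; assert (H3 := one_plus_inv_pow_le n Hn).
  assert (0 < (1 + / INR n) ^ n) by (apply pow_lt; lra).
  apply (Rmult_le_reg_r ((1 + / INR n) ^ n)); [lra|].
  rewrite Rmult_assoc, Rinv_l by lra; lra.
- rewrite <- (Rinv_inv (INR n + 1)); apply Rinv_le_contravar.
  + apply Rinv_0_lt_compat; lra.
  + set (r := / (1 + / INR n)) in *.
    replace (/ (INR n + 1)) with (1 - r) by (unfold r; field; lra); nra.
Qed.

Lemma ritt_nodes r q n : 0 < r < 1 -> 0 < q -> exists N0, forall N, (N0 <= N)%nat ->
  (6 * n <= N)%nat /\ r ^ N <= / 2 /\
  forall y, r ^ N * norm (Nat.iter N E y) <= q * norm y.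
Proof.
intros Hr Hq.
destruct (growth_le_eventually r ((r + 1) / 2) q) as [N0 HN0]; [lra | lra | | lra |].
- apply growth_le_lt_1; lra.
- exists (max N0 (6 * n)); intros N HN; split; [lia|]; apply HN0; lia.
Qed.

Theorem ritt_power_bound n : bnd (Nat.iter n E) (72 * K ^ 3).
Proof.
intros x; assert (HK := ritt_ge_1 _ _ _ H).
assert (HK3 : 1 <= K ^ 3) by (apply pow_R1_Rle; lra).
destruct n as [|n1]; [simpl; generalize (norm_ge_0 x); nra|].
set (n := S n1); assert (Hn : (1 <= n)%nat) by (unfold n; lia).
assert (Hn0 : 1 <= INR n) by (apply (le_INR 1); lia).
destruct (radius_choice n Hn) as (r & Hr & Hr3 & Hrn).
destruct (ritt_nodes r 1 n Hr ltac:(lra)) as [N HN].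
destruct (HN N (le_n N)) as (H6 & H2 & Hq).
assert (HP := power_bound_aux N n r 1 Hr H2 Hn H6 ltac:(lra) Hq x).
assert (Hr2 : 0 < / (1 - r ^ 2)) by (apply Rinv_0_lt_compat; nra).
assert (HB : 6 * (1 + 1) * K ^ 3 / (INR n * (1 - r ^ 2)) <= 24 * K ^ 3).
{ unfold Rdiv; rewrite Rinv_mult.
  assert (/ INR n * / (1 - r ^ 2) <= 2).
  { apply Rle_trans with (/ INR n * (INR n + 1)).
    - apply Rmult_le_compat_l; [left; apply Rinv_0_lt_compat; lra | exact Hrn].
    - apply (Rmult_le_reg_l (INR n)); [lra|].
      rewrite <- Rmult_assoc, Rinv_r by lra; lra. }
  nra. }
generalize (norm_ge_0 (Nat.iter n E x)) (norm_ge_0 x); intros; nra.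
Qed.

Theorem ritt_regularity n x : (2 <= n)%nat ->
  norm (Nat.iter n E x - E (Nat.iter n E x))%V <= 432 * (1 + K) * K ^ 4 / INR n * norm x.
Proof.
intros Hn2; assert (HK := ritt_ge_1 _ _ _ H).
assert (HK4 : 1 <= K ^ 4) by (apply pow_R1_Rle; lra).
assert (Hn : (1 <= n)%nat) by lia.
assert (Hn0 : 2 <= INR n) by (apply (le_INR 2); lia).
assert (Hnm : INR (n - 1) = INR n - 1) by (rewrite minus_INR by lia; reflexivity).
destruct (radius_choice n Hn) as (r & Hr & Hr3 & Hrn).
destruct (ritt_nodes r 1 n Hr ltac:(lra)) as [N HN].
destruct (HN N (le_n N)) as (H6 & H2 & Hq).
assert (HP := regularity_aux N n r 1 Hr H2 Hn H6 ltac:(lra) Hq x Hn2).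
assert (Hr2 : 0 < / (1 - r ^ 2)) by (apply Rinv_0_lt_compat; nra).
assert (HB : 24 * (1 + 1) * (1 + K) * K ^ 4 / (INR n * INR (n - 1) * (1 - r ^ 2)) 
   <= 144 * (1 + K) * K ^ 4 / INR n).
{ rewrite Hnm; unfold Rdiv; rewrite !Rinv_mult.
  assert (HB1 : / (INR n - 1) * / (1 - r ^ 2) <= 3).
  { apply Rle_trans with (/ (INR n - 1) * (INR n + 1)).
    - apply Rmult_le_compat_l; [left; apply Rinv_0_lt_compat; lra | exact Hrn].
    - apply (Rmult_le_reg_l (INR n - 1)); [lra|].
      rewrite <- Rmult_assoc, Rinv_r by lra; lra. }
  assert (HB2 : 0 <= 48 * (1 + K) * K ^ 4 * / INR n).
  { repeat apply Rmult_le_pos; try lra; left; apply Rinv_0_lt_compat; lra. }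
  apply (Rmult_le_compat_l _ _ _ HB2) in HB1; lra. }
generalize (norm_ge_0 (Nat.iter n E x - E (Nat.iter n E x))%V) (norm_ge_0 x); intros.
apply Rle_trans with (3 * (144 * (1 + K) * K ^ 4 / INR n * norm x)); [nra|].
right; field; lra.
Qed.

End OneOperator.

Theorem ritt_difference (K eps : R) (E E0 : X -> X) (Rw Rw0 : C -> X -> X) n :
  ritt K E Rw -> ritt K E0 Rw0 -> 0 < eps ->
  (forall x, norm (E x - E0 x)%V <= eps * norm x) ->
  (forall w x, Cmod w < 1 -> norm (Rw w x - Rw0 w x)%V <= eps / Cmod (1 - w) * norm x) ->
  forall x, norm (Nat.iter n E x - Nat.iter n E0 x)%V <= 180 * eps * K ^ 2 * norm x.
Proof.
intros H H0 Heps HE HR x; assert (HK := ritt_ge_1 _ _ _ H).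
assert (HK2 : 1 <= K ^ 2) by (apply pow_R1_Rle; lra).
destruct n as [|n1].
{ simpl Nat.iter; rewrite norm_minus_diag.
  repeat apply Rmult_le_pos; try lra; apply norm_ge_0. }
set (n := S n1); assert (Hn : (1 <= n)%nat) by (unfold n; lia).
assert (Hn0 : 1 <= INR n) by (apply (le_INR 1); lia).
destruct (radius_choice n Hn) as (r & Hr & Hr3 & Hrn).
set (q := eps / K); assert (Hq : 0 < q) by (apply Rdiv_lt_0_compat; lra).
destruct (ritt_nodes K E Rw H r q n Hr Hq) as [N1 HN1].
destruct (ritt_nodes K E0 Rw0 H0 r q n Hr Hq) as [N2 HN2].
set (N := max N1 N2).
destruct (HN1 N) as (H6 & H2 & HqN); [lia|].
destruct (HN2 N) as (_ & _ & HqN0); [lia|].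
assert (HN : (1 <= N)%nat) by lia.
set (w := wt N r).
assert (Hw : forall j, Cmod (w j) < 1) by (intros; now apply wt_lt_1).
assert (Hw1 : forall j, 0 < Cmod (1 - w j)) by (intros; apply Cmod_1_minus, Hw).
set (p := (N - n)%nat); set (m := mom N r Rw p x); set (m0 := mom N r Rw0 p x).
set (S0 := r ^ S p * norm x * (3 * INR N / (1 - r ^ 2))).
assert (HS0 : 0 <= S0).
{ apply Rmult_le_pos; [apply Rmult_le_pos; [apply pow_le; lra | apply norm_ge_0]|].
  apply Rmult_le_pos; [generalize (pos_INR N); lra | left; apply Rinv_0_lt_compat; nra]. }
assert (Hm : norm m <= 2 / INR n * (K ^ 3 * S0)).
{ eapply Rle_trans; [apply (mom_bound K E Rw H N n r Hr H2 Hn H6 x)|].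
  right; unfold S0, p; ring. }
assert (Hm0 : norm m0 <= 2 / INR n * (K ^ 3 * S0)).
{ eapply Rle_trans; [apply (mom_bound K E0 Rw0 H0 N n r Hr H2 Hn H6 x)|].
  right; unfold S0, p; ring. }
assert (Hd : norm (m - m0)%V <= 2 / INR n * (3 * eps * K ^ 2 * S0)).
{ replace (2 / INR n) with (2 * 1 / INR n) by (unfold Rdiv; ring).
  apply (parts_bound N HN n 1 _ (mom2 N r E Rw (S p) x - mom2 N r E0 Rw0 (S p) x)%V
    ((1 - om N) * om N ^ p)%C); [exact Hn | exact H6 | | |].
  - transitivity ((om N ^ p - 1) *: m - (om N ^ p - 1) *: m0)%V; [unfold p; vec|].
    unfold m, m0.
    rewrite (mom_parts N r HN Hr K E Rw H), (mom_parts N r HN Hr K E0 Rw0 H0); vec.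
  - rewrite Cmod_phase; lra.
  - unfold mom2; rewrite <- vsum_minus.
    rewrite (vsum_ext _ (fun j => w j ^ S p *: (E (Rw (w j) (Rw (w (S j)) x)) -
       E0 (Rw0 (w j) (Rw0 (w (S j)) x))))%V) by (intros; unfold w; vec).
    replace (3 * eps * K ^ 2 * S0) with
      (r ^ S p * (3 * eps * K ^ 2 * norm x) * (3 * INR N / (1 - r ^ 2))) by (unfold S0; ring).
    apply (weighted_sum_bound N r HN Hr H2 _ 0 1); intros j.
    rewrite Nat.add_0_r, Nat.add_1_r; fold w.
    set (a := Cmod (1 - w j)); set (b := Cmod (1 - w (S j))).
    assert (Ha : 0 < a) by apply Hw1; assert (Hb : 0 < b) by apply Hw1.
    assert (Hu : norm (Rw (w (S j)) x) <= K * norm x / b)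
      by (apply (ritt_R_le K E Rw H); [apply Hw | apply Rle_refl]).
    set (u := Rw (w (S j)) x) in *; set (u0 := Rw0 (w (S j)) x).
    assert (Huu : norm (u - u0)%V <= eps * norm x / b).
    { eapply Rle_trans; [apply HR, Hw|]; fold b; right; field; lra. }
    replace (E (Rw (w j) u) - E0 (Rw0 (w j) u0))%V with
      ((E (Rw (w j) u) - E0 (Rw (w j) u)) +
       (E0 (Rw (w j) u - Rw0 (w j) u) + E0 (Rw0 (w j) (u - u0))))%V.
    2: { rewrite (lin_minus (Rw0 (w j))) by (apply (ritt_Rlin _ _ _ H0), Hw).
         rewrite !(lin_minus E0) by apply H0; vec. }
    assert (B1 : norm (E (Rw (w j) u) - E0 (Rw (w j) u))%V <= eps * (K * (K * norm x / b) / a)).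
    { eapply Rle_trans; [apply HE|]; apply Rmult_le_compat_l; [lra|].
      apply (ritt_R_le K E Rw H); [apply Hw | exact Hu]. }
    assert (B2 : norm (E0 (Rw (w j) u - Rw0 (w j) u)%V) <= K * (eps / a * (K * norm x / b))).
    { apply (ritt_E_le K E0 Rw0 H0); eapply Rle_trans; [apply HR, Hw|]; fold a.
      apply Rmult_le_compat_l; [left; now apply Rdiv_lt_0_compat | exact Hu]. }
    assert (B3 : norm (E0 (Rw0 (w j) (u - u0)%V)) <= K * (K * (eps * norm x / b) / a)).
    { apply (ritt_E_le K E0 Rw0 H0), (ritt_R_le K E0 Rw0 H0); [apply Hw | exact Huu]. }
    eapply Rle_trans; [exact (norm_plus_le _ _ _ _ B1 (norm_plus_le _ _ _ _ B2 B3))|].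
    right; field; lra. }
assert (HP : INR N * r ^ N * norm (Nat.iter n E x - Nat.iter n E0 x)%V <=
   r ^ S p * (10 * eps * K ^ 2 / INR n * norm x) * (3 * INR N / (1 - r ^ 2))).
{ assert (HrN0 : 0 < r ^ N) by (apply pow_lt; lra).
  assert (E1 := mom_identity N r HN Hr K E Rw H n x ltac:(lia)).
  assert (E2 := mom_identity N r HN Hr K E0 Rw0 H0 n x ltac:(lia)).
  fold p in E1, E2; fold m in E1; fold m0 in E2.
  replace (INR N * r ^ N) with (Cmod (RtoC (INR N * r ^ N))).
  2: { rewrite Cmod_R; apply Rabs_right, Rle_ge, Rmult_le_pos; [apply pos_INR | lra]. }
  rewrite <- norm_scalC.
  replace (RtoC (INR N * r ^ N) *: (Nat.iter n E x - Nat.iter n E0 x))%V with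
    ((m - m0) - (RtoC (r ^ N) *: Nat.iter N E m - RtoC (r ^ N) *: Nat.iter N E0 m0))%V.
  2: { transitivity (RtoC (INR N * r ^ N) *: Nat.iter n E x - RtoC (INR N * r ^ N) *: Nat.iter n E0 x)%V;
       [rewrite E1, E2; vec | vec]. }
  assert (B : forall F v, (forall y, r ^ N * norm (Nat.iter N F y) <= q * norm y) ->
     norm v <= 2 / INR n * (K ^ 3 * S0) ->
     norm (RtoC (r ^ N) *: Nat.iter N F v)%V <= q * (2 / INR n * (K ^ 3 * S0))).
  { intros F v HF Hv; rewrite norm_scalC, Cmod_R, Rabs_right by lra.
    eapply Rle_trans; [apply HF|]; apply Rmult_le_compat_l; lra. }
  eapply Rle_trans.
  - exact (norm_minus_le _ _ _ _ Hd (norm_minus_le _ _ _ _ (B _ _ HqN Hm) (B _ _ HqN0 Hm0))).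
  - right; unfold q, S0; field; split; [nra | lra]. }
apply cancel_powers in HP; [| lia | exact Hr |].
2: { repeat apply Rmult_le_pos; try lra; [left; apply Rinv_0_lt_compat; lra | apply norm_ge_0]. }
assert (Hr2 : 0 < / (1 - r ^ 2)) by (apply Rinv_0_lt_compat; nra).
assert (HB : / INR n * / (1 - r ^ 2) <= 2).
{ apply Rle_trans with (/ INR n * (INR n + 1)).
  - apply Rmult_le_compat_l; [left; apply Rinv_0_lt_compat; lra | exact Hrn].
  - apply (Rmult_le_reg_l (INR n)); [lra|].
    rewrite <- Rmult_assoc, Rinv_r by lra; lra. }
assert (HB2 : 0 <= 30 * eps * K ^ 2 * norm x).
{ repeat apply Rmult_le_pos; try lra; apply norm_ge_0. }
apply (Rmult_le_compat_l _ _ _ HB2) in HB.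
generalize (norm_ge_0 (Nat.iter n E x - Nat.iter n E0 x)%V); unfold Rdiv in HP; intros; nra.
Qed.

End RittBounds.

(** * Analytic semigroups generated by sectorial operators *)

Lemma RtoC_ne (r : R) : r <> 0 -> RtoC r <> RtoC 0.
Proof. intros Hr H; apply Hr; exact (f_equal Re H). Qed.

Definition cone (kappa : R) (z : C) := Rabs (Im z) <= kappa * Re z.

Lemma cone_0 kappa : cone kappa 0.
Proof. unfold cone; simpl; rewrite Rabs_R0; lra. Qed.

Lemma cone_plus kappa a b : cone kappa a -> cone kappa b -> cone kappa (a + b).
Proof.
unfold cone; destruct a as [a1 a2], b as [b1 b2]; simpl; intros.
eapply Rle_trans; [apply Rabs_triang|]; lra.
Qed.

Lemma cone_scal kappa t z : 0 <= t -> cone kappa z -> cone kappa (t * z).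
Proof.
unfold cone; destruct z as [a b]; simpl; intros Ht Hz.
replace (t * b + 0 * a) with (t * b) by ring.
rewrite Rabs_mult, Rabs_right by lra; nra.
Qed.

Lemma cone_real kappa t : 0 <= kappa -> 0 <= t -> cone kappa t.
Proof. unfold cone; simpl; intros; rewrite Rabs_R0; nra. Qed.

Lemma cone_Re_pos kappa z : 0 < kappa -> cone kappa z -> z <> RtoC 0 -> 0 < Re z.
Proof.
unfold cone; destruct z as [a b]; simpl; intros Hk Hz Hne.
generalize (Rabs_pos b); intros; apply Rnot_le_lt; intros Ha; apply Hne.
assert (a = 0) as -> by nra; assert (Rabs b = 0) by nra.
assert (b = 0) as -> by (destruct (Req_dec b 0); [assumption | now apply Rabs_no_R0 in H1]).
reflexivity.
Qed.

Lemma cone_plus_ne kappa a b : 0 < kappa -> cone kappa a -> cone kappa b ->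
  a <> RtoC 0 -> (a + b)%C <> RtoC 0.
Proof.
intros Hk Ha Hb Hne H0.
assert (H1 := cone_Re_pos kappa a Hk Ha Hne).
assert (H2 : 0 <= Re b).
{ destruct (Ceq_dec b 0) as [->|Hb0]; [simpl; lra|].
  left; now apply (cone_Re_pos kappa). }
apply (f_equal Re) in H0; destruct a as [a1 a2], b as [b1 b2]; simpl in *; lra.
Qed.

Section Sectorial.
Context {X : CompleteNormedModule C_AbsRing}.
Implicit Types x y : X.
Implicit Types G : poperator X.

(** With [lambda = mu / h] this is the usual resolvent bound [K / |lambda|] on a
    sector of half-angle greater than [PI / 2]; the form [mu - h G] needs no
    arguments of complex numbers. *)
Record sectorial (kappa K : R) G : Prop := {
  sect_kappa : 0 < kappa;
  sect_K : 1 <= K;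
  sect_dom0 : dom G 0%V;
  sect_plus : forall x y, dom G x -> dom G y ->
    dom G (x + y)%V /\ G (x + y)%V = (G x + G y)%V;
  sect_scal : forall c x, dom G x -> dom G (c *: x)%V /\ G (c *: x)%V = (c *: G x)%V;
  sect_dense : forall x eps, 0 < eps -> exists y, dom G y /\ norm (x - y)%V <= eps;
  sect_bound : forall h mu x, cone kappa h -> h <> RtoC 0 -> 0 < Re mu -> dom G x ->
    Cmod mu * norm x <= K * norm (mu *: x - h *: G x)%V;
  sect_surj : forall h mu y, cone kappa h -> h <> RtoC 0 -> 0 < Re mu ->
    exists x, dom G x /\ (mu *: x - h *: G x)%V = y
}.

Definition res G (h mu : C) y : X :=
  epsilon (inhabits (0%V : X)) (fun x => dom G x /\ (mu *: x - h *: G x)%V = y).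

(** [(1 - h G)^-1]; at [h = 0] the value [res G 0 1 x] would be [x] only for [x]
    in the domain of [G]. *)
Definition J G (h : C) x : X := if Ceq_dec h 0 then x else res G h 1 x.

Lemma telescope (P Q : X -> X) (N : nat) (c d : R) x : 0 <= c -> lin P ->
  (forall i, (i < N)%nat -> bnd (Nat.iter i P) c) ->
  (forall i, (i < N)%nat -> norm (P (Nat.iter i Q x) - Nat.iter (S i) Q x)%V <= d) ->
  norm (Nat.iter N P x - Nat.iter N Q x)%V <= INR N * (c * d).
Proof.
intros Hc HP; revert x; induction N as [|N IH]; intros x Hb Hd.
- simpl Nat.iter; rewrite norm_minus_diag; simpl; lra.
- rewrite S_INR, !iter_S_r.
  replace (Nat.iter N P (P x) - Nat.iter N Q (Q x))%V with
    ((Nat.iter N P (Q x) - Nat.iter N Q (Q x)) + Nat.iter N P (P x - Q x))%V.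
  2: { rewrite (lin_minus (Nat.iter N P)) by (apply lin_iter, HP); vec. }
  rewrite Rmult_plus_distr_r, Rmult_1_l; apply norm_plus_le.
  + apply IH; intros i Hi; [apply Hb; lia|].
    rewrite <- !iter_S_r; apply Hd; lia.
  + apply bnd_le; [apply Hb; lia | exact Hc | apply (Hd O); lia].
Qed.

Section Generator.
Variables (kappa K : R) (G : poperator X).
Hypothesis HG : sectorial kappa K G.

Lemma gen_minus x y : dom G x -> dom G y ->
  dom G (x - y)%V /\ G (x - y)%V = (G x - G y)%V.
Proof.
intros Hx Hy; destruct (sect_scal _ _ _ HG (RtoC (-1)) y Hy) as [H1 H2].
destruct (sect_plus _ _ _ HG x _ Hx H1) as [H3 H4].
replace (x - y)%V with (x + RtoC (-1) *: y)%V by vec.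
split; [exact H3|]; rewrite H4, H2; vec.
Qed.

Section Resolvent.
Variables (h mu : C).
Hypothesis Hh : cone kappa h.
Hypothesis Hh0 : h <> RtoC 0.
Hypothesis Hmu : 0 < Re mu.

Let Hmu0 : 0 < Cmod mu.
Proof. apply Rlt_le_trans with (Re mu); [exact Hmu|]. eapply Rle_trans; [apply Rle_abs | apply re_le_Cmod]. Qed.

Lemma res_spec y : dom G (res G h mu y) /\ (mu *: res G h mu y - h *: G (res G h mu y))%V = y.
Proof. unfold res; apply epsilon_spec, (sect_surj _ _ _ HG); assumption. Qed.

Lemma res_bnd : bnd (res G h mu) (K / Cmod mu).
Proof.
intros y; destruct (res_spec y) as [H1 H2].
assert (H3 := sect_bound _ _ _ HG h mu _ Hh Hh0 Hmu H1); rewrite H2 in H3.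
apply (Rmult_le_reg_l (Cmod mu)); [exact Hmu0|].
eapply Rle_trans; [exact H3|]; right; field; lra.
Qed.

Lemma res_unique x y : dom G x -> (mu *: x - h *: G x)%V = y -> res G h mu y = x.
Proof.
intros Hx Hy; destruct (res_spec y) as [H1 H2].
destruct (gen_minus _ _ H1 Hx) as [H3 H4].
assert (H5 := sect_bound _ _ _ HG h mu _ Hh Hh0 Hmu H3).
apply eq_of_norm, (Rmult_le_reg_l (Cmod mu)); [exact Hmu0|].
eapply Rle_trans; [exact H5|]; rewrite H4.
replace (mu *: (res G h mu y - x) - h *: (G (res G h mu y) - G x))%V with
  ((mu *: res G h mu y - h *: G (res G h mu y)) - (mu *: x - h *: G x))%V by vec.
rewrite H2, Hy, norm_minus_diag; lra.
Qed.

Lemma res_lin : lin (res G h mu).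
Proof.
split; [intros x y | intros c x].
- destruct (res_spec x) as [H1 H2], (res_spec y) as [H3 H4].
  destruct (sect_plus _ _ _ HG _ _ H1 H3) as [H5 H6].
  apply res_unique; [exact H5|]; rewrite H6.
  transitivity ((mu *: res G h mu x - h *: G (res G h mu x)) +
    (mu *: res G h mu y - h *: G (res G h mu y)))%V; [vec | now rewrite H2, H4].
- destruct (res_spec x) as [H1 H2].
  destruct (sect_scal _ _ _ HG c _ H1) as [H5 H6].
  apply res_unique; [exact H5|]; rewrite H6.
  transitivity (c *: (mu *: res G h mu x - h *: G (res G h mu x)))%V; [vec | now rewrite H2].
Qed.

Lemma res_gen x : dom G x -> G (res G h mu x) = res G h mu (G x).
Proof.
intros Hx; destruct (res_spec x) as [H1 H2]; set (u := res G h mu x) in *.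
assert (H3 : G u = (/ h *: (mu *: u - x))%V).
{ rewrite <- H2; vecf; exact Hh0. }
destruct (sect_scal _ _ _ HG mu u H1) as [H4 H5].
destruct (gen_minus _ _ H4 Hx) as [H6 H7].
destruct (sect_scal _ _ _ HG (/ h)%C _ H6) as [H8 H9].
symmetry; apply res_unique; [now rewrite H3|].
rewrite H3 at 2; rewrite H9, H7, H5; vecf; exact Hh0.
Qed.

End Resolvent.

Lemma Re_1_pos : 0 < Re 1.
Proof. simpl; lra. Qed.

Lemma res_comm h1 mu1 h2 mu2 x :
  cone kappa h1 -> h1 <> RtoC 0 -> 0 < Re mu1 ->
  cone kappa h2 -> h2 <> RtoC 0 -> 0 < Re mu2 ->
  res G h1 mu1 (res G h2 mu2 x) = res G h2 mu2 (res G h1 mu1 x).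
Proof.
intros A1 A2 A3 B1 B2 B3.
destruct (res_spec h2 mu2 B1 B2 B3 x) as [H1 H2].
destruct (res_spec h1 mu1 A1 A2 A3 (res G h2 mu2 x)) as [H3 _].
symmetry; apply res_unique; trivial.
rewrite res_gen by trivial; assert (Hl := res_lin h1 mu1 A1 A2 A3).
rewrite <- !(lin_scal _ _ _ Hl), <- (lin_minus _ _ _ Hl).
now rewrite H2.
Qed.

Lemma J_0 x : J G 0 x = x.
Proof. unfold J; now destruct (Ceq_dec 0 0). Qed.

Lemma J_ne h x : h <> RtoC 0 -> J G h x = res G h 1 x.
Proof. intros Hh; unfold J; now destruct (Ceq_dec h 0). Qed.

Lemma J_spec h x : cone kappa h -> h <> RtoC 0 ->
  dom G (J G h x) /\ (J G h x - h *: G (J G h x))%V = x.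
Proof.
intros H1 H2; rewrite J_ne by exact H2.
destruct (res_spec h 1 H1 H2 Re_1_pos x) as [H3 H4]; split; [exact H3|].
rewrite <- H4 at 3; vec.
Qed.

Lemma J_unique h x : cone kappa h -> dom G x -> J G h (x - h *: G x)%V = x.
Proof.
intros H1 H2; destruct (Ceq_dec h 0) as [->|H3]; [rewrite J_0; vec|].
rewrite J_ne by exact H3.
apply res_unique; [exact H1 | exact H3 | exact Re_1_pos | exact H2 | vec].
Qed.

Lemma J_lin h : cone kappa h -> lin (J G h).
Proof.
intros H1; destruct (Ceq_dec h 0) as [->|H3].
- split; intros; now rewrite !J_0.
- assert (Hl := res_lin h 1 H1 H3 Re_1_pos).
  split; intros; rewrite !J_ne by exact H3; apply Hl.
Qed.

Lemma J_gen h x : cone kappa h -> dom G x -> dom G (J G h x) /\ G (J G h x) = J G h (G x).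
Proof.
intros H1 Hx; destruct (Ceq_dec h 0) as [->|H3]; [now rewrite !J_0|].
split; [now apply J_spec|]; rewrite !J_ne by exact H3.
apply res_gen; trivial; exact Re_1_pos.
Qed.

Lemma J_comm a b x : cone kappa a -> cone kappa b -> J G a (J G b x) = J G b (J G a x).
Proof.
intros Ha Hb; destruct (Ceq_dec a 0) as [->|Ha0]; [now rewrite !J_0|].
destruct (Ceq_dec b 0) as [->|Hb0]; [now rewrite !J_0|].
rewrite !J_ne by assumption; apply res_comm; trivial; exact Re_1_pos.
Qed.

(** [(1 - w J)^-1 = 1 + w (1 - w - h G)^-1]. *)
Definition ritt_res (h w : C) x := (x + w *: res G h (1 - w) x)%V.

Lemma Re_1_minus w : Cmod w < 1 -> 0 < Re (1 - w).
Proof.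
intros H; generalize (re_le_Cmod w) (Rle_abs (Re w)); destruct w; simpl in *; lra.
Qed.

Lemma J_ritt h : cone kappa h -> h <> RtoC 0 -> ritt (K + 2) (J G h) (ritt_res h).
Proof.
intros H1 H2; assert (HK := sect_K _ _ _ HG).
assert (Heq : forall w x, Cmod w < 1 -> J G h (ritt_res h w x) = res G h (1 - w) x).
{ intros w x Hw; destruct (res_spec h _ H1 H2 (Re_1_minus w Hw) x) as [H3 H4].
  unfold ritt_res; set (v := res G h (1 - w) x) in *.
  transitivity (J G h (v - h *: G v)%V); [f_equal | now apply J_unique].
  transitivity (((1 - w) *: v - h *: G v) + w *: v)%V; [now rewrite H4 | vec]. }
split.
- lra.
- now apply J_lin.
- intros x; rewrite J_ne by exact H2; eapply Rle_trans; [now apply res_bnd, Re_1_pos|].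
  rewrite Cmod_1; apply Rmult_le_compat_r; [apply norm_ge_0 | lra].
- intros w Hw; assert (Hl := res_lin h _ H1 H2 (Re_1_minus w Hw)).
  unfold ritt_res; split; intros; [rewrite (lin_plus _ _ _ Hl) | rewrite (lin_scal _ _ _ Hl)]; vec.
- intros w x Hw; rewrite Heq by exact Hw; reflexivity.
- intros w x Hw; rewrite Heq by exact Hw; unfold ritt_res.
  assert (Hl := res_lin h 1 H1 H2 Re_1_pos).
  rewrite !J_ne by exact H2; rewrite (res_comm h (1 - w) h 1) by
    (trivial; try exact Re_1_pos; now apply Re_1_minus).
  rewrite <- (lin_scal _ _ _ Hl), <- (lin_plus _ _ _ Hl).
  rewrite <- (J_ne h) by exact H2; symmetry; now apply Heq.
- intros w Hw x; assert (H3 := Cmod_1_minus w Hw).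
  assert (H4 : Cmod (1 - w) <= 2).
  { eapply Rle_trans; [apply Cmod_triangle|]; rewrite Cmod_opp, Cmod_1; lra. }
  replace ((K + 2) / Cmod (1 - w) * norm x) with
    (2 / Cmod (1 - w) * norm x + 1 * (K / Cmod (1 - w) * norm x)) by (field; lra).
  assert (Hx := norm_ge_0 x).
  apply norm_plus_le.
  + apply Rle_trans with (1 * norm x); [lra|]; apply Rmult_le_compat_r; [exact Hx|].
    apply (Rmult_le_reg_r (Cmod (1 - w))); [lra|]; unfold Rdiv.
    rewrite Rmult_assoc, Rinv_l by lra; lra.
  + apply norm_scal_le; [lra|]; apply res_bnd; trivial; now apply Re_1_minus.
Qed.

Definition KP := 72 * (K + 2) ^ 3.

Lemma KP_ge_1 : 1 <= KP.
Proof.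
assert (HK := sect_K _ _ _ HG); unfold KP.
assert (1 <= (K + 2) ^ 3) by (apply pow_R1_Rle; lra); lra.
Qed.

Lemma J_iter_bnd h n : cone kappa h -> bnd (Nat.iter n (J G h)) KP.
Proof.
intros H1; destruct (Ceq_dec h 0) as [->|H2].
- intros x; replace (Nat.iter n (J G 0) x) with x.
  + generalize KP_ge_1 (norm_ge_0 x); intros; nra.
  + induction n as [|n IH]; [reflexivity|]; simpl; now rewrite <- IH, J_0.
- now apply (ritt_power_bound _ _ _ (J_ritt h H1 H2)).
Qed.

Lemma J_le h x c : cone kappa h -> norm x <= c -> norm (J G h x) <= KP * c.
Proof.
intros H1 Hx; apply bnd_le; [exact (J_iter_bnd h 1 H1) | | exact Hx].
generalize KP_ge_1; lra.
Qed.

Lemma J_iter_gen h n x : cone kappa h -> dom G x ->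
  dom G (Nat.iter n (J G h) x) /\ G (Nat.iter n (J G h) x) = Nat.iter n (J G h) (G x).
Proof.
intros H1 Hx; induction n as [|n [IH1 IH2]]; [now split|].
simpl; destruct (J_gen h _ H1 IH1) as [H2 H3]; split; [exact H2|].
now rewrite H3, IH2.
Qed.

Definition dom2 x := dom G x /\ dom G (G x).

Lemma J_sub_id h x : cone kappa h -> dom G x ->
  (J G h x - x)%V = (h *: J G h (G x))%V.
Proof.
intros H1 Hx; destruct (Ceq_dec h 0) as [->|H2]; [rewrite J_0; vec|].
destruct (J_spec h x H1 H2) as [_ H3]; rewrite <- (proj2 (J_gen h x H1 Hx)).
rewrite <- H3 at 2; vec.
Qed.

Lemma dom2_dense x eps : 0 < eps -> exists y, dom2 y /\ norm (x - y)%V <= eps.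
Proof.
intros Heps; destruct (sect_dense _ _ _ HG x (eps / 2)) as (y & H1 & H2); [lra|].
assert (HP := KP_ge_1); assert (Hy := norm_ge_0 (G y)).
set (t := eps / (2 * KP * (norm (G y) + 1))).
assert (Ht : 0 < t) by (apply Rdiv_lt_0_compat; [lra|]; nra).
assert (Hk := sect_kappa _ _ _ HG).
assert (Hc : cone kappa t) by (apply cone_real; lra).
assert (Ht0 : RtoC t <> RtoC 0).
{ intros H0; apply (f_equal Re) in H0; simpl in H0; lra. }
destruct (J_gen t y Hc H1) as [H3 H4].
exists (J G t y); split.
- split; [exact H3|]; rewrite H4; now apply J_spec.
- replace (x - J G t y)%V with ((x - y) - (J G t y - y))%V by vec.
  rewrite J_sub_id by assumption.
  replace eps with (eps / 2 + t * (KP * (norm (G y) + 1))).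
  + apply norm_minus_le; [exact H2|].
    apply norm_scal_le; [rewrite Cmod_R, Rabs_right; lra|].
    apply J_le; [exact Hc | lra].
  + unfold t; field; lra.
Qed.

(** With [a = b] this compares two steps of size [a] with one of size [2 a]; in
    general it yields the semigroup law in the limit. *)
Lemma J_product a b y : cone kappa a -> cone kappa b -> dom2 y ->
  (J G a (J G b y) - J G (a + b) y =
   - (a * b) *: J G a (J G b (J G (a + b) (G (G y)))))%V.
Proof.
intros Ha Hb [Hy1 Hy2].
destruct (Ceq_dec a 0) as [->|Ha0].
{ rewrite Cplus_0_l, !J_0; vec. }
destruct (Ceq_dec b 0) as [->|Hb0].
{ rewrite Cplus_0_r, !J_0; vec. }
assert (Hab := cone_plus kappa a b Ha Hb).
assert (Hab0 := cone_plus_ne kappa a b (sect_kappa _ _ _ HG) Ha Hb Ha0).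
set (z := J G (a + b) y).
destruct (J_spec (a + b) y Hab Hab0) as [Hz Hzy]; fold z in Hz, Hzy.
destruct (J_gen (a + b) y Hab Hy1) as [_ Hz1]; fold z in Hz1.
destruct (J_gen (a + b) (G y) Hab Hy2) as [Hz2 Hz3].
rewrite <- Hz3, <- Hz1; rewrite <- Hz1 in Hz2.
set (u := (z - a *: G z)%V).
assert (Hu : dom G u /\ G u = (G z - a *: G (G z))%V).
{ destruct (sect_scal _ _ _ HG a _ Hz2) as [H1 H2].
  unfold u; rewrite <- H2; now apply gen_minus. }
assert (E1 : J G a u = z) by now apply J_unique.
assert (E2 : J G b (u - b *: G u)%V = u) by now apply J_unique.
assert (E3 : (u - b *: G u)%V = (y + (a * b) *: G (G z))%V).
{ rewrite (proj2 Hu), <- Hzy; unfold u; vec. }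
assert (E4 : z = (J G a (J G b y) + (a * b) *: J G a (J G b (G (G z))))%V).
{ rewrite <- E1 at 1; rewrite <- E2 at 1; rewrite E3.
  rewrite (lin_plus _ _ _ (J_lin b Hb)), (lin_scal _ _ _ (J_lin b Hb)).
  rewrite (lin_plus _ _ _ (J_lin a Ha)), (lin_scal _ _ _ (J_lin a Ha)); reflexivity. }
rewrite E4 at 1; vec.
Qed.

Lemma J_product_iter a b n x : cone kappa a -> cone kappa b -> dom2 x ->
  norm (Nat.iter n (J G a) (Nat.iter n (J G b) x) - Nat.iter n (J G (a + b)) x)%V <=
  INR n * (KP ^ 6 * (Cmod a * Cmod b) * norm (G (G x))).
Proof.
intros Ha Hb [Hx1 Hx2]; assert (HP := KP_ge_1).
assert (Hab := cone_plus kappa a b Ha Hb).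
set (P := fun y => J G a (J G b y)).
assert (HPi : forall i y, Nat.iter i P y = Nat.iter i (J G a) (Nat.iter i (J G b) y)).
{ induction i as [|i IH]; intros y; [reflexivity|].
  simpl; rewrite IH; unfold P; f_equal; symmetry.
  apply iter_comm; intros; now apply J_comm. }
rewrite <- HPi.
replace (KP ^ 6 * (Cmod a * Cmod b) * norm (G (G x))) with
  (KP * KP * (Cmod a * Cmod b * (KP * (KP * (KP * (KP * norm (G (G x)))))))) by ring.
apply telescope.
- nra.
- exact (lin_comp _ _ (J_lin a Ha) (J_lin b Hb)).
- intros i _ y; rewrite HPi, Rmult_assoc.
  apply bnd_le; [now apply J_iter_bnd | lra | now apply J_iter_bnd].
- intros i _; unfold P; simpl Nat.iter.
  destruct (J_iter_gen (a + b) i x Hab Hx1) as [H1 H2].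
  destruct (J_iter_gen (a + b) i (G x) Hab Hx2) as [H3 H4].
  rewrite J_product; [|exact Ha | exact Hb | split; [exact H1 | now rewrite H2]].
  apply norm_scal_le; [rewrite Cmod_opp, Cmod_mult; lra|].
  apply J_le; [exact Ha|]; apply J_le; [exact Hb|]; apply J_le; [exact Hab|].
  rewrite H2, H4; now apply J_iter_bnd.
Qed.

Definition euler k (z : C) x := Nat.iter (2 ^ k) (J G (z / RtoC (2 ^ k))) x.

Lemma pow_2_pos k : 0 < 2 ^ k.
Proof. apply pow_lt; lra. Qed.

Lemma INR_pow2 k : INR (2 ^ k) = 2 ^ k.
Proof. rewrite pow_INR; f_equal; simpl; ring. Qed.

Lemma pow2_ne k : RtoC (2 ^ k) <> RtoC 0.
Proof. intros H; apply (f_equal Re) in H; simpl in H; generalize (pow_2_pos k); lra. Qed.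

Lemma cone_div_pow2 z k : cone kappa z -> cone kappa (z / RtoC (2 ^ k)).
Proof.
intros Hz; replace (z / RtoC (2 ^ k))%C with (RtoC (/ 2 ^ k) * z)%C.
- apply cone_scal; [left; apply Rinv_0_lt_compat, pow_2_pos | exact Hz].
- rewrite RtoC_inv; [unfold Cdiv; ring | generalize (pow_2_pos k); lra].
Qed.

Lemma Cmod_div_pow2 z k : Cmod (z / RtoC (2 ^ k)) = Cmod z / 2 ^ k.
Proof.
rewrite Cmod_div by apply pow2_ne; rewrite Cmod_R, Rabs_right; [reflexivity|].
generalize (pow_2_pos k); lra.
Qed.

Lemma euler_bnd k z : cone kappa z -> bnd (euler k z) KP.
Proof. intros Hz; apply J_iter_bnd, cone_div_pow2, Hz. Qed.

Lemma euler_lin k z : cone kappa z -> lin (euler k z).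
Proof. intros Hz; apply lin_iter, J_lin, cone_div_pow2, Hz. Qed.

Lemma euler_gen k z x : cone kappa z -> dom G x ->
  dom G (euler k z x) /\ G (euler k z x) = euler k z (G x).
Proof. intros Hz Hx; apply J_iter_gen; [now apply cone_div_pow2 | exact Hx]. Qed.

Lemma euler_mul k a b x : cone kappa a -> cone kappa b -> dom2 x ->
  norm (euler k a (euler k b x) - euler k (a + b) x)%V <=
  KP ^ 6 * (Cmod a * Cmod b) * norm (G (G x)) / 2 ^ k.
Proof.
intros Ha Hb Hx; unfold euler.
replace ((a + b) / RtoC (2 ^ k))%C with (a / RtoC (2 ^ k) + b / RtoC (2 ^ k))%C
  by (unfold Cdiv; ring).
eapply Rle_trans; [apply J_product_iter; trivial; now apply cone_div_pow2|].
rewrite INR_pow2, !Cmod_div_pow2; right; field; generalize (pow_2_pos k); lra.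
Qed.

Lemma euler_step k z x : cone kappa z -> dom2 x ->
  norm (euler (S k) z x - euler k z x)%V <= KP ^ 6 * Cmod z ^ 2 * norm (G (G x)) / 2 ^ k.
Proof.
intros Hz Hx; set (c := (z / RtoC (2 ^ S k))%C).
assert (Hc : cone kappa c) by now apply cone_div_pow2.
assert (H2 : (z / RtoC (2 ^ k))%C = (c + c)%C).
{ unfold c; rewrite <- tech_pow_Rmult, RtoC_mult; field; apply pow2_ne. }
assert (HE : euler (S k) z x = Nat.iter (2 ^ k) (J G c) (Nat.iter (2 ^ k) (J G c) x)).
{ unfold euler; fold c; rewrite <- iter_add; f_equal; simpl; lia. }
rewrite HE; unfold euler; rewrite H2.
eapply Rle_trans; [apply J_product_iter; trivial|].
unfold c; rewrite INR_pow2, !Cmod_div_pow2.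
assert (Hp := pow_2_pos k); assert (HP := KP_ge_1).
change (2 ^ S k) with (2 * 2 ^ k).
replace (2 ^ k * (KP ^ 6 * (Cmod z / (2 * 2 ^ k) * (Cmod z / (2 * 2 ^ k))) * norm (G (G x)))) with
  (/ 4 * (KP ^ 6 * Cmod z ^ 2 * norm (G (G x)) / 2 ^ k)) by (field; lra).
assert (0 <= KP ^ 6 * Cmod z ^ 2 * norm (G (G x)) / 2 ^ k).
{ apply Rmult_le_pos; [|left; now apply Rinv_0_lt_compat].
  apply Rmult_le_pos; [|apply norm_ge_0].
  apply Rmult_le_pos; [apply pow_le; lra | apply pow_le, Cmod_ge_0]. }
lra.
Qed.

Definition sg (z : C) x : X :=
  epsilon (inhabits (0%V : X)) (tends eventually (fun k => euler k z x)).

Lemma sg_tends z x : cone kappa z -> tends eventually (fun k => euler k z x) (sg z x).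
Proof.
intros Hz; unfold sg; apply epsilon_spec.
assert (HP := KP_ge_1).
apply tends_Cauchy; [apply eventually_filter|]; intros eps Heps.
destruct (dom2_dense x (eps / (6 * KP))) as (y & Hy & Hxy); [apply Rdiv_lt_0_compat; lra|].
destruct (geom_converges (fun k => euler k z y) (KP ^ 6 * Cmod z ^ 2 * norm (G (G y))))
  as [l [Hl _]].
{ intros k; now apply euler_step. }
destruct (Hl (eps / 6)) as [N HN]; [lra|].
assert (Hk : forall k, (N <= k)%nat -> norm (euler k z x - l)%V < eps / 2).
{ intros k Hk; replace (euler k z x - l)%V with (euler k z (x - y) + (euler k z y - l))%V.
  2: { rewrite (lin_minus (euler k z)) by now apply euler_lin. vec. }
  apply Rle_lt_trans with (KP * (eps / (6 * KP)) + eps / 6).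
  - apply norm_plus_le; [|left; now apply HN].
    apply bnd_le; [now apply euler_bnd | lra | exact Hxy].
  - replace (KP * (eps / (6 * KP))) with (eps / 6) by (field; lra); lra. }
exists (fun k => (N <= k)%nat); split; [now exists N|].
intros u v Hu Hv.
replace (euler u z x - euler v z x)%V with ((euler u z x - l) - (euler v z x - l))%V by vec.
eapply Rle_lt_trans; [apply norm_minus_le; apply Rle_refl|].
generalize (Hk u Hu) (Hk v Hv); lra.
Qed.

Lemma sg_unique z x l : cone kappa z -> tends eventually (fun k => euler k z x) l -> sg z x = l.
Proof.
intros Hz Hl; eapply (tends_unique eventually); [now apply sg_tends | exact Hl].
Qed.

Lemma sg_lin z : cone kappa z -> lin (sg z).
Proof.
intros Hz; split.
- intros x y; apply sg_unique; [exact Hz|].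
  apply (tends_ext eventually (fun k => euler k z x + euler k z y)%V).
  + intros k; symmetry; apply lin_plus; now apply euler_lin.
  + apply (tends_plus eventually); now apply sg_tends.
- intros c x; apply sg_unique; [exact Hz|].
  apply (tends_ext eventually (fun k => c *: euler k z x)%V).
  + intros k; symmetry; apply lin_scal; now apply euler_lin.
  + apply (tends_scal eventually); now apply sg_tends.
Qed.

Lemma sg_limit_le z x (f : X -> X) c N : cone kappa z -> 
  (forall l u, tends eventually u l -> tends eventually (fun k : nat => f (u k)) (f l)) ->
  (forall k, (N <= k)%nat -> norm (f (euler k z x)) <= c) -> norm (f (sg z x)) <= c.
Proof.
intros Hz Hf Hc; apply (tends_le eventually (fun k => f (euler k z x))).
- now apply Hf, sg_tends.
- now exists N.
Qed.

Lemma sg_bnd z : cone kappa z -> bnd (sg z) KP.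
Proof.
intros Hz x; apply (sg_limit_le z x (fun y => y) _ 0); [exact Hz | trivial|].
intros k _; now apply euler_bnd.
Qed.

Lemma sg_le z x c : cone kappa z -> norm x <= c -> norm (sg z x) <= KP * c.
Proof.
intros Hz Hx; apply bnd_le; [now apply sg_bnd | generalize KP_ge_1; lra | exact Hx].
Qed.

Lemma sg_0 x : sg 0 x = x.
Proof.
apply sg_unique; [apply cone_0|].
apply (tends_ext eventually (fun _ => x)); [|apply (tends_const eventually)].
intros k; unfold euler; replace (0 / RtoC (2 ^ k))%C with (RtoC 0).
- induction (2 ^ k)%nat as [|n IH]; [reflexivity|]; simpl; now rewrite <- IH, J_0.
- unfold Cdiv; ring.
Qed.

Lemma lin_eq_on_dense (f g : X -> X) c (P : X -> Prop) : 0 < c -> lin f -> lin g ->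
  bnd f c -> bnd g c ->
  (forall x eps, 0 < eps -> exists y, P y /\ norm (x - y)%V <= eps) ->
  (forall x, P x -> f x = g x) -> forall x, f x = g x.
Proof.
intros Hc Hf Hg Bf Bg HP H x; apply eq_of_small; intros eps Heps.
destruct (HP x (eps / (2 * c))) as (y & Hy & Hxy); [apply Rdiv_lt_0_compat; lra|].
replace (f x - g x)%V with (f (x - y) - g (x - y))%V.
- replace eps with (c * (eps / (2 * c)) + c * (eps / (2 * c))) by (field; lra).
  apply norm_minus_le; apply bnd_le; trivial; lra.
- rewrite (lin_minus f), (lin_minus g), (H y) by assumption; vec.
Qed.

Lemma sg_add a b x : cone kappa a -> cone kappa b -> sg (a + b) x = sg a (sg b x).
Proof.
intros Ha Hb; assert (Hab := cone_plus kappa a b Ha Hb); assert (HP := KP_ge_1).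
revert x; apply (lin_eq_on_dense _ _ (KP * KP) dom2); [nra | now apply sg_lin | | | | apply dom2_dense |].
- apply (lin_comp (sg a) (sg b)); now apply sg_lin.
- intros x; eapply Rle_trans; [now apply sg_bnd|].
  apply Rmult_le_compat_r; [apply norm_ge_0 | nra].
- intros x; rewrite Rmult_assoc; apply sg_le; [exact Ha | now apply sg_bnd].
- intros x Hx; apply sg_unique; [exact Hab|].
  apply (tends_ext eventually (fun k => euler k a (euler k b x) -
    (euler k a (euler k b x) - euler k (a + b) x))%V); [intros; vec|].
  replace (sg a (sg b x)) with (sg a (sg b x) - 0)%V by vec.
  apply (tends_minus eventually).
  + apply (tends_opnorm eventually (fun k => euler k a) KP (fun k => euler k b x) (sg b x)); [lra | intros; now apply euler_lin | | |].
    * exists O; intros; now apply euler_bnd.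
    * now apply sg_tends.
    * now apply sg_tends.
  + intros eps Heps.
    destruct (geom_small (KP ^ 6 * (Cmod a * Cmod b) * norm (G (G x))) eps Heps) as [N HN].
    exists N; intros k Hk; eapply Rle_lt_trans; [|exact (HN k Hk)].
    replace (euler k a (euler k b x) - euler k (a + b) x - 0)%V with
      (euler k a (euler k b x) - euler k (a + b) x)%V by vec.
    now apply euler_mul.
Qed.

Lemma gen_closed {I} (F : (I -> Prop) -> Prop) {FF : ProperFilter F} u x y :
  (forall i, dom G (u i)) -> tends F u x -> tends F (fun i => G (u i)) y ->
  dom G x /\ G x = y.
Proof.
intros Hu Hx Hy; assert (Hc : cone kappa 1).
{ apply cone_real; generalize (sect_kappa _ _ _ HG); lra. }
assert (H1 : RtoC 1 <> RtoC 0) by (apply RtoC_ne; lra).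
assert (E : x = J G 1 (x - y)%V).
{ apply (tends_unique F u); [exact Hx|].
  apply (tends_ext F (fun i => J G 1 (u i - G (u i))%V)).
  - intros i; rewrite <- (J_unique 1 (u i)) at 3 by (trivial); f_equal; vec.
  - apply (tends_lin F (J G 1) KP); [now apply J_lin | exact (J_iter_bnd 1 1 Hc)|].
    now apply (tends_minus F). }
destruct (J_spec 1 (x - y)%V Hc H1) as [H2 H3]; rewrite <- E in H2, H3.
split; [exact H2|].
transitivity (x - (x - RtoC 1 *: G x))%V; [vec|]; rewrite H3; vec.
Qed.

Lemma sg_gen z x : cone kappa z -> dom G x -> dom G (sg z x) /\ G (sg z x) = sg z (G x).
Proof.
intros Hz Hx; apply (gen_closed eventually (fun k => euler k z x)).
- intros k; now apply euler_gen.
- now apply sg_tends.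
- apply (tends_ext eventually (fun k => euler k z (G x))); [|now apply sg_tends].
  intros k; symmetry; now apply euler_gen.
Qed.

Lemma tends_shift (f : X -> X) c v : lin f -> bnd f c ->
  forall l u, tends eventually u l ->
  tends eventually (fun k : nat => f (u k) - v)%V (f l - v)%V.
Proof.
intros Hf Hb l u Hu; apply (tends_minus eventually); [|apply (tends_const eventually)].
now apply (tends_lin eventually f c).
Qed.

Lemma sg_sub_id z x : cone kappa z -> dom G x ->
  norm (sg z x - x)%V <= KP ^ 2 * Cmod z * norm (G x).
Proof.
intros Hz Hx; assert (HP := KP_ge_1).
apply (sg_limit_le z x (fun y => y - x)%V _ 0); [exact Hz | |].
{ apply (tends_shift (fun y => y) 1); [now split | intros y; lra]. }
intros k _; unfold euler; set (h := (z / RtoC (2 ^ k))%C).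
assert (Hh : cone kappa h) by now apply cone_div_pow2.
assert (Hid : forall n, Nat.iter n (fun y : X => y) x = x).
{ induction n as [|n IH]; [reflexivity | exact IH]. }
rewrite <- (Hid (2 ^ k)%nat) at 2.
eapply Rle_trans; [apply (telescope _ _ _ KP (Cmod h * (KP * norm (G x))))|].
- lra.
- now apply J_lin.
- intros i _; now apply J_iter_bnd.
- intros i _; simpl; rewrite !Hid, J_sub_id by assumption.
  apply norm_scal_le; [lra|]; apply J_le; [exact Hh | lra].
- unfold h; rewrite INR_pow2, Cmod_div_pow2; right; field; generalize (pow_2_pos k); lra.
Qed.

Lemma iter_first_order h n x e : cone kappa h -> dom G x ->
  (forall i, (i <= n)%nat -> norm (Nat.iter i (J G h) (G x) - G x)%V <= e) ->
  norm (Nat.iter n (J G h) x - x - (INR n * h) *: G x)%V <= INR n * Cmod h * e.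
Proof.
intros Hh Hx; induction n as [|n IH]; intros He.
- simpl Nat.iter; replace (x - x - (INR 0 * h) *: G x)%V with (0%V : X) by (simpl INR; vec).
  rewrite norm_zeroX; simpl; lra.
- replace (Nat.iter (S n) (J G h) x - x - (INR (S n) * h) *: G x)%V with
    ((Nat.iter n (J G h) x - x - (INR n * h) *: G x) +
     h *: (Nat.iter (S n) (J G h) (G x) - G x))%V.
  + rewrite S_INR, !Rmult_plus_distr_r, Rmult_1_l; apply norm_plus_le.
    * apply IH; intros i Hi; apply He; lia.
    * apply norm_scal_le; [lra | now apply He].
  + destruct (J_iter_gen h n x Hh Hx) as [H1 H2].
    assert (H3 := J_sub_id h _ Hh H1); rewrite H2 in H3.
    transitivity ((Nat.iter n (J G h) x - x - (INR n * h) *: G x) +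
     h *: J G h (Nat.iter n (J G h) (G x)) - h *: G x)%V; [simpl Nat.iter; vec|].
    rewrite <- H3, S_INR, RtoC_plus; simpl Nat.iter; vec.
Qed.

Lemma sg_first_order z x v : cone kappa z -> dom G x -> dom G v ->
  norm (sg z x - x - z *: G x)%V <=
  Cmod z * ((KP + 1) * norm (G x - v)%V + KP ^ 2 * Cmod z * norm (G v)).
Proof.
intros Hz Hx Hv; assert (HP := KP_ge_1).
apply (sg_limit_le z x (fun y => y - x - z *: G x)%V _ 0); [exact Hz | |].
{ intros l u Hu; apply (tends_minus eventually); [|apply (tends_const eventually)].
  apply (tends_minus eventually); [exact Hu | apply (tends_const eventually)]. }
intros k _; unfold euler; set (h := (z / RtoC (2 ^ k))%C).
assert (Hh : cone kappa h) by now apply cone_div_pow2.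
assert (Hk := pow_2_pos k).
assert (Hhz : z = (INR (2 ^ k) * h)%C).
{ rewrite INR_pow2; unfold h; field; apply pow2_ne. }
assert (Hhz' : INR (2 ^ k) * Cmod h = Cmod z).
{ unfold h; rewrite INR_pow2, Cmod_div_pow2; field; lra. }
rewrite Hhz at 1; eapply Rle_trans; [apply iter_first_order; [exact Hh | exact Hx|]|
  rewrite Hhz'; apply Rle_refl].
intros i Hi.
replace (Nat.iter i (J G h) (G x) - G x)%V with
  (Nat.iter i (J G h) (G x - v) - (G x - v) + (Nat.iter i (J G h) v - v))%V.
2: { rewrite (lin_minus (Nat.iter i (J G h))) by now apply lin_iter, J_lin. vec. }
rewrite Rmult_plus_distr_r; apply norm_plus_le.
- apply norm_minus_le; [now apply J_iter_bnd | lra].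
- assert (Hid : forall n, Nat.iter n (fun y : X => y) v = v).
  { induction n as [|n IH]; [reflexivity | exact IH]. }
  rewrite <- (Hid i) at 2.
  eapply Rle_trans; [apply (telescope _ _ _ KP (Cmod h * (KP * norm (G v))))|].
  + lra.
  + now apply J_lin.
  + intros j _; now apply J_iter_bnd.
  + intros j _; simpl; rewrite !Hid, J_sub_id by assumption.
    apply norm_scal_le; [lra|]; apply J_le; [exact Hh | lra].
  + apply le_INR in Hi; assert (H0 := Cmod_ge_0 h).
    replace (KP ^ 2 * Cmod z * norm (G v)) with (KP ^ 2 * norm (G v) * Cmod z) by ring.
    replace (INR i * (KP * (Cmod h * (KP * norm (G v))))) with
      (KP ^ 2 * norm (G v) * (INR i * Cmod h)) by ring.
    rewrite <- Hhz'; apply Rmult_le_compat_l.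
    * apply Rmult_le_pos; [apply pow_le; lra | apply norm_ge_0].
    * apply Rmult_le_compat_r; [apply Cmod_ge_0 | exact Hi].
Qed.

Lemma sg_second_order z x : cone kappa z -> dom2 x ->
  norm (sg z x - x - z *: G x)%V <= KP ^ 2 * Cmod z ^ 2 * norm (G (G x)).
Proof.
intros Hz [H1 H2]; eapply Rle_trans; [apply (sg_first_order z x (G x)); assumption|].
rewrite norm_minus_diag; right; ring.
Qed.

Definition KR := 432 * (1 + (K + 2)) * (K + 2) ^ 4.

Lemma KR_pos : 0 < KR.
Proof.
assert (HK := sect_K _ _ _ HG); unfold KR.
apply Rmult_lt_0_compat; [lra | apply pow_lt; lra].
Qed.

Lemma sg_regular_dom z x : cone kappa z -> z <> RtoC 0 -> dom G x ->
  norm (G (sg z x)) <= KR / Cmod z * norm x.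
Proof.
intros Hz Hz0 Hx; assert (HR := KR_pos).
assert (Hm : 0 < Cmod z) by now apply Cmod_gt_0.
rewrite (proj2 (sg_gen z x Hz Hx)); apply le_epsilon; intros eps Heps.
destruct (geom_small (KR * norm (G x)) eps Heps) as [N HN].
apply (sg_limit_le z (G x) (fun y => y) _ (S N)); [exact Hz | trivial |].
intros k Hk; assert (Hp := pow_2_pos k).
unfold euler; set (h := (z / RtoC (2 ^ k))%C); set (n := (2 ^ k)%nat).
assert (Hh : cone kappa h) by now apply cone_div_pow2.
assert (Hhm : Cmod h = Cmod z / 2 ^ k) by apply Cmod_div_pow2.
assert (Hh0 : h <> RtoC 0).
{ apply Cmod_gt_0; rewrite Hhm; now apply Rdiv_lt_0_compat. }
assert (Hn2 : (2 <= n)%nat).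
{ unfold n; destruct k as [|k]; [lia|]; simpl.
  assert (Nat.pow 2 k <> 0)%nat by (apply Nat.pow_nonzero; lia); lia. }
assert (HnR : INR n = 2 ^ k) by apply INR_pow2.
assert (R1 := ritt_regularity _ _ _ (J_ritt h Hh Hh0) n x Hn2).
assert (R2 := ritt_regularity _ _ _ (J_ritt h Hh Hh0) n (G x) Hn2).
fold KR in R1, R2; rewrite HnR in R1, R2.
destruct (J_iter_gen h n x Hh Hx) as [H1 H2].
assert (H3 := J_sub_id h _ Hh H1); rewrite H2 in H3.
rewrite norm_minus_sym, H3, norm_scalC, Hhm in R1.
set (v := Nat.iter n (J G h) (G x)) in *.
replace v with (J G h v + (v - J G h v))%V by vec.
apply norm_plus_le.
- apply (Rmult_le_reg_l (Cmod z / 2 ^ k)); [now apply Rdiv_lt_0_compat|].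
  eapply Rle_trans; [exact R1|]; right; field; lra.
- eapply Rle_trans; [exact R2|].
  left; replace (KR / 2 ^ k * norm (G x)) with (KR * norm (G x) / 2 ^ k) by (field; lra).
  apply HN; lia.
Qed.

Lemma sg_regular z x : cone kappa z -> z <> RtoC 0 ->
  dom G (sg z x) /\ norm (G (sg z x)) <= KR / Cmod z * norm x.
Proof.
intros Hz Hz0; assert (HR := KR_pos).
assert (Hm : 0 < Cmod z) by now apply Cmod_gt_0.
assert (Hc : 0 < KR / Cmod z) by now apply Rdiv_lt_0_compat.
destruct (choice (fun n y => dom G y /\ norm (x - y)%V <= 1 / 2 ^ n)) as [u Hu].
{ intros n; apply (sect_dense _ _ _ HG), Rdiv_lt_0_compat; [lra | apply pow_2_pos]. }
assert (Htu : tends eventually u x).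
{ intros eps Heps; destruct (geom_small 1 eps Heps) as [N HN]; exists N; intros n Hn.
  rewrite norm_minus_sym; eapply Rle_lt_trans; [apply Hu | now apply HN]. }
assert (Hg : forall n, dom G (sg z (u n))) by (intros; apply sg_gen; [exact Hz | apply Hu]).
assert (Htg : tends eventually (fun n => sg z (u n)) (sg z x)).
{ apply (tends_lin eventually (sg z) KP); [now apply sg_lin | now apply sg_bnd | exact Htu]. }
assert (Hd : forall m n, norm (G (sg z (u m)) - G (sg z (u n)))%V <=
   KR / Cmod z * norm (u m - u n)%V).
{ intros m n; destruct (gen_minus _ _ (proj1 (Hu m)) (proj1 (Hu n))) as [H1 H2].
  rewrite <- (proj2 (gen_minus _ _ (Hg m) (Hg n))).
  rewrite <- (lin_minus (sg z)) by now apply sg_lin.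
  now apply sg_regular_dom. }
destruct (tends_Cauchy eventually (fun n => G (sg z (u n)))) as [l Hl].
{ intros eps Heps.
  assert (He : 0 < eps / (KR / Cmod z) / 2) by (apply Rdiv_lt_0_compat; [apply Rdiv_lt_0_compat|]; lra).
  destruct (Htu _ He) as [N HN]; exists (fun n => (N <= n)%nat); split; [now exists N|].
  intros m n Hm' Hn; eapply Rle_lt_trans; [apply Hd|].
  apply Rlt_le_trans with (KR / Cmod z * (eps / (KR / Cmod z))).
  - apply Rmult_lt_compat_l; [exact Hc|].
    replace (u m - u n)%V with ((u m - x) - (u n - x))%V by vec.
    eapply Rle_lt_trans; [apply norm_minus_le; apply Rle_refl|].
    generalize (HN m Hm') (HN n Hn); lra.
  - right; field; lra. }
destruct (gen_closed eventually _ _ _ Hg Htg Hl) as [H1 H2]; split; [exact H1|].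
rewrite H2; apply le_epsilon; intros eps Heps.
assert (He : 0 < eps / (KR / Cmod z)) by now apply Rdiv_lt_0_compat.
apply (tends_le eventually (fun n => G (sg z (u n)))); [exact Hl|].
destruct (Htu _ He) as [N HN]; exists N; intros n Hn.
eapply Rle_trans; [now apply sg_regular_dom, Hu|].
apply Rle_trans with (KR / Cmod z * (norm x + eps / (KR / Cmod z))).
- apply Rmult_le_compat_l; [lra|].
  replace (u n) with (x + (u n - x))%V by vec.
  apply norm_plus_le; [lra|]; left; now apply HN.
- right; field; lra.
Qed.

End Generator.
End Sectorial.

Lemma exp_second_order x : Rabs x <= / 2 -> 0 <= exp x - 1 - x <= 2 * x ^ 2.
Proof.
intros Hx; apply Rabs_le_between in Hx.
split; [generalize (exp_ineq1_le x); lra|].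
assert (H := exp_ineq1_le (- x)); rewrite exp_Ropp in H.
assert (Hp := exp_pos x).
assert (H1 : (1 - x) * exp x <= 1).
{ apply Rle_trans with (/ exp x * exp x); [apply Rmult_le_compat_r; lra | rewrite Rinv_l; lra]. }
nra.
Qed.

Lemma cos_second_order y : 0 <= 1 - cos y <= y ^ 2 / 2.
Proof.
assert (H : cos y = 1 - 2 * sin (y / 2) * sin (y / 2)).
{ rewrite <- cos_2a_sin; f_equal; field. }
assert (H1 : sin (y / 2) * sin (y / 2) <= (y / 2) * (y / 2)).
{ assert (Hs : forall t, 0 <= t -> Rabs (sin t) <= t).
  { intros t [Ht|<-]; [|rewrite sin_0, Rabs_R0; lra].
    destruct (Rle_dec t 1) as [H1|H1].
    - rewrite Rabs_right; [left; now apply sin_lt_x|].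
      apply Rle_ge, sin_ge_0; generalize PI_RGT_0 PI2_1; lra.
    - generalize (SIN_bound t); intros; apply Rabs_le; lra. }
  assert (Ha : Rabs (sin (y / 2)) <= Rabs (y / 2)).
  { destruct (Rle_dec 0 (y / 2)) as [H0|H0].
    - rewrite (Rabs_right (y / 2)) by lra; now apply Hs.
    - rewrite (Rabs_left (y / 2)) by lra.
      replace (y / 2) with (- - (y / 2)) at 1 by ring.
      rewrite sin_neg, Rabs_Ropp; apply Hs; lra. }
  apply Rsqr_le_abs_1 in Ha; exact Ha. }
generalize (COS_bound y); split; [lra|]; rewrite H; nra.
Qed.

Lemma sin_first_order y : Rabs (sin y - y) <= Rabs y * y ^ 2 / 2.
Proof.
assert (Hs : forall t, 0 <= t -> Rabs (sin t - t) <= t * t ^ 2 / 2).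
{ intros t [Ht|<-]; [|rewrite sin_0, Rminus_0_r, Rabs_R0; lra].
  destruct (MVT_cor2 sin cos 0 t Ht) as (c & H1 & H2).
  { intros; apply derivable_pt_lim_sin. }
  rewrite sin_0, Rminus_0_r, Rminus_0_r in H1; rewrite H1.
  replace (cos c * t - t) with (- (t * (1 - cos c))) by ring.
  assert (H3 := cos_second_order c); rewrite Rabs_Ropp, Rabs_right by nra.
  assert (c ^ 2 <= t ^ 2) by nra; nra. }
destruct (Rle_dec 0 y) as [H0|H0].
- rewrite (Rabs_right y) by lra; now apply Hs.
- rewrite (Rabs_left y) by lra; replace (y ^ 2) with ((- y) ^ 2) by ring.
  replace (sin y - y) with (- (sin (- y) - - y)) by (rewrite sin_neg; ring).
  rewrite Rabs_Ropp; apply Hs; lra.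
Qed.

Definition cexp (z : C) : C := (exp (Re z) * cos (Im z), exp (Re z) * sin (Im z)).

Lemma cexp_add a b : cexp (a + b) = (cexp a * cexp b)%C.
Proof.
destruct a as [a1 a2], b as [b1 b2]; unfold cexp, Cmult; simpl.
rewrite exp_plus, cos_plus, sin_plus; f_equal; ring.
Qed.

Lemma cexp_0 : cexp 0 = RtoC 1.
Proof. unfold cexp; simpl; rewrite exp_0, cos_0, sin_0; unfold RtoC; f_equal; ring. Qed.

Lemma Cmod_cexp z : Cmod (cexp z) = exp (Re z).
Proof.
unfold cexp, Cmod; simpl fst; simpl snd.
replace (_ + _) with (exp (Re z) ^ 2).
- apply sqrt_pow2, Rlt_le, exp_pos.
- generalize (sin2_cos2 (Im z)); unfold Rsqr; intros H.
  replace (exp (Re z) ^ 2) with (exp (Re z) ^ 2 * (sin (Im z) * sin (Im z) + cos (Im z) * cos (Im z))) by (rewrite H; ring).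
  ring.
Qed.

Lemma im_le_Cmod z : Rabs (Im z) <= Cmod z.
Proof.
replace (Rabs (Im z)) with (sqrt (Im z ^ 2)).
- apply sqrt_le_1_alt; destruct z as [a b]; simpl; nra.
- rewrite <- Rsqr_pow2; apply sqrt_Rsqr_abs.
Qed.

Lemma Cmod_le_sum z : Cmod z <= Rabs (Re z) + Rabs (Im z).
Proof.
destruct z as [a b]; simpl.
replace ((a, b) : C) with (RtoC a + Ci * RtoC b)%C by (unfold Ci, RtoC, Cmult, Cplus; simpl; f_equal; ring).
eapply Rle_trans; [apply Cmod_triangle|]; rewrite Cmod_mult, !Cmod_R.
replace (Cmod Ci) with 1; [lra|].
unfold Cmod, Ci; simpl; symmetry; replace (0 * (0 * 1) + 1 * (1 * 1)) with 1 by ring; apply sqrt_1.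
Qed.

Lemma cexp_second_order h : Cmod h <= / 2 -> Cmod (cexp h - 1 - h) <= 8 * Cmod h ^ 2.
Proof.
intros Hh; assert (Hx := re_le_Cmod h); assert (Hy := im_le_Cmod h).
destruct h as [x y]; simpl in Hx, Hy.
rewrite Cmod_sqr_alt; simpl fst; simpl snd.
assert (E1 := exp_second_order x ltac:(lra)); set (a := exp x - 1 - x) in *.
assert (E2 := cos_second_order y); set (b := 1 - cos y) in *.
assert (E3 := sin_first_order y); set (s := sin y - y) in *.
replace (cexp (x, y) - 1 - (x, y))%C with
  ((a - b * (1 + x + a), s * (1 + x + a) + (x + a) * y) : C).
2: { unfold cexp, Cminus, Cplus, Copp, RtoC; simpl; f_equal; unfold a, b, s; ring. }
eapply Rle_trans; [apply Cmod_le_sum|]; simpl Re; simpl Im.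
assert (Hx2 : Rabs x <= / 2) by lra; assert (Hy2 : Rabs y <= / 2) by lra.
assert (Hax : x ^ 2 = Rabs x ^ 2) by (now rewrite pow2_abs).
assert (Hay : y ^ 2 = Rabs y ^ 2) by (now rewrite pow2_abs).
rewrite Hax in *; rewrite Hay in *.
assert (Hxb := Rle_abs x); assert (Hxc := Rle_abs (- x)); rewrite Rabs_Ropp in Hxc.
generalize (Rabs_pos x) (Rabs_pos y); intros Hx0 Hy0.
assert (Ha1 : a <= / 2 * (2 * Rabs x)) by nra.
assert (B1 : Rabs (a - b * (1 + x + a)) <= 2 * Rabs x ^ 2 + Rabs y ^ 2).
{ apply Rabs_le; nra. }
assert (B2 : Rabs (s * (1 + x + a)) <= Rabs y ^ 2).
{ rewrite Rabs_mult, (Rabs_right (1 + x + a)) by nra.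
  assert (Rabs s <= Rabs y ^ 2 / 4) by nra. nra. }
assert (B3 : Rabs ((x + a) * y) <= 2 * Rabs x * Rabs y).
{ rewrite Rabs_mult; apply Rmult_le_compat_r; [lra|].
  eapply Rle_trans; [apply Rabs_triang|]; rewrite (Rabs_right a) by lra; lra. }
generalize (Rabs_triang (s * (1 + x + a)) ((x + a) * y)); nra.
Qed.

Lemma cexp_first_order h : Cmod h <= / 2 -> Cmod (cexp h - 1) <= 5 * Cmod h.
Proof.
intros Hh; replace (cexp h - 1)%C with ((cexp h - 1 - h) + h)%C by ring.
eapply Rle_trans; [apply Cmod_triangle|].
generalize (cexp_second_order h Hh) (Cmod_ge_0 h); nra.
Qed.

Lemma cexp_small (c h : C) : (Cmod c + 1) * Cmod h <= / 2 ->
  Cmod (cexp (c * h)) <= 4 /\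
  Cmod (cexp (c * h) - 1) <= 5 * (Cmod c + 1) * Cmod h /\
  Cmod (cexp (c * h) - 1 - c * h) <= 8 * (Cmod c + 1) ^ 2 * Cmod h ^ 2.
Proof.
intros H; assert (Hh := Cmod_ge_0 h); assert (Hc := Cmod_ge_0 c).
assert (Hm : Cmod (c * h) <= (Cmod c + 1) * Cmod h) by (rewrite Cmod_mult; nra).
assert (E1 := cexp_first_order _ (Rle_trans _ _ _ Hm H)).
assert (E2 := cexp_second_order _ (Rle_trans _ _ _ Hm H)).
split; [|split].
- replace (cexp (c * h)) with ((cexp (c * h) - 1) + 1)%C by ring.
  eapply Rle_trans; [apply Cmod_triangle|]; rewrite Cmod_1; lra.
- lra.
- eapply Rle_trans; [exact E2|].
  replace (8 * (Cmod c + 1) ^ 2 * Cmod h ^ 2) with (8 * ((Cmod c + 1) * Cmod h) ^ 2) by ring.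
  apply Rmult_le_compat_l; [lra|]; apply pow_incr; split; [apply Cmod_ge_0 | exact Hm].
Qed.

Lemma cexp_continuous_0 (c : C) eps : 0 < eps -> exists d, 0 < d /\
  forall h, Cmod h < d -> Cmod (cexp (c * h) - 1) < eps.
Proof.
intros Heps; set (k := Cmod c + 1); assert (Hk : 0 < k) by (unfold k; generalize (Cmod_ge_0 c); lra).
exists (Rmin (/ (2 * k)) (eps / (5 * k))); split.
{ apply Rmin_glb_lt; [apply Rinv_0_lt_compat | apply Rdiv_lt_0_compat]; lra. }
intros h Hh; apply Rmin_Rgt_l in Hh; destruct Hh as [H1 H2].
apply (Rmult_lt_compat_l k) in H1; [|exact Hk].
replace (k * / (2 * k)) with (/ 2) in H1 by (field; lra).
destruct (cexp_small c h) as (_ & E & _); [fold k; lra|]; fold k in E.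
apply (Rmult_lt_compat_l (5 * k)) in H2; [|lra].
replace (5 * k * (eps / (5 * k))) with eps in H2 by (field; lra); lra.
Qed.

Lemma exp_le_mono x y : x <= y -> exp x <= exp y.
Proof. intros [H| ->]; [left; now apply exp_increasing | apply Rle_refl]. Qed.

Section Semigroup.
Context {X : CompleteNormedModule C_AbsRing}.
Implicit Types x y : X.
Variables (kappa K : R) (G : poperator X).
Hypothesis HG : sectorial kappa K G.

Lemma dom_sg z x : cone kappa z -> z <> RtoC 0 -> dom G (sg G z x).
Proof. intros Hz Hz0; now apply (sg_regular kappa K G HG). Qed.

Lemma gen_sg_lin z : cone kappa z -> z <> RtoC 0 -> lin (fun x => G (sg G z x)).
Proof.
intros Hz Hz0; assert (Hl := sg_lin kappa K G HG z Hz); split.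
- intros x y; rewrite (lin_plus _ _ _ Hl); apply (sect_plus _ _ _ HG); now apply dom_sg.
- intros c x; rewrite (lin_scal _ _ _ Hl); apply (sect_scal _ _ _ HG); now apply dom_sg.
Qed.

Lemma sg_half z x : cone kappa z -> z <> RtoC 0 ->
  dom2 G (sg G z x) /\ norm (G (G (sg G z x))) <= (2 * KR K / Cmod z) ^ 2 * norm x.
Proof.
intros Hz Hz0; assert (HR := KR_pos kappa K G HG).
assert (Hm : 0 < Cmod z) by now apply Cmod_gt_0.
set (w := (RtoC (/ 2) * z)%C).
assert (Hw : cone kappa w) by (apply cone_scal; [lra | exact Hz]).
assert (Hwm : Cmod w = Cmod z / 2).
{ unfold w; rewrite Cmod_mult, Cmod_R, Rabs_right by lra; field. }
assert (Hw0 : w <> RtoC 0) by (apply Cmod_gt_0; lra).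
assert (Hzw : z = (w + w)%C).
{ unfold w; transitivity ((RtoC (/ 2) + RtoC (/ 2)) * z)%C; [|ring].
  rewrite <- RtoC_plus; replace (/ 2 + / 2) with 1 by field; ring. }
rewrite Hzw at 1 2; rewrite (sg_add kappa K G HG w w) by assumption.
destruct (sg_regular kappa K G HG w x Hw Hw0) as [H1 H2].
destruct (sg_gen kappa K G HG w _ Hw H1) as [H3 H4].
destruct (sg_regular kappa K G HG w (G (sg G w x)) Hw Hw0) as [H5 H6].
split; [split; [exact H3 | now rewrite H4]|].
rewrite H4; eapply Rle_trans; [exact H6|].
apply Rle_trans with (KR K / Cmod w * (KR K / Cmod w * norm x)).
- apply Rmult_le_compat_l; [left; apply Rdiv_lt_0_compat; lra | exact H2].
- rewrite Hwm; right; field; lra.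
Qed.

Lemma cone_interior s z h : 0 < kappa -> s = kappa * Re z - Rabs (Im z) -> 0 < s ->
  cone kappa (RtoC ((kappa + 1) * Cmod h / s) * z + h).
Proof.
intros Hk Hs Hs0; unfold cone.
set (eta := (kappa + 1) * Cmod h / s).
assert (Heta : 0 <= eta).
{ apply Rmult_le_pos; [|left; now apply Rinv_0_lt_compat].
  apply Rmult_le_pos; [lra | apply Cmod_ge_0]. }
assert (H1 := re_le_Cmod h); assert (H2 := im_le_Cmod h).
replace (Re (RtoC eta * z + h)) with (eta * Re z + Re h) by (destruct z, h; simpl; ring).
replace (Im (RtoC eta * z + h)) with (eta * Im z + Im h) by (destruct z, h; simpl; ring).
eapply Rle_trans; [apply Rabs_triang|]; rewrite Rabs_mult, (Rabs_right eta) by lra.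
assert (H3 : eta * s = (kappa + 1) * Cmod h) by (unfold eta; field; lra).
rewrite Hs in H3; generalize (Rle_abs (- Re h)); rewrite Rabs_Ropp; intros.
generalize (Cmod_ge_0 h); intros; nra.
Qed.

(** The increment [h] need not lie in the cone, but [z = z' + p] and
    [z + h = z' + q] with [p] and [q] in the cone and of size [O(|h|)]. *)
Lemma sg_derivable z s : s = kappa * Re z - Rabs (Im z) -> 0 < s ->
  exists c d, 0 < c /\ 0 < d /\ forall h x, Cmod h < d ->
    norm (sg G (z + h) x - sg G z x - h *: G (sg G z x))%V <= c * Cmod h ^ 2 * norm x.
Proof.
intros Hs Hs0; assert (Hk := sect_kappa _ _ _ HG).
assert (HR := KR_pos kappa K G HG); assert (HP := KP_ge_1 kappa K G HG).
assert (Hz : cone kappa z) by (unfold cone; lra).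
assert (Hz0 : z <> RtoC 0).
{ intros ->; simpl in Hs; rewrite Rabs_R0 in Hs; lra. }
assert (Hm : 0 < Cmod z) by now apply Cmod_gt_0.
set (c1 := (kappa + 1) * Cmod z / s).
assert (Hc1 : 0 < c1).
{ apply Rdiv_lt_0_compat; [apply Rmult_lt_0_compat|]; lra. }
set (b := (2 * KR K / (Cmod z / 2)) ^ 2).
assert (Hb : 0 < b).
{ apply pow_lt; apply Rdiv_lt_0_compat; lra. }
exists ((KP K ^ 2 * ((c1 + 1) ^ 2 + c1 ^ 2 + c1)) * b), (s / (2 * (kappa + 1))).
assert (HP2 : 0 < KP K ^ 2) by (apply pow_lt; lra).
split; [apply Rmult_lt_0_compat; [apply Rmult_lt_0_compat; [exact HP2 | nra] | exact Hb]|].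
split; [apply Rdiv_lt_0_compat; lra|].
intros h x Hh; assert (Hh0 := Cmod_ge_0 h).
set (eta := (kappa + 1) * Cmod h / s).
assert (Heta : 0 <= eta <= / 2).
{ unfold eta; split.
  - apply Rmult_le_pos; [apply Rmult_le_pos; lra | left; now apply Rinv_0_lt_compat].
  - apply (Rmult_le_reg_r s); [exact Hs0|]; unfold Rdiv; rewrite Rmult_assoc, Rinv_l by lra.
    apply (Rmult_lt_compat_l (kappa + 1)) in Hh; [|lra].
    replace ((kappa + 1) * (s / (2 * (kappa + 1)))) with (/ 2 * s) in Hh by (field; lra); lra. }
set (z' := (RtoC (1 - eta) * z)%C); set (p := (RtoC eta * z)%C); set (q := (RtoC eta * z + h)%C).
assert (Hz' : cone kappa z') by (apply cone_scal; [lra | exact Hz]).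
assert (Hp : cone kappa p) by (apply cone_scal; [lra | exact Hz]).
assert (Hq : cone kappa q) by now apply cone_interior.
assert (Hz'm : Cmod z / 2 <= Cmod z').
{ unfold z'; rewrite Cmod_mult, Cmod_R, Rabs_right by lra; nra. }
assert (Hz'0 : z' <> RtoC 0) by (apply Cmod_gt_0; lra).
assert (Hpm : Cmod p = c1 * Cmod h).
{ unfold p; rewrite Cmod_mult, Cmod_R, Rabs_right by lra; unfold eta, c1; field; lra. }
assert (Hqm : Cmod q <= (c1 + 1) * Cmod h).
{ unfold q; fold p; eapply Rle_trans; [apply Cmod_triangle|]; lra. }
destruct (sg_half z' x Hz' Hz'0) as [[Hy1 Hy2] Hy3].
set (y := sg G z' x) in *.
assert (Hyb : norm (G (G y)) <= b * norm x).
{ eapply Rle_trans; [exact Hy3|]; apply Rmult_le_compat_r; [apply norm_ge_0|].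
  apply pow_incr; split; [left; apply Rdiv_lt_0_compat; lra|].
  apply Rmult_le_compat_l; [lra|]; apply Rinv_le_contravar; lra. }
assert (Ezp : z = (p + z')%C).
{ unfold p, z'; rewrite RtoC_minus; ring. }
assert (Ezq : (z + h)%C = (q + z')%C).
{ unfold q; fold p; rewrite Ezp at 1; ring. }
rewrite Ezq, Ezp at 1; rewrite Ezp at 1.
rewrite !(sg_add kappa K G HG) by assumption; fold y.
rewrite (proj2 (sg_gen kappa K G HG p y Hp Hy1)).
replace (sg G q y - sg G p y - h *: sg G p (G y))%V with
  ((sg G q y - y - q *: G y) - (sg G p y - y - p *: G y) - h *: (sg G p (G y) - G y))%V
  by (unfold q, p; vec).
assert (B1 := sg_second_order kappa K G HG q y Hq (conj Hy1 Hy2)).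
assert (B2 := sg_second_order kappa K G HG p y Hp (conj Hy1 Hy2)).
assert (B3 := sg_sub_id kappa K G HG p (G y) Hp Hy2).
eapply Rle_trans.
{ apply norm_minus_le; [exact (norm_minus_le _ _ _ _ B1 B2)|].
  apply norm_scal_le; [apply Rle_refl | exact B3]. }
rewrite Hpm; set (g := norm (G (G y))) in *; assert (Hg : 0 <= g) by apply norm_ge_0.
assert (Hq2 : Cmod q ^ 2 <= ((c1 + 1) * Cmod h) ^ 2).
{ apply pow_incr; split; [apply Cmod_ge_0 | exact Hqm]. }
apply Rle_trans with (KP K ^ 2 * ((c1 + 1) ^ 2 + c1 ^ 2 + c1) * Cmod h ^ 2 * g).
- replace (KP K ^ 2 * ((c1 + 1) ^ 2 + c1 ^ 2 + c1) * Cmod h ^ 2 * g) with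
   (KP K ^ 2 * ((c1 + 1) * Cmod h) ^ 2 * g + KP K ^ 2 * (c1 * Cmod h) ^ 2 * g +
     Cmod h * (KP K ^ 2 * (c1 * Cmod h) * g)) by ring.
  apply Rplus_le_compat_r, Rplus_le_compat_r, Rmult_le_compat_r; [exact Hg|].
  apply Rmult_le_compat_l; lra.
- apply Rle_trans with (KP K ^ 2 * ((c1 + 1) ^ 2 + c1 ^ 2 + c1) * Cmod h ^ 2 * (b * norm x)); [|right; ring].
  apply Rmult_le_compat_l; [|exact Hyb].
  apply Rmult_le_pos; [apply Rmult_le_pos; nra | apply pow2_ge_0].
Qed.

Lemma sg_continuous_0 x eps : 0 < eps -> exists d, 0 < d /\
  forall z, cone kappa z -> Cmod z < d -> norm (sg G z x - x)%V < eps.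
Proof.
intros Heps; assert (HP := KP_ge_1 kappa K G HG).
destruct (sect_dense _ _ _ HG x (eps / (4 * (KP K + 1)))) as (y & Hy & Hxy).
{ apply Rdiv_lt_0_compat; lra. }
assert (Hg := norm_ge_0 (G y)).
assert (HP2 : 0 < KP K ^ 2) by (apply pow_lt; lra).
exists (eps / (2 * (KP K ^ 2 * (norm (G y) + 1)))); split.
{ apply Rdiv_lt_0_compat; nra. }
intros z Hz Hzd.
replace (sg G z x - x)%V with ((sg G z (x - y) - (x - y)) + (sg G z y - y))%V.
2: { rewrite (lin_minus _ _ _ (sg_lin kappa K G HG z Hz)); vec. }
assert (B1 : norm (sg G z (x - y) - (x - y))%V <= eps / 4).
{ replace (eps / 4) with (KP K * (eps / (4 * (KP K + 1))) + eps / (4 * (KP K + 1))) by (field; lra).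
  apply norm_minus_le; [now apply (sg_le kappa K G HG) | exact Hxy]. }
assert (B2 := sg_sub_id kappa K G HG z y Hz Hy).
assert (B3 : KP K ^ 2 * Cmod z * norm (G y) <= eps / 2).
{ apply Rle_trans with (KP K ^ 2 * (norm (G y) + 1) * Cmod z).
  - assert (0 <= KP K ^ 2 * Cmod z) by (apply Rmult_le_pos; [lra | apply Cmod_ge_0]); nra.
  - apply Rlt_le in Hzd; apply (Rmult_le_compat_l (KP K ^ 2 * (norm (G y) + 1))) in Hzd; [|nra].
    eapply Rle_trans; [exact Hzd|]; right; field; nra. }
eapply Rle_lt_trans; [exact (norm_plus_le _ _ _ _ B1 B2)|]; lra.
Qed.

End Semigroup.

Theorem sg_difference {X : CompleteNormedModule C_AbsRing} kappa K (G G0 : poperator X) eps :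
  sectorial kappa K G -> sectorial kappa K G0 -> 0 < eps ->
  (forall h mu x, cone kappa h -> h <> RtoC 0 -> 0 < Re mu ->
     norm (res G h mu x - res G0 h mu x)%V <= eps / Cmod mu * norm x) ->
  forall z x, cone kappa z -> norm (sg G z x - sg G0 z x)%V <= 180 * eps * (K + 2) ^ 2 * norm x.
Proof.
intros HG HG0 Heps HR z x Hz.
destruct (Ceq_dec z 0) as [->|Hz0].
{ rewrite (sg_0 kappa K G HG), (sg_0 kappa K G0 HG0), norm_minus_diag.
  assert (HK := sect_K _ _ _ HG).
  repeat apply Rmult_le_pos; try lra; apply norm_ge_0. }
apply (tends_le eventually (fun k => euler G k z x - euler G0 k z x)%V).
- apply (tends_minus eventually); [now apply (sg_tends kappa K G HG) | now apply (sg_tends kappa K G0 HG0)].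
- exists O; intros k _; unfold euler.
  assert (Hh := cone_div_pow2 kappa z k Hz).
  assert (Hh0 : (z / RtoC (2 ^ k))%C <> RtoC 0).
  { apply Cmod_gt_0; rewrite Cmod_div_pow2; apply Rdiv_lt_0_compat; [now apply Cmod_gt_0 | apply pow_2_pos]. }
  set (h := (z / RtoC (2 ^ k))%C) in *.
  apply (ritt_difference (K + 2) eps _ _ (ritt_res G h) (ritt_res G0 h)).
  + now apply (J_ritt kappa K G HG).
  + now apply (J_ritt kappa K G0 HG0).
  + exact Heps.
  + intros y; rewrite !J_ne by exact Hh0.
    eapply Rle_trans; [apply HR; trivial; apply Re_1_pos|].
    rewrite Cmod_1; right; field.
  + intros w y Hw; unfold ritt_res.
    replace (y + w *: res G h (1 - w) y - (y + w *: res G0 h (1 - w) y))%V with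
      (w *: (res G h (1 - w) y - res G0 h (1 - w) y))%V by vec.
    rewrite <- (Rmult_1_l (eps / _ * _)); apply norm_scal_le; [lra|].
    apply HR; trivial; now apply Re_1_minus.
Qed.

Lemma at_right_0 (P : R -> Prop) :
  at_right 0 P <-> exists d, 0 < d /\ forall t, 0 < t < d -> P t.
Proof.
split.
- intros [d Hd]; exists d; split; [apply cond_pos|]; intros t Ht.
  apply Hd; [|apply Ht].
  change (Rabs (t - 0) < d); rewrite Rminus_0_r, Rabs_right; lra.
- intros (d & Hd & H); exists (mkposreal d Hd); intros t Ht Ht0.
  change (Rabs (t - 0) < d) in Ht; apply H; split; [exact Ht0|].
  rewrite Rminus_0_r, Rabs_right in Ht; lra.
Qed.

Lemma locally_C_0 (Q P : C -> Prop) :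
  within Q (locally (RtoC 0)) P <->
  exists d, 0 < d /\ forall z, Cmod z < d -> Q z -> P z.
Proof.
split.
- intros [d Hd]; exists d; split; [apply cond_pos|]; intros z Hz.
  apply Hd; split; simpl.
  + change (Rabs (fst z - 0) < d); rewrite Rminus_0_r.
    eapply Rle_lt_trans; [exact (re_le_Cmod z) | exact Hz].
  + change (Rabs (snd z - 0) < d); rewrite Rminus_0_r.
    eapply Rle_lt_trans; [exact (im_le_Cmod z) | exact Hz].
- intros (d & Hd & H); assert (Hd2 : 0 < d / 2) by lra.
  exists (mkposreal _ Hd2); intros z [H1 H2]; apply H.
  change (Rabs (fst z - 0) < d / 2) in H1; change (Rabs (snd z - 0) < d / 2) in H2.
  rewrite Rminus_0_r in H1, H2.
  eapply Rle_lt_trans; [apply Cmod_le_sum|].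
  change (Rabs (fst z) + Rabs (snd z) < d); lra.
Qed.

Lemma open_sector_cone kappa z : 0 < kappa -> open_sector (atan kappa) z ->
  z <> RtoC 0 /\ 0 < kappa * Re z - Rabs (Im z).
Proof.
intros Hk [Hz0 (theta & [_ Hz] & Ht)]; split; [exact Hz0|].
apply Cmod_gt_0 in Hz0; set (m := Cmod z) in *.
assert (Ha := atan_bound kappa).
set (a := Rabs theta) in *; assert (Ha0 : 0 <= a) by apply Rabs_pos.
assert (Hc : 0 < cos a) by (apply cos_gt_0; lra).
assert (Htan : tan a < kappa).
{ rewrite <- (tan_atan kappa); apply tan_increasing; lra. }
assert (Hs : sin a < kappa * cos a).
{ apply (Rmult_lt_compat_r (cos a)) in Htan; [|exact Hc].
  unfold tan, Rdiv in Htan; rewrite Rmult_assoc, Rinv_l, Rmult_1_r in Htan; lra. }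
assert (Hs0 : 0 <= sin a) by (apply sin_ge_0; lra).
rewrite Hz; simpl.
assert (E1 : cos theta = cos a).
{ unfold a, Rabs; destruct (Rcase_abs theta); [symmetry; apply cos_neg | reflexivity]. }
assert (E2 : Rabs (m * sin theta) = m * sin a).
{ rewrite Rabs_mult, (Rabs_right m) by lra; f_equal.
  unfold a in *; unfold Rabs in *; destruct (Rcase_abs theta).
  - rewrite sin_neg in *; destruct (Rcase_abs (sin theta)); lra.
  - destruct (Rcase_abs (sin theta)); lra. }
rewrite E1, E2; nra.
Qed.

Lemma closed_sector_open d d' z : d' < d -> closed_sector d' z -> open_sector d z.
Proof.
intros Hd [H0 (theta & H1 & H2)]; split; [exact H0|].
exists theta; split; [exact H1 | lra].
Qed.

Lemma cone_closed_sector kappa z : 0 < kappa -> cone kappa z -> z <> RtoC 0 ->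
  closed_sector (atan kappa) z.
Proof.
intros Hk Hz Hz0; split; [exact Hz0|].
assert (Hre := cone_Re_pos kappa z Hk Hz Hz0); unfold cone in Hz.
destruct z as [a b]; simpl in *.
exists (atan (b / a)); split; [split|].
- generalize (atan_bound (b / a)) PI_RGT_0; lra.
- rewrite cos_atan, sin_atan.
  assert (Hp : 0 < sqrt (1 + (b / a)²)).
  { apply sqrt_lt_R0; generalize (Rle_0_sqr (b / a)); lra. }
  assert (Hm : Cmod (a, b) = a * sqrt (1 + (b / a)²)).
  { unfold Cmod; simpl fst; simpl snd.
    rewrite <- (sqrt_pow2 a) at 2 by lra.
    rewrite <- sqrt_mult_alt by apply pow2_ge_0.
    f_equal; unfold Rsqr; field; lra. }
  rewrite Hm; f_equal; field; lra.
- assert (Hb : Rabs (b / a) <= kappa).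
  { unfold Rdiv; rewrite Rabs_mult, (Rabs_right (/ a)).
    - apply (Rmult_le_reg_r a); [exact Hre|]; rewrite Rmult_assoc, Rinv_l; lra.
    - left; now apply Rinv_0_lt_compat. }
  apply Rabs_le_between in Hb; apply Rabs_le; rewrite <- atan_opp.
  split; destruct (Rle_lt_or_eq_dec _ _ (proj1 Hb)) as [H1|H1],
    (Rle_lt_or_eq_dec _ _ (proj2 Hb)) as [H2|H2];
    try (left; apply atan_increasing; lra); right; f_equal; lra.
Qed.

Section Packaging.
Context {X : CompleteNormedModule C_AbsRing}.
Implicit Types x y : X.
Variables (kappa K : R) (G : poperator X) (c : R).
Hypothesis HG : sectorial kappa K G.

Definition tdz (z : C) x : X := (cexp (c * z) *: sg G z x)%V.
Definition td (t : R) x : X := tdz t x.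

Lemma tdz_lin z : cone kappa z -> lin (tdz z).
Proof.
intros Hz; assert (Hl := sg_lin kappa K G HG z Hz); unfold tdz; split; intros.
- rewrite (lin_plus _ _ _ Hl); vec.
- rewrite (lin_scal _ _ _ Hl); vec.
Qed.

Lemma tdz_bnd z : cone kappa z -> bnd (tdz z) (exp (c * Re z) * KP K).
Proof.
intros Hz x; unfold tdz; rewrite Rmult_assoc; apply norm_scal_le.
- rewrite Cmod_cexp; right; f_equal; destruct z; simpl; ring.
- now apply (sg_bnd kappa K G HG).
Qed.

Lemma tdz_is_linear z : cone kappa z -> is_linear (tdz z : X -> X).
Proof. intros Hz; exact (is_linear_of_lin _ _ (tdz_lin z Hz) (tdz_bnd z Hz)). Qed.

Lemma tdz_0 x : tdz 0 x = x.
Proof.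
unfold tdz; rewrite (sg_0 kappa K G HG).
replace (c * 0)%C with (RtoC 0) by ring; rewrite cexp_0; vec.
Qed.

Lemma tdz_add a b x : cone kappa a -> cone kappa b -> tdz (a + b) x = tdz a (tdz b x).
Proof.
intros Ha Hb; unfold tdz.
rewrite (sg_add kappa K G HG), (lin_scal _ _ _ (sg_lin kappa K G HG a Ha)) by assumption.
replace (c * (a + b))%C with (c * a + c * b)%C by ring; rewrite cexp_add; vec.
Qed.

Lemma tdz_continuous_0 x eps : 0 < eps -> exists d, 0 < d /\
  forall z, cone kappa z -> Cmod z < d -> norm (tdz z x - x)%V < eps.
Proof.
intros Heps.
assert (H : tends (within (cone kappa) (locally (RtoC 0))) (fun z => tdz z x) (RtoC 1 *: x)%V).
{ apply (tends_scal_fun (within (cone kappa) (locally (RtoC 0)))).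
  - intros e He; apply locally_C_0.
    destruct (cexp_continuous_0 c e He) as (d & Hd & H); exists d; split; auto.
  - intros e He; apply locally_C_0.
    destruct (sg_continuous_0 kappa K G HG x e He) as (d & Hd & H); exists d; split; auto. }
replace (RtoC 1 *: x)%V with x in H by vec.
specialize (H eps Heps); apply locally_C_0 in H; destruct H as (d & Hd & H); exists d; split; auto.
Qed.

Lemma td_cone t : 0 <= t -> cone kappa t.
Proof. intros; apply cone_real; [left; apply (sect_kappa _ _ _ HG) | assumption]. Qed.

Lemma td_C0 : C0_semigroup (td : R -> X -> X).
Proof.
split; [|split; [|split]].
- intros t Ht; now apply tdz_is_linear, td_cone.
- exact tdz_0.
- intros s t x Hs Ht; unfold td; rewrite RtoC_plus; apply tdz_add; now apply td_cone.
- intros x; apply (proj1 (tends_filterlim (at_right 0) (fun t => td t x) x)).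
  intros eps Heps; apply at_right_0.
  destruct (tdz_continuous_0 x eps Heps) as (d & Hd & H); exists d; split; [exact Hd|].
  intros t Ht; apply H; [apply td_cone; lra|].
  rewrite Cmod_R, Rabs_right; lra.
Qed.

Lemma quotient_shift (S : R -> X -> X) (b : R) x y :
  tends (at_right 0) (fun h => / h *: (S h x - x))%V y ->
  tends (at_right 0) (fun h => / h *: (cexp (b * h) *: S h x - x))%V (y + RtoC b *: x)%V.
Proof.
intros H.
assert (Hsum : tends (at_right 0) (fun h : R => cexp (b * h) *: (/ h *: (S h x - x)) +
    (/ h * (cexp (b * h) - 1)) *: x)%V (RtoC 1 *: y + RtoC b *: x)%V).
{ apply (tends_plus (at_right 0)); apply (tends_scal_fun (at_right 0)).
  - intros e He; destruct (cexp_continuous_0 b e He) as (d & Hd & Hs); apply at_right_0.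
    exists d; split; [exact Hd|]; intros h Hh; apply Hs; rewrite Cmod_R, Rabs_right; lra.
  - exact H.
  - intros e He; set (k := Cmod b + 1).
    assert (Hk : 0 < k) by (unfold k; generalize (Cmod_ge_0 b); lra).
    assert (Hk2 : 0 < 8 * k ^ 2) by nra.
    apply at_right_0; exists (Rmin (/ (2 * k)) (e / (8 * k ^ 2))); split.
    { apply Rmin_glb_lt; [apply Rinv_0_lt_compat | apply Rdiv_lt_0_compat]; lra. }
    intros h [Hh0 Hh]; apply Rmin_Rgt_l in Hh; destruct Hh as [H1 H2].
    apply (Rmult_lt_compat_l k) in H1; [|exact Hk].
    replace (k * / (2 * k)) with (/ 2) in H1 by (field; lra).
    destruct (cexp_small b h) as (_ & _ & E).
    { rewrite (Cmod_R h), (Rabs_right h) by lra; fold k; lra. }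
    rewrite (Cmod_R h), (Rabs_right h) in E by lra; fold k in E. assert (Hhne : RtoC h <> RtoC 0) by (apply RtoC_ne; lra).
    replace (/ h * (cexp (b * h) - 1) - b)%C with (/ h * (cexp (b * h) - 1 - b * h))%C
      by (field; exact Hhne).
    rewrite Cmod_mult, Cmod_inv, Cmod_R, Rabs_right by (trivial; lra).
    apply (Rmult_lt_compat_l (8 * k ^ 2)) in H2; [|exact Hk2].
    replace (8 * k ^ 2 * (e / (8 * k ^ 2))) with e in H2 by (field; lra).
    apply (Rmult_lt_reg_l h); [lra|]; rewrite <- Rmult_assoc, Rinv_r, Rmult_1_l by lra.
    eapply Rle_lt_trans; [exact E|]; nra.
  - apply (tends_const (at_right 0)). }
replace (RtoC 1 *: y + RtoC b *: x)%V with (y + RtoC b *: x)%V in Hsum by vec.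
intros e He; specialize (Hsum e He); apply at_right_0 in Hsum; destruct Hsum as (d & Hd & Hs).
apply at_right_0; exists d; split; [exact Hd|]; intros h Hh; specialize (Hs h Hh).
assert (Hhne : RtoC h <> RtoC 0) by (apply RtoC_ne; lra).
replace (/ h *: (cexp (b * h) *: S h x - x))%V with
  (cexp (b * h) *: (/ h *: (S h x - x)) + (/ h * (cexp (b * h) - 1)) *: x)%V by (vecf; exact Hhne).
exact Hs.
Qed.

Lemma sg_generator x y :
  (dom G x /\ G x = y) <-> tends (at_right 0) (fun h : R => / h *: (sg G h x - x))%V y.
Proof.
assert (Hfwd : forall x, dom G x -> tends (at_right 0) (fun h : R => / h *: (sg G h x - x))%V (G x)).
{ clear x y; intros x Hx eps Heps; apply at_right_0.
  assert (HP := KP_ge_1 kappa K G HG).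
  destruct (sect_dense _ _ _ HG (G x) (eps / (2 * (KP K + 1)))) as (v & Hv & Hxv).
  { apply Rdiv_lt_0_compat; lra. }
  assert (Hg := norm_ge_0 (G v)); assert (HP2 : 0 < KP K ^ 2) by (apply pow_lt; lra).
  exists (eps / (2 * (KP K ^ 2 * (norm (G v) + 1)))); split; [apply Rdiv_lt_0_compat; nra|].
  intros h [Hh0 Hh].
  assert (Hhne : RtoC h <> RtoC 0) by (apply RtoC_ne; lra).
  replace (/ h *: (sg G h x - x) - G x)%V with (/ h *: (sg G h x - x - RtoC h *: G x))%V
    by (vecf; exact Hhne).
  rewrite norm_scalC, Cmod_inv, Cmod_R, Rabs_right by (trivial; lra).
  apply (Rmult_lt_reg_l h); [lra|].
  rewrite <- Rmult_assoc, Rinv_r, Rmult_1_l by lra.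
  eapply Rle_lt_trans; [apply (sg_first_order kappa K G HG h x v); trivial; apply td_cone; lra|].
  rewrite Cmod_R, Rabs_right by lra; apply Rmult_lt_compat_l; [lra|].
  assert (B1 : (KP K + 1) * norm (G x - v)%V <= eps / 2).
  { replace (eps / 2) with ((KP K + 1) * (eps / (2 * (KP K + 1)))) by (field; lra).
    apply Rmult_le_compat_l; lra. }
  assert (B2 : h * (KP K ^ 2 * (norm (G v) + 1)) < eps / 2).
  { replace (eps / 2) with (eps / (2 * (KP K ^ 2 * (norm (G v) + 1))) * (KP K ^ 2 * (norm (G v) + 1)))
      by (field; nra).
    apply Rmult_lt_compat_r; nra. }
  nra. }
split; [intros [Hx <-]; now apply Hfwd|]; intros H.
assert (Hc : cone kappa 1) by (apply td_cone; lra).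
assert (H1 : RtoC 1 <> RtoC 0) by (apply RtoC_ne; lra).
assert (Hl := J_lin kappa K G HG 1 Hc); assert (Hb := J_iter_bnd kappa K G HG 1 1 Hc).
destruct (J_spec kappa K G HG 1 x Hc H1) as [H2 H3].
assert (E : G (J G 1 x) = J G 1 y).
{ apply (tends_unique (at_right 0) (fun h : R => / h *: (sg G h (J G 1 x) - J G 1 x))%V);
    [now apply Hfwd|].
  intros eps Heps.
  assert (HJ := tends_lin (at_right 0) (J G 1) _ _ _ Hl Hb H eps Heps).
  apply at_right_0 in HJ; destruct HJ as (d & Hd & HJ); apply at_right_0.
  exists d; split; [exact Hd|]; intros h Hh; specialize (HJ h Hh).
  replace (sg G h (J G 1 x)) with (J G 1 (sg G h x)).
  { rewrite (lin_scal _ _ _ Hl), (lin_minus _ _ _ Hl) in HJ; exact HJ. }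
  assert (Hch : cone kappa h) by (apply td_cone; lra).
  symmetry; apply (sg_unique kappa K G HG); [exact Hch|].
  apply (tends_ext eventually (fun k => J G 1 (euler G k h x))).
  - intros k; symmetry; apply iter_comm; intros z; apply (J_comm kappa K G HG); trivial.
    now apply cone_div_pow2.
  - apply (tends_lin eventually (J G 1) _ _ _ Hl Hb); now apply (sg_tends kappa K G HG). }
assert (Ex : x = J G 1 (x - y)%V).
{ rewrite (lin_minus _ _ _ Hl), <- E; rewrite <- H3 at 1; vec. }
destruct (J_spec kappa K G HG 1 (x - y)%V Hc H1) as [H4 H5]; rewrite <- Ex in H4, H5.
split; [exact H4|]; transitivity (x - (x - RtoC 1 *: G x))%V; [vec|]; rewrite H5; vec.
Qed.

Lemma td_generator (Gc : poperator X) :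
  (forall x, dom Gc x <-> dom G x) -> (forall x, dom G x -> Gc x = (G x + RtoC c *: x)%V) ->
  is_generator Gc (td : R -> X -> X).
Proof.
intros Hdom Happ x y.
assert (HF := tends_filterlim (at_right 0) (fun h : R => / h *: (td h x - x))%V y).
transitivity (tends (at_right 0) (fun h : R => / h *: (td h x - x))%V y).
2: { etransitivity; [exact HF|].
     assert (Heq : at_right 0 (fun h => / h *: (td h x - x) = RtoC (/ h) *: (td h x - x))%V).
     { apply at_right_0; exists 1; split; [lra|]; intros h Hh; rewrite RtoC_inv by lra; reflexivity. }
     split; apply filterlim_ext_loc; [exact Heq|].
     revert Heq; apply filter_imp; intros h E; symmetry; exact E. }
split.
- intros [Hx <-]; apply Hdom in Hx; rewrite Happ by exact Hx.
  apply (quotient_shift (fun h => sg G h) c), sg_generator; now split.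
- intros H.
  assert (H' := quotient_shift td (- c) x y H).
  assert (Hs : tends (at_right 0) (fun h : R => / h *: (sg G h x - x))%V (y + RtoC (- c) *: x)%V).
  { revert H'; apply (tends_ext (at_right 0)); intros h; do 2 f_equal.
    unfold td, tdz; transitivity ((cexp ((- c)%R * h) * cexp (c * h)) *: sg G h x)%V; [vec|].
    rewrite <- cexp_add.
    replace ((- c)%R * h + c * h)%C with (RtoC 0); [rewrite cexp_0; vec|].
    rewrite RtoC_opp; ring. }
  apply sg_generator in Hs; destruct Hs as [H1 H2].
  split; [now apply Hdom|]; rewrite Happ, H2, RtoC_opp by exact H1; vec.
Qed.

Lemma tdz_derivable z : open_sector (atan kappa) z -> op_derivable (tdz : C -> X -> X) z.
Proof.
intros Hzs; assert (Hk := sect_kappa _ _ _ HG).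
destruct (open_sector_cone kappa z Hk Hzs) as [Hz0 Hs].
assert (Hz : cone kappa z) by (unfold cone; lra).
assert (Hl := sg_lin kappa K G HG z Hz); assert (Hgl := gen_sg_lin kappa K G HG z Hz Hz0).
assert (HR := KR_pos kappa K G HG); assert (HP := KP_ge_1 kappa K G HG).
assert (Hm : 0 < Cmod z) by now apply Cmod_gt_0.
set (e := cexp (c * z)).
assert (He : 0 < Cmod e) by (unfold e; rewrite Cmod_cexp; apply exp_pos).
exists (fun x : X => e *: (RtoC c *: sg G z x + G (sg G z x)))%V; split.
{ apply (is_linear_of_lin _ (Cmod e * (Rabs c * KP K + KR K / Cmod z))).
  - split; intros.
    + rewrite (lin_plus _ _ _ Hgl), (lin_plus _ _ _ Hl); vec.
    + rewrite (lin_scal _ _ _ Hgl), (lin_scal _ _ _ Hl); vec.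
  - intros x; rewrite Rmult_assoc; apply norm_scal_le; [lra|].
    rewrite Rmult_plus_distr_r, Rmult_assoc; apply norm_plus_le.
    + apply norm_scal_le; [rewrite Cmod_R; lra | now apply (sg_bnd kappa K G HG)].
    + now apply (sg_regular kappa K G HG). }
destruct (sg_derivable kappa K G HG z _ eq_refl Hs) as (b & d & Hb & Hd & Hder).
set (k := Cmod c + 1); assert (Hk1 : 1 <= k) by (unfold k; generalize (Cmod_ge_0 c); lra).
assert (Hq : 0 < KR K / Cmod z) by now apply Rdiv_lt_0_compat.
set (B := Cmod e * (4 * b + 8 * k ^ 2 * KP K + 5 * k * (KR K / Cmod z))).
assert (Hk2 : 0 < k ^ 2) by nra.
assert (HB : 0 < B) by (unfold B; apply Rmult_lt_0_compat; nra).
intros eps; assert (Heps := cond_pos eps).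
assert (Hd1 : 0 < eps / B) by now apply Rdiv_lt_0_compat.
assert (Hd3 : 0 < / (2 * k)) by (apply Rinv_0_lt_compat; lra).
assert (Hd0 : 0 < Rmin d (Rmin (eps / B) (/ (2 * k)))) by (repeat apply Rmin_glb_lt; assumption).
exists (mkposreal _ Hd0); simpl; intros h Hh x.
apply Rmin_Rgt_l in Hh; destruct Hh as [H1 Hh]; apply Rmin_Rgt_l in Hh; destruct Hh as [H2 H3].
assert (Hh0 := Cmod_ge_0 h); assert (Hx := norm_ge_0 x).
apply (Rmult_lt_compat_l k) in H3; [|lra].
replace (k * / (2 * k)) with (/ 2) in H3 by (field; lra).
destruct (cexp_small c h) as (E3 & E1 & E2); [fold k; lra|]; fold k in E1, E2.
change (norm (tdz (z + h) x - tdz z x - h *: (e *: (RtoC c *: sg G z x + G (sg G z x))))%V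
  <= eps * Cmod h * norm x).
unfold tdz; replace (c * (z + h))%C with (c * z + c * h)%C by ring.
rewrite cexp_add; fold e; set (f := cexp (c * h)) in *.
assert (Hd2 := Hder h x H1).
set (u := sg G z x) in *; set (v := sg G (z + h) x) in *.
replace ((e * f) *: v - e *: u - h *: (e *: (RtoC c *: u + G u)))%V with
  (e *: (f *: (v - u - h *: G u) + ((f - 1 - c * h) *: u + ((f - 1) * h) *: G u)))%V by vec.
assert (B1 : norm (f *: (v - u - h *: G u))%V <= 4 * (b * Cmod h ^ 2 * norm x)).
{ now apply norm_scal_le. }
assert (B2 : norm ((f - 1 - c * h) *: u)%V <= (8 * k ^ 2 * Cmod h ^ 2) * (KP K * norm x)).
{ apply norm_scal_le; [exact E2 | now apply (sg_bnd kappa K G HG)]. }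
assert (B3 : norm (((f - 1) * h) *: G u)%V <= (5 * k * Cmod h * Cmod h) * (KR K / Cmod z * norm x)).
{ apply norm_scal_le; [|now apply (sg_regular kappa K G HG)].
  rewrite Cmod_mult; apply Rmult_le_compat_r; lra. }
rewrite norm_scalC.
apply Rle_trans with (Cmod e * (4 * (b * Cmod h ^ 2 * norm x) +
  ((8 * k ^ 2 * Cmod h ^ 2) * (KP K * norm x) +
   (5 * k * Cmod h * Cmod h) * (KR K / Cmod z * norm x)))).
{ apply Rmult_le_compat_l; [lra|].
  exact (norm_plus_le _ _ _ _ B1 (norm_plus_le _ _ _ _ B2 B3)). }
apply Rle_trans with (B * Cmod h * (Cmod h * norm x)); [right; unfold B; ring|].
apply Rle_trans with (eps * (Cmod h * norm x)); [|right; ring].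
apply Rmult_le_compat_r; [now apply Rmult_le_pos|].
replace (pos eps) with (B * (eps / B)) by (field; lra).
apply Rmult_le_compat_l; lra.
Qed.

Lemma td_analytic : analytic_semigroup (td : R -> X -> X).
Proof.
assert (Hk := sect_kappa _ _ _ HG).
assert (Hidx : forall z, open_sector (atan kappa) z \/ z = RtoC 0 -> cone kappa z).
{ intros z [Hz| ->]; [|apply cone_0].
  apply (open_sector_cone kappa z Hk) in Hz; unfold cone; lra. }
split; [apply td_C0|]; exists (atan kappa), (tdz : C -> X -> X).
split; [|split].
- split; [rewrite <- atan_0; now apply atan_increasing | left; apply atan_bound].
- split; [|split; [|split; [|split]]].
  + intros z Hz; now apply tdz_is_linear, Hidx.
  + exact tdz_0.
  + intros a b x Ha Hb; apply tdz_add; now apply Hidx.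
  + exact tdz_derivable.
  + intros x d' Hd'; apply (proj1 (tends_filterlim _ (fun z => tdz z x) x)).
    intros eps Heps; apply locally_C_0.
    destruct (tdz_continuous_0 x eps Heps) as (d & Hd & H); exists d; split; [exact Hd|].
    intros z Hz Hzc; apply H; [|exact Hz].
    apply Hidx; left; apply (closed_sector_open _ d'); [lra | exact Hzc].
- reflexivity.
Qed.

End Packaging.

(** * Vector-valued integrals *)

Section Integrals.
Context {X : CompleteNormedModule C_AbsRing}.
Implicit Types f g : R -> X.

Definition cont f t := forall eps, 0 < eps ->
  exists d, 0 < d /\ forall s, Rabs (s - t) < d -> norm (f s - f t)%V < eps.

Definition has_deriv f t (l : X) := forall eps, 0 < eps ->
  exists d, 0 < d /\ forall s, Rabs s < d ->
    norm (f (t + s)%R - f t - RtoC s *: l)%V <= eps * Rabs s.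

Definition vint f a b : X := RInt (V := realify X) f a b.

Lemma cont_continuous f t : cont f t -> continuous (f : R -> realify X) t.
Proof.
intros H; apply (filterlim_locally_ball_norm (K := R_AbsRing) (U := realify X)).
intros eps; destruct (H eps (cond_pos eps)) as (d & Hd & Hs).
exists (mkposreal d Hd); intros s Hst; exact (Hs s Hst).
Qed.

Lemma has_deriv_is_derive f t l : has_deriv f t l ->
  is_derive (K := R_AbsRing) (V := realify X) f t l.
Proof.
intros H; split; [apply (is_linear_scal_l (K := R_AbsRing) (V := realify X))|].
intros x Hx.
assert (E := is_filter_lim_locally_unique (K := R_AbsRing) (V := AbsRing_NormedModule R_AbsRing) t x Hx).
subst x; clear Hx.
intros eps; destruct (H eps (cond_pos eps)) as (d & Hd & Hs).
exists (mkposreal d Hd); intros s Hst.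
specialize (Hs (s - t) Hst); rewrite (Rplus_minus t s) in Hs.
exact Hs.
Qed.

Lemma ex_vint f a b : (forall t, Rmin a b <= t <= Rmax a b -> cont f t) ->
  ex_RInt (V := realify X) f a b.
Proof. intros H; apply (ex_RInt_continuous (V := realify X)); intros; now apply cont_continuous, H. Qed.

Lemma vint_ftc f g a b : a <= b -> (forall t, a <= t <= b -> has_deriv f t (g t)) ->
  (forall t, a <= t <= b -> cont g t) -> vint g a b = (f b - f a)%V.
Proof.
intros Hab Hd Hc; apply (is_RInt_unique (V := realify X)).
apply (is_RInt_derive (V := realify X)); intros t Ht;
  rewrite Rmin_left, Rmax_right in Ht by exact Hab.
- now apply has_deriv_is_derive, Hd.
- now apply cont_continuous, Hc.
Qed.

Lemma vint_ext f g a b : a <= b -> (forall t, a < t < b -> f t = g t) -> vint f a b = vint g a b.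
Proof.
intros Hab H; apply (RInt_ext (V := realify X)); intros t Ht; apply H.
now rewrite Rmin_left, Rmax_right in Ht by exact Hab.
Qed.

Lemma vint_norm f a b M : a <= b -> (forall t, cont f t) ->
  (forall t, a <= t <= b -> norm (f t) <= M) -> norm (vint f a b) <= (b - a) * M.
Proof.
intros Hab Hc HM.
apply (norm_RInt_le_const (V := realify X) f a b _ M Hab); [exact HM|].
apply (RInt_correct (V := realify X)), ex_vint; intros; apply Hc.
Qed.

Lemma vint_plus f g a b : (forall t, cont f t) -> (forall t, cont g t) ->
  vint (fun t => f t + g t)%V a b = (vint f a b + vint g a b)%V.
Proof.
intros Hf Hg; apply (RInt_plus (V := realify X)); apply ex_vint; intros; trivial.
Qed.

Lemma Riemann_sum_lin (E : X -> X) f ptd : lin E ->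
  Riemann_sum (V := realify X) (fun t => E (f t)) ptd = E (Riemann_sum (V := realify X) f ptd).
Proof.
intros HE; induction ptd as [x0 | h ptd IH] using SF_cons_ind.
- symmetry; exact (lin_zero E HE).
- rewrite !Riemann_sum_cons, IH.
  symmetry; etransitivity; [apply (lin_plus E _ _ HE)|].
  f_equal; exact (lin_scal E _ _ HE).
Qed.

Lemma vint_lin (E : X -> X) K f a b : lin E -> bnd E K -> (forall t, cont f t) ->
  vint (fun t => E (f t)) a b = E (vint f a b).
Proof.
intros HE HK Hf; apply (is_RInt_unique (V := realify X)).
assert (H : is_RInt (V := realify X) f a b (vint f a b)).
{ apply (RInt_correct (V := realify X)), ex_vint; intros; apply Hf. }
unfold is_RInt in *.
apply (tends_filterlim (Riemann_fine a b)
  (fun ptd => scal (sign (b - a)) (Riemann_sum (V := realify X) f ptd)) (vint f a b)) in H.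
apply (tends_lin (Riemann_fine a b) E K _ _ HE HK) in H.
apply (tends_filterlim (Riemann_fine a b)).
revert H; apply (tends_ext (Riemann_fine a b)); intros ptd.
rewrite Riemann_sum_lin by exact HE; exact (lin_scal E _ _ HE).
Qed.

Lemma cont_lin (E : X -> X) K f t : lin E -> bnd E K -> cont f t -> cont (fun t => E (f t)) t.
Proof.
intros HE HK Hf eps Heps; set (k := Rabs K + 1).
assert (Hk : 0 < k) by (unfold k; generalize (Rabs_pos K); lra).
destruct (Hf (eps / k)) as (d & Hd & H); [now apply Rdiv_lt_0_compat|].
exists d; split; [exact Hd|]; intros s Hs; specialize (H s Hs).
rewrite <- lin_minus by exact HE; eapply Rle_lt_trans; [apply HK|].
apply Rle_lt_trans with (k * norm (f s - f t)%V).
- apply Rmult_le_compat_r; [apply norm_ge_0|]; unfold k; generalize (Rle_abs K); lra.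
- apply (Rmult_lt_compat_l k) in H; [|exact Hk].
  replace (k * (eps / k)) with eps in H by (field; lra); exact H.
Qed.

Lemma cont_plus f g t : cont f t -> cont g t -> cont (fun t => f t + g t)%V t.
Proof.
intros Hf Hg eps Heps.
destruct (Hf (eps / 2)) as (d1 & Hd1 & H1); [lra|].
destruct (Hg (eps / 2)) as (d2 & Hd2 & H2); [lra|].
exists (Rmin d1 d2); split; [now apply Rmin_glb_lt|]; intros s Hs.
apply Rmin_Rgt_l in Hs; destruct Hs as [Hs1 Hs2].
replace (f s + g s - (f t + g t))%V with ((f s - f t) + (g s - g t))%V by vec.
eapply Rle_lt_trans; [apply norm_triangleX|].
generalize (H1 s Hs1) (H2 s Hs2); lra.
Qed.

Lemma cexp_deriv (mu : C) f t l : has_deriv f t l ->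
  has_deriv (fun s => cexp (mu * s) *: f s)%V t (cexp (mu * t) *: (mu *: f t + l))%V.
Proof.
intros Hf eps Heps; set (e := cexp (mu * t)).
assert (He : 0 < Cmod e) by (unfold e; rewrite Cmod_cexp; apply exp_pos).
set (k := Cmod mu + 1); assert (Hk : 0 < k) by (unfold k; generalize (Cmod_ge_0 mu); lra).
destruct (Hf (eps / (8 * Cmod e))) as (d & Hd & H); [apply Rdiv_lt_0_compat; lra|].
assert (Hn := norm_ge_0 (f t)); assert (Hl := norm_ge_0 l).
set (b := 8 * k ^ 2 * norm (f t) + 5 * k * norm l + 1).
assert (Hb : 0 < b).
{ assert (0 <= k ^ 2 * norm (f t)) by (apply Rmult_le_pos; nra).
  assert (0 <= k * norm l) by nra; unfold b; lra. }
assert (Hd2 : 0 < eps / (2 * Cmod e * b)) by (apply Rdiv_lt_0_compat; nra).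
assert (Hd3 : 0 < / (2 * k)) by (apply Rinv_0_lt_compat; lra).
exists (Rmin d (Rmin (eps / (2 * Cmod e * b)) (/ (2 * k)))); split.
{ repeat apply Rmin_glb_lt; assumption. }
intros s Hs; apply Rmin_Rgt_l in Hs; destruct Hs as [H1 Hs]; apply Rmin_Rgt_l in Hs.
destruct Hs as [H2 H3]; specialize (H s H1).
assert (Hs0 := Rabs_pos s).
apply (Rmult_lt_compat_l k) in H3; [|lra].
replace (k * / (2 * k)) with (/ 2) in H3 by (field; lra).
destruct (cexp_small mu s) as (E3 & E1 & E2); [rewrite Cmod_R; fold k; lra|].
rewrite Cmod_R in E1, E2; fold k in E1, E2.
rewrite RtoC_plus; replace (mu * (t + s))%C with (mu * t + mu * s)%C by ring.
rewrite cexp_add; fold e; set (q := cexp (mu * s)) in *.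
set (v := f (t + s)) in *; set (u := f t) in *.
replace ((e * q) *: v - e *: u - RtoC s *: (e *: (mu *: u + l)))%V with
  (e *: (q *: (v - u - RtoC s *: l) + ((q - 1 - mu * s) *: u + ((q - 1) * s) *: l)))%V by vec.
assert (B1 : norm (q *: (v - u - RtoC s *: l))%V <= 4 * (eps / (8 * Cmod e) * Rabs s)).
{ now apply norm_scal_le. }
assert (B2 : norm ((q - 1 - mu * s) *: u)%V <= (8 * k ^ 2 * Rabs s ^ 2) * norm u).
{ apply norm_scal_le; lra. }
assert (B3 : norm (((q - 1) * s) *: l)%V <= (5 * k * Rabs s * Rabs s) * norm l).
{ apply norm_scal_le; [|lra]; rewrite Cmod_mult, Cmod_R; apply Rmult_le_compat_r; lra. }
rewrite norm_scalC.
eapply Rle_trans.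
{ apply Rmult_le_compat_l; [lra|].
  exact (norm_plus_le _ _ _ _ B1 (norm_plus_le _ _ _ _ B2 B3)). }
assert (B4 : Cmod e * (b * Rabs s) <= eps / 2).
{ apply Rlt_le; replace (eps / 2) with (Cmod e * b * (eps / (2 * Cmod e * b))) by (field; lra).
  rewrite <- Rmult_assoc; apply Rmult_lt_compat_l; [nra | exact H2]. }
apply Rle_trans with (eps / 2 * Rabs s + Cmod e * (b * Rabs s) * Rabs s).
- apply Rle_trans with (eps / 2 * Rabs s + Cmod e * ((b - 1) * Rabs s) * Rabs s).
  + right; unfold b; field; lra.
  + apply Rplus_le_compat_l, Rmult_le_compat_r; [exact Hs0|].
    apply Rmult_le_compat_l; [lra|]; apply Rmult_le_compat_r; lra.
- apply (Rmult_le_compat_r _ _ _ Hs0) in B4; lra.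
Qed.

Lemma cexp_cont (mu : C) f t : cont f t -> cont (fun s => cexp (mu * s) *: f s)%V t.
Proof.
intros Hf; set (F := fun P => exists d, 0 < d /\ forall s, Rabs (s - t) < d -> P s).
assert (FF : Filter F).
{ split.
  - exists 1; split; [lra | auto].
  - intros P Q (d1 & Hd1 & H1) (d2 & Hd2 & H2); exists (Rmin d1 d2).
    split; [now apply Rmin_glb_lt|]; intros s Hs; apply Rmin_Rgt_l in Hs; split; [apply H1 | apply H2]; apply Hs.
  - intros P Q HPQ (d & Hd & H); exists d; split; auto. }
apply (tends_scal_fun F); [|exact Hf]; intros eps Heps.
assert (He : 0 < Cmod (cexp (mu * t))) by (rewrite Cmod_cexp; apply exp_pos).
destruct (cexp_continuous_0 mu (eps / Cmod (cexp (mu * t)))) as (d & Hd & H).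
{ now apply Rdiv_lt_0_compat. }
exists d; split; [exact Hd|]; intros s Hs; specialize (H (s - t)%R); rewrite Cmod_R in H; specialize (H Hs).
replace (cexp (mu * s) - cexp (mu * t))%C with (cexp (mu * t) * (cexp (mu * (s - t)%R) - 1))%C.
- rewrite Cmod_mult; apply (Rmult_lt_compat_l _ _ _ He) in H.
  replace (Cmod (cexp (mu * t)) * (eps / Cmod (cexp (mu * t)))) with eps in H by (field; lra); exact H.
- transitivity (cexp (mu * t) * cexp (mu * (s - t)%R) - cexp (mu * t))%C; [ring|].
  rewrite <- cexp_add; do 2 f_equal; rewrite RtoC_minus; ring.
Qed.

End Integrals.

(** * Strongly continuous semigroups and their generators *)

Section RealSemigroup.
Context {X : CompleteNormedModule C_AbsRing}.
Implicit Types x y : X.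

Record semi (A : poperator X) (S : R -> X -> X) : Prop := {
  semi_lin : forall t, 0 <= t -> lin (S t);
  semi_0 : forall x, S 0 x = x;
  semi_add : forall s t x, 0 <= s -> 0 <= t -> S (s + t) x = S s (S t x);
  semi_bnd : forall a, 0 <= a -> exists M, 1 <= M /\ forall t, 0 <= t <= a -> bnd (S t) M;
  semi_cont : forall x, tends (at_right 0) (fun t => S t x) x;
  semi_gen : forall x y, (dom A x /\ A x = y) <->
    tends (at_right 0) (fun h => RtoC (/ h) *: (S h x - x))%V y
}.

Section OneSemigroup.
Variables (A : poperator X) (S : R -> X -> X).
Hypothesis HS : semi A S.

Lemma semi_comm s t x : 0 <= s -> 0 <= t -> S s (S t x) = S t (S s x).
Proof.
intros Hs Ht; rewrite <- !(semi_add _ _ HS) by assumption; now rewrite Rplus_comm.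
Qed.

Lemma semi_commuting (E : X -> X) K x : lin E -> bnd E K ->
  (forall t, 0 < t -> S t (E x) = E (S t x)) -> dom A x -> dom A (E x) /\ A (E x) = E (A x).
Proof.
intros Hl HK HE Hx; apply (semi_gen _ _ HS).
assert (H := proj1 (semi_gen _ _ HS x (A x)) (conj Hx eq_refl)).
intros eps Heps.
assert (H2 := tends_lin (at_right 0) E K _ _ Hl HK H eps Heps).
apply at_right_0 in H2; destruct H2 as (d & Hd & H2); apply at_right_0.
exists d; split; [exact Hd|]; intros h Hh; specialize (H2 h Hh).
rewrite (lin_scal _ _ _ Hl), (lin_minus _ _ _ Hl) in H2.
rewrite HE by lra; exact H2.
Qed.

Lemma semi_dom t x : 0 <= t -> dom A x -> dom A (S t x) /\ A (S t x) = S t (A x).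
Proof.
intros Ht; destruct (semi_bnd _ _ HS t Ht) as (M & _ & HM).
apply (semi_commuting _ M); [now apply (semi_lin _ _ HS) | apply HM; lra|].
intros s Hs; apply semi_comm; lra.
Qed.

Lemma semi_tends_elim x y eps : dom A x -> A x = y -> 0 < eps -> exists d, 0 < d /\
  forall h, 0 < h < d -> norm (S h x - x - RtoC h *: y)%V <= h * eps.
Proof.
intros Hx Hy Heps.
assert (H := proj1 (semi_gen _ _ HS x y) (conj Hx Hy) eps Heps).
apply at_right_0 in H; destruct H as (d & Hd & H); exists d; split; [exact Hd|].
intros h Hh; specialize (H h Hh).
assert (Hhne : RtoC h <> RtoC 0) by (apply RtoC_ne; lra).
replace (S h x - x - RtoC h *: y)%V with (RtoC h *: (RtoC (/ h) *: (S h x - x) - y))%V.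
- rewrite norm_scalC, Cmod_R, Rabs_right by lra; apply Rmult_le_compat_l; lra.
- rewrite RtoC_inv by lra; vecf; exact Hhne.
Qed.

Lemma semi_first_order_step n h y e q M : 0 <= h -> dom A y ->
  norm (S h y - y - RtoC h *: A y)%V <= q ->
  (forall r, 0 <= r <= INR n * h -> norm (S r (A y) - A y)%V <= e) -> 
  (forall r, 0 <= r <= INR n * h -> bnd (S r) M) -> 0 <= M ->
  norm (S (INR n * h)%R y - y - RtoC (INR n * h) *: A y)%V <= INR n * (M * q + h * e).
Proof.
intros Hh Hy Hq; induction n as [|n IH]; intros He HM HM0.
- simpl; rewrite !Rmult_0_l, (semi_0 _ _ HS).
  replace (y - y - RtoC 0 *: A y)%V with (0%V : X) by vec; rewrite norm_zeroX; lra.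
- assert (Hn := pos_INR n); assert (Hnh : 0 <= INR n * h) by nra.
  rewrite S_INR in *.
  replace ((INR n + 1) * h) with (INR n * h + h) in * by ring.
  set (r := INR n * h) in *.
  rewrite (semi_add _ _ HS r h), RtoC_plus by assumption.
  assert (Hl := semi_lin _ _ HS r Hnh).
  replace (S r (S h y) - y - (r + h) *: A y)%V with
    ((S r y - y - RtoC r *: A y) + (S r (S h y - y - RtoC h *: A y) +
       RtoC h *: (S r (A y) - A y)))%V.
  2: { rewrite !(lin_minus _ _ _ Hl), (lin_scal _ _ _ Hl); vec. }
  replace ((INR n + 1) * (M * q + h * e)) with (INR n * (M * q + h * e) + (M * q + h * e)) by ring.
  apply norm_plus_le; [apply IH; [intros; apply He; lra | intros; apply HM; lra | exact HM0]|].
  apply norm_plus_le.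
  + apply bnd_le; [apply HM; lra | exact HM0 | exact Hq].
  + apply norm_scal_le; [rewrite Cmod_R, Rabs_right; lra | apply He; lra].
Qed.

Lemma semi_first_order s y e : 0 <= s -> dom A y ->
  (forall r, 0 <= r <= s -> norm (S r (A y) - A y)%V <= e) ->
  norm (S s y - y - RtoC s *: A y)%V <= s * e.
Proof.
intros Hs Hy He; destruct (semi_bnd _ _ HS s Hs) as (M & HM1 & HM).
destruct Hs as [Hs|<-].
2: { rewrite (semi_0 _ _ HS); replace (y - y - RtoC 0 *: A y)%V with (0%V : X) by vec.
     rewrite norm_zeroX; lra. }
apply le_epsilon; intros eps Heps.
destruct (semi_tends_elim y (A y) (eps / (M * s)) Hy eq_refl) as (d & Hd & H).
{ apply Rdiv_lt_0_compat; nra. }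
destruct (nfloor_ex (s / d)) as [n [_ Hn]].
{ left; now apply Rdiv_lt_0_compat. }
set (N := Datatypes.S n); set (h := s / INR N).
assert (HN : 0 < INR N) by (apply lt_0_INR; unfold N; lia).
assert (Hh : 0 < h) by now apply Rdiv_lt_0_compat.
assert (Hhd : h < d).
{ unfold h; apply (Rmult_lt_reg_r (INR N)); [exact HN|].
  unfold Rdiv; rewrite Rmult_assoc, Rinv_l, Rmult_1_r by lra.
  unfold N; rewrite S_INR; apply (Rmult_lt_compat_l d) in Hn; [|exact Hd].
  replace (d * (s / d)) with s in Hn by (field; lra); lra. }
assert (HNh : INR N * h = s) by (unfold h; field; lra).
assert (HB := semi_first_order_step N h y e (h * (eps / (M * s))) M).
rewrite HNh in HB; eapply Rle_trans.
- apply HB; [lra | exact Hy | apply H; lra | exact He | exact HM | lra].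
- replace (INR N * (M * (h * (eps / (M * s))) + h * e)) with
    ((INR N * h) * e + (INR N * h) * (eps / s)) by (field; lra).
  rewrite HNh; right; field; lra.
Qed.

Lemma semi_lipschitz s y M : 0 <= s -> dom A y ->
  (forall r, 0 <= r <= s -> bnd (S r) M) -> 
  norm (S s y - y)%V <= s * ((M + 2) * norm (A y)).
Proof.
intros Hs Hy HM.
replace (S s y - y)%V with ((S s y - y - RtoC s *: A y) + RtoC s *: A y)%V by vec.
replace (s * ((M + 2) * norm (A y))) with (s * ((M + 1) * norm (A y)) + s * norm (A y)) by ring.
apply norm_plus_le.
- apply semi_first_order; [exact Hs | exact Hy|]; intros r Hr.
  rewrite Rmult_plus_distr_r; apply norm_minus_le; [now apply HM | lra].
- rewrite norm_scalC, Cmod_R, Rabs_right by lra; lra.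
Qed.

Lemma semi_second_order s y M : 0 <= s -> dom A y -> dom A (A y) -> 0 <= M ->
  (forall r, 0 <= r <= s -> bnd (S r) M) -> 
  norm (S s y - y - RtoC s *: A y)%V <= s ^ 2 * ((M + 2) * norm (A (A y))).
Proof.
intros Hs Hy HAy HM0 HM.
replace (s ^ 2 * ((M + 2) * norm (A (A y)))) with (s * (s * ((M + 2) * norm (A (A y))))) by ring.
apply semi_first_order; [exact Hs | exact Hy|]; intros r Hr.
eapply Rle_trans; [apply (semi_lipschitz r (A y) M); [apply Hr | exact HAy|]|].
- intros r' Hr'; apply HM; lra.
- apply Rmult_le_compat_r; [|lra].
  apply Rmult_le_pos; [lra | apply norm_ge_0].
Qed.

Lemma semi_closed {I} (F : (I -> Prop) -> Prop) {FF : ProperFilter F} u p w :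
  (forall i, dom A (u i)) -> tends F u p -> tends F (fun i => A (u i)) w ->
  dom A p /\ A p = w.
Proof.
intros Hu Hp Hw; apply (semi_gen _ _ HS); intros eps Heps.
destruct (semi_bnd _ _ HS 1 ltac:(lra)) as (M & HM1 & HM).
destruct (proj1 (at_right_0 _) (semi_cont _ _ HS w (eps / 4) ltac:(lra))) as (d & Hd & Hc).
apply at_right_0; exists (Rmin d 1); split; [apply Rmin_glb_lt; lra|].
intros s [Hs0 Hs]; apply Rmin_Rgt_l in Hs; destruct Hs as [Hs1 Hs2].
assert (Hs : norm (S s p - p - RtoC s *: w)%V <= s * (eps / 2)).
{ apply (tends_le F (fun i => S s (u i) - u i - RtoC s *: A (u i))%V).
  - apply (tends_minus F); [|now apply (tends_scal F)].
    apply (tends_minus F); [|exact Hp].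
    apply (tends_lin F (S s) M); [now apply (semi_lin _ _ HS), Rlt_le | apply HM; lra | exact Hp].
  - assert (He : 0 < eps / (4 * (M + 1))) by (apply Rdiv_lt_0_compat; lra).
    generalize (Hw _ He); apply filter_imp; intros i Hi.
    apply semi_first_order; [lra | apply Hu|]; intros r Hr.
    assert (Hl := semi_lin _ _ HS r (proj1 Hr)).
    replace (S r (A (u i)) - A (u i))%V with
      ((S r (A (u i) - w) - (A (u i) - w)) + (S r w - w))%V
      by (rewrite (lin_minus _ _ _ Hl); vec).
    replace (eps / 2) with ((M * (eps / (4 * (M + 1))) + eps / (4 * (M + 1))) + eps / 4) by (field; lra).
    apply norm_plus_le.
    + apply norm_minus_le; [|lra].
      apply bnd_le; [apply HM; lra | lra | lra].
    + destruct (proj1 Hr) as [Hr0|<-].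
      * left; apply Hc; lra.
      * rewrite (semi_0 _ _ HS), norm_minus_diag; lra. }
assert (Hsne : RtoC s <> RtoC 0) by (apply RtoC_ne; lra).
replace (RtoC (/ s) *: (S s p - p) - w)%V with (RtoC (/ s) *: (S s p - p - RtoC s *: w))%V
  by (rewrite RtoC_inv by lra; vecf; exact Hsne).
rewrite norm_scalC, Cmod_R, Rabs_right by (left; now apply Rinv_0_lt_compat).
apply Rle_lt_trans with (/ s * (s * (eps / 2))).
- apply Rmult_le_compat_l; [left; now apply Rinv_0_lt_compat | exact Hs].
- rewrite <- Rmult_assoc, Rinv_l; lra.
Qed.

Lemma semi_iter h n x : 0 <= h -> Nat.iter n (S h) x = S (INR n * h)%R x.
Proof.
intros Hh; induction n as [|n IH]; [simpl; now rewrite Rmult_0_l, (semi_0 _ _ HS)|].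
rewrite S_INR; change (S h (Nat.iter n (S h) x) = S ((INR n + 1) * h)%R x).
assert (0 <= INR n * h) by (apply Rmult_le_pos; [apply pos_INR | exact Hh]).
rewrite IH, <- (semi_add _ _ HS) by assumption; f_equal; ring.
Qed.

End OneSemigroup.

Lemma semi_gen_plus (A : poperator X) S x y : semi A S -> dom A x -> dom A y ->
  dom A (x + y)%V /\ A (x + y)%V = (A x + A y)%V.
Proof.
intros HS Hx Hy; apply (semi_gen _ _ HS).
assert (T1 := proj1 (semi_gen _ _ HS x (A x)) (conj Hx eq_refl)).
assert (T2 := proj1 (semi_gen _ _ HS y (A y)) (conj Hy eq_refl)).
assert (T3 := tends_plus (at_right 0) _ _ _ _ T1 T2).
intros eps Heps; specialize (T3 eps Heps); apply at_right_0 in T3.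
destruct T3 as (r & Hr & H); apply at_right_0; exists r; split; [exact Hr|].
intros s Hs; specialize (H s Hs).
assert (Hl := semi_lin _ _ HS s ltac:(lra)); rewrite (lin_plus _ _ _ Hl).
replace (RtoC (/ s) *: (S s x + S s y - (x + y)))%V with
  (RtoC (/ s) *: (S s x - x) + RtoC (/ s) *: (S s y - y))%V by vec; exact H.
Qed.

Lemma semi_gen_scal (A : poperator X) S c x : semi A S -> dom A x ->
  dom A (c *: x)%V /\ A (c *: x)%V = (c *: A x)%V.
Proof.
intros HS Hx; apply (semi_gen _ _ HS).
assert (T1 := proj1 (semi_gen _ _ HS x (A x)) (conj Hx eq_refl)).
assert (T3 := tends_scal (at_right 0) c _ _ T1).
intros eps Heps; specialize (T3 eps Heps); apply at_right_0 in T3.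
destruct T3 as (r & Hr & H); apply at_right_0; exists r; split; [exact Hr|].
intros s Hs; specialize (H s Hs).
assert (Hl := semi_lin _ _ HS s ltac:(lra)); rewrite (lin_scal _ _ _ Hl).
replace (RtoC (/ s) *: (c *: S s x - c *: x))%V with
  (c *: (RtoC (/ s) *: (S s x - x)))%V by vec; exact H.
Qed.

Lemma semi_unique (A : poperator X) (S1 S2 : R -> X -> X) t x :
  semi A S1 -> semi A S2 -> 0 <= t -> dom A x -> dom A (A x) -> S1 t x = S2 t x.
Proof.
intros H1 H2 Ht Hx HAx.
destruct (semi_bnd _ _ H1 t Ht) as (M1 & HM1 & B1).
destruct (semi_bnd _ _ H2 t Ht) as (M2 & HM2 & B2).
set (c := M1 * ((M1 + 2) * (M2 * norm (A (A x))) + (M2 + 2) * (M2 * norm (A (A x))))).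
assert (Hg := norm_ge_0 (A (A x))).
assert (Hc : 0 <= c) by (unfold c; assert (0 <= M2 * norm (A (A x))) by nra;
  apply Rmult_le_pos; [lra | apply Rplus_le_le_0_compat; apply Rmult_le_pos; lra]).
apply eq_of_small; intros eps Heps.
destruct (nfloor_ex (t ^ 2 * c / eps)) as [n [_ Hn]].
{ apply Rmult_le_pos; [nra | left; now apply Rinv_0_lt_compat]. }
set (N := Datatypes.S n); set (h := t / INR N).
assert (HN : 0 < INR N) by (apply lt_0_INR; unfold N; lia).
assert (Hh : 0 <= h) by (apply Rmult_le_pos; [exact Ht | left; now apply Rinv_0_lt_compat]).
assert (HNh : INR N * h = t) by (unfold h; field; lra).
assert (Hin : forall i, (i <= N)%nat -> 0 <= INR i * h <= t).
{ intros i Hi; apply le_INR in Hi; assert (Hi0 := pos_INR i); rewrite <- HNh; split; nra. }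
assert (HN1 : 1 <= INR N) by (apply (le_INR 1); unfold N; lia).
assert (Hht : h <= t) by (rewrite <- HNh; nra).
rewrite <- HNh, <- (semi_iter A S1 H1), <- (semi_iter A S2 H2) by exact Hh.
assert (HT : norm (Nat.iter N (S1 h) x - Nat.iter N (S2 h) x)%V <= INR N * (M1 * (h ^ 2 * (c / M1)))).
{ clear Hn Heps eps.
  apply telescope; [lra | now apply (semi_lin _ _ H1) | |]; intros i Hi.
  { intros v; rewrite (semi_iter A S1 H1) by exact Hh; apply B1, Hin; lia. }
  simpl Nat.iter; set (y := Nat.iter i (S2 h) x).
  assert (Hy : dom A y /\ dom A (A y) /\ norm (A (A y)) <= M2 * norm (A (A x))).
  { unfold y; rewrite (semi_iter A S2 H2) by exact Hh.
    destruct (Hin i ltac:(lia)) as [Hi0 Hi1].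
    destruct (semi_dom A S2 H2 _ x Hi0 Hx) as [Hy1 Hy2].
    destruct (semi_dom A S2 H2 _ _ Hi0 HAx) as [Hy3 Hy4].
    rewrite Hy2, Hy4; split; [exact Hy1 | split; [exact Hy3|]]; apply B2; lra. }
  destruct Hy as (Hy1 & Hy2 & Hy3).
  assert (C1 := semi_second_order A S1 H1 h y M1 Hh Hy1 Hy2 ltac:(lra) ltac:(intros; apply B1; lra)).
  assert (C2 := semi_second_order A S2 H2 h y M2 Hh Hy1 Hy2 ltac:(lra) ltac:(intros; apply B2; lra)).
  replace (S1 h y - S2 h y)%V with
    ((S1 h y - y - RtoC h *: A y) - (S2 h y - y - RtoC h *: A y))%V by vec.
  eapply Rle_trans; [exact (norm_minus_le _ _ _ _ C1 C2)|].
  assert (Hh2 := pow2_ge_0 h).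
  replace (h ^ 2 * (c / M1)) with (h ^ 2 * ((M1 + 2) * (M2 * norm (A (A x)))) +
     h ^ 2 * ((M2 + 2) * (M2 * norm (A (A x))))) by (unfold c; field; lra).
  apply Rplus_le_compat; apply Rmult_le_compat_l; trivial; apply Rmult_le_compat_l; lra. }
eapply Rle_trans; [exact HT|].
replace (INR N * (M1 * (h ^ 2 * (c / M1)))) with (t ^ 2 * c / INR N) by (unfold h; field; lra).
apply (Rmult_le_reg_r (INR N)); [exact HN|].
unfold Rdiv at 1; rewrite Rmult_assoc, Rinv_l, Rmult_1_r by lra.
apply (Rmult_lt_compat_l eps) in Hn; [|exact Heps].
replace (eps * (t ^ 2 * c / eps)) with (t ^ 2 * c) in Hn by (field; lra).
unfold N; rewrite S_INR; lra.
Qed.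

End RealSemigroup.

(** * Resolvent estimates from an analytic semigroup *)

Section Holomorphic.
Context {X : CompleteNormedModule C_AbsRing}.
Implicit Types x y : X.

Record holo (kappa : R) (A : poperator X) (S : C -> X -> X) : Prop := {
  holo_kappa : 0 < kappa;
  holo_lin : forall z, cone kappa z -> lin (S z);
  holo_bnd : forall z, cone kappa z -> exists K, bnd (S z) K;
  holo_0 : forall x, S 0 x = x;
  holo_add : forall a b x, cone kappa a -> cone kappa b -> S (a + b)%C x = S a (S b x);
  holo_der : forall z, cone kappa z -> z <> RtoC 0 -> exists L, lin L /\ (exists K, bnd L K) /\
    forall eps, 0 < eps -> exists d, 0 < d /\ forall h x, Cmod h < d ->
      norm (S (z + h)%C x - S z x - h *: L x)%V <= eps * Cmod h * norm x;
  holo_cont : forall x eps, 0 < eps -> exists d, 0 < d /\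
    forall z, cone kappa z -> Cmod z < d -> norm (S z x - x)%V < eps;
  holo_gen : forall x y, (dom A x /\ A x = y) <->
    tends (at_right 0) (fun h => RtoC (/ h) *: (S (RtoC h) x - x))%V y
}.

Lemma finite_bound (u : nat -> R) N : exists B, forall n, (n < N)%nat -> u n <= B.
Proof.
induction N as [|N [B HB]]; [exists 0; intros; lia|].
exists (Rmax B (u N)); intros n Hn.
destruct (Nat.eq_dec n N) as [->|Hne]; [apply Rmax_r|].
eapply Rle_trans; [apply HB; lia | apply Rmax_l].
Qed.

Section OneFamily.
Variables (kappa : R) (A : poperator X) (S : C -> X -> X).
Hypothesis HS : holo kappa A S.

Let Hk : 0 < kappa := holo_kappa _ _ _ HS.

Lemma holo_local_bound : exists M d, 1 <= M /\ 0 < d /\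
  forall z, cone kappa z -> Cmod z <= d -> bnd (S z) M.
Proof.
apply NNPP; intros Hn.
assert (Hz : forall n : nat, exists z, cone kappa z /\ Cmod z <= 1 / 2 ^ n /\ ~ bnd (S z) (2 ^ n)).
{ intros n; apply NNPP; intros H; apply Hn; exists (2 ^ n), (1 / 2 ^ n).
  split; [apply pow_R1_Rle; lra|]; split; [apply Rdiv_lt_0_compat; [lra | apply pow_2_pos]|].
  intros z H1 H2; apply NNPP; intros H3; apply H; now exists z. }
destruct (choice _ Hz) as [z Hzn].
destruct (uniform_boundedness (fun n => S (z n))) as [M HM].
- intros n; apply (holo_lin _ _ _ HS), Hzn.
- intros n; apply (holo_bnd _ _ _ HS), Hzn.
- intros x; destruct (holo_cont _ _ _ HS x 1 Rlt_0_1) as (d & Hd & H).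
  destruct (geom_small 1 d Hd) as [N HN].
  destruct (finite_bound (fun n => norm (S (z n) x)) N) as [B HB].
  exists (Rmax B (norm x + 1)); intros n; destruct (Nat.lt_ge_cases n N) as [H1|H1].
  + eapply Rle_trans; [now apply HB | apply Rmax_l].
  + eapply Rle_trans; [|apply Rmax_r].
    replace (S (z n) x) with (x + (S (z n) x - x))%V by vec.
    apply norm_plus_le; [lra|]; left; apply H; [apply Hzn|].
    eapply Rle_lt_trans; [apply Hzn | now apply HN].
- destruct (geom_small M 1 Rlt_0_1) as [N HN].
  specialize (HN N (le_n N)); apply (proj2 (proj2 (Hzn N))).
  assert (Hp := pow_2_pos N).
  assert (HMN : M <= 2 ^ N).
  { apply (Rmult_lt_compat_r (2 ^ N)) in HN; [|exact Hp].
    unfold Rdiv in HN; rewrite Rmult_assoc, Rinv_l in HN by lra; lra. }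
  intros x; eapply Rle_trans; [apply HM|].
  apply Rmult_le_compat_r; [apply norm_ge_0 | exact HMN].
Qed.

Lemma holo_iter n z x : cone kappa z -> S (RtoC (INR n) * z)%C x = Nat.iter n (S z) x.
Proof.
intros Hz; induction n as [|n IH].
- simpl INR; replace (0 * z)%C with (RtoC 0) by ring; apply (holo_0 _ _ _ HS).
- rewrite S_INR, RtoC_plus; replace ((INR n + 1) * z)%C with (z + INR n * z)%C by ring.
  rewrite (holo_add _ _ _ HS), IH; [reflexivity | exact Hz|].
  apply cone_scal; [apply pos_INR | exact Hz].
Qed.

Lemma holo_growth : exists M w, 1 <= M /\ 0 <= w /\
  forall z, cone kappa z -> bnd (S z) (M * exp (w * Re z)).
Proof.
destruct holo_local_bound as (M & d & HM & Hd & HB).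
assert (HlnM : 0 <= ln M).
{ destruct HM as [HM|<-]; [left; rewrite <- ln_1; apply ln_increasing; lra | rewrite ln_1; lra]. }
exists M, (ln M * (1 + kappa) / d); split; [exact HM | split].
{ apply Rmult_le_pos; [nra | left; now apply Rinv_0_lt_compat]. }
intros z Hz x.
destruct (nfloor_ex (Cmod z / d)) as [n0 Hn0].
{ apply Rmult_le_pos; [apply Cmod_ge_0 | left; now apply Rinv_0_lt_compat]. }
set (n := Datatypes.S n0); assert (Hn : 0 < INR n) by (apply lt_0_INR; unfold n; lia).
set (v := (RtoC (/ INR n) * z)%C).
assert (Hv : cone kappa v) by (apply cone_scal; [left; now apply Rinv_0_lt_compat | exact Hz]).
assert (Hzv : z = (INR n * v)%C).
{ unfold v; rewrite RtoC_inv by lra; field.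
  apply RtoC_ne; lra. }
assert (Hvd : Cmod v <= d).
{ unfold v; rewrite Cmod_mult, Cmod_R, Rabs_right by (left; now apply Rinv_0_lt_compat).
  apply (Rmult_le_reg_l (INR n)); [exact Hn|].
  rewrite <- Rmult_assoc, Rinv_r, Rmult_1_l by lra; unfold n; rewrite S_INR.
  replace (Cmod z) with (Cmod z / d * d) by (field; lra).
  apply Rmult_le_compat_r; lra. }
rewrite Hzv at 1; rewrite holo_iter by exact Hv.
eapply Rle_trans; [apply (bnd_iter (S v) M n); [lra | now apply HB]|].
apply Rmult_le_compat_r; [apply norm_ge_0|].
unfold n; simpl pow; apply Rmult_le_compat_l; [lra|].
rewrite <- (Rpower_pow n0) by lra; unfold Rpower.
assert (H : INR n0 * ln M <= ln M * (1 + kappa) / d * Re z).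
{ assert (Hc : Cmod z <= (1 + kappa) * Re z).
  { eapply Rle_trans; [apply Cmod_le_sum|]; unfold cone in Hz.
    assert (Hre : 0 <= Re z) by (generalize (Rabs_pos (Im z)); intros; nra).
    rewrite (Rabs_right (Re z)) by lra; lra. }
  replace (ln M * (1 + kappa) / d * Re z) with (((1 + kappa) * Re z) / d * ln M) by (field; lra).
  apply Rmult_le_compat_r; [exact HlnM|].
  apply Rle_trans with (Cmod z / d); [lra|].
  apply Rmult_le_compat_r; [left; now apply Rinv_0_lt_compat | exact Hc]. }
now apply exp_le_mono.
Qed.

Lemma holo_semi : semi A (fun t => S (RtoC t)).
Proof.
assert (Hc : forall t, 0 <= t -> cone kappa t) by (intros; apply cone_real; lra).
split.
- intros t Ht; now apply (holo_lin _ _ _ HS), Hc.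
- exact (holo_0 _ _ _ HS).
- intros s t x Hs Ht; rewrite RtoC_plus; apply (holo_add _ _ _ HS); now apply Hc.
- intros a Ha; destruct holo_growth as (M & w & HM & Hw & HB).
  assert (Hwa : 1 <= exp (w * a)).
  { generalize (exp_ineq1_le (w * a)); assert (0 <= w * a) by nra; lra. }
  exists (M * exp (w * a)); split; [nra|]; intros t Ht x.
  eapply Rle_trans; [apply HB, Hc, Ht|].
  apply Rmult_le_compat_r; [apply norm_ge_0|]; apply Rmult_le_compat_l; [lra|].
  simpl Re; assert (Hwt : w * t <= w * a) by (apply Rmult_le_compat_l; lra).
  now apply exp_le_mono.
- intros x eps Heps; destruct (holo_cont _ _ _ HS x eps Heps) as (d & Hd & H).
  apply at_right_0; exists d; split; [exact Hd|]; intros t Ht.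
  apply H; [apply Hc; lra|]; rewrite Cmod_R, Rabs_right; lra.
- exact (holo_gen _ _ _ HS).
Qed.

Lemma holo_dom z : cone kappa z -> z <> RtoC 0 ->
  (forall x, dom A (S z x)) /\ lin (fun x => A (S z x)) /\ (exists K, bnd (fun x => A (S z x)) K) /\
  forall eps, 0 < eps -> exists d, 0 < d /\ forall h x, Cmod h < d ->
      norm (S (z + h)%C x - S z x - h *: A (S z x))%V <= eps * Cmod h * norm x.
Proof.
intros Hz Hz0; destruct (holo_der _ _ _ HS z Hz Hz0) as (L & HL & HLb & Hd).
assert (HA : forall x, dom A (S z x) /\ A (S z x) = L x).
{ intros x; apply (holo_gen _ _ _ HS); intros eps Heps.
  assert (Hx := norm_ge_0 x).
  destruct (Hd (eps / (norm x + 1))) as (d & Hd0 & H); [apply Rdiv_lt_0_compat; lra|].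
  apply at_right_0; exists d; split; [exact Hd0|]; intros h Hh.
  assert (Hhne : RtoC h <> RtoC 0) by (apply RtoC_ne; lra).
  specialize (H (RtoC h) x); rewrite Cmod_R, Rabs_right in H by lra.
  rewrite Cplus_comm, (holo_add _ _ _ HS) in H; [| apply cone_real; lra | exact Hz].
  replace (RtoC (/ h) *: (S h (S z x) - S z x) - L x)%V with
    (RtoC (/ h) *: (S h (S z x) - S z x - RtoC h *: L x))%V by (rewrite RtoC_inv by lra; vecf; exact Hhne).
  rewrite norm_scalC, Cmod_R, Rabs_right by (left; apply Rinv_0_lt_compat; lra).
  apply Rle_lt_trans with (/ h * (eps / (norm x + 1) * h * norm x)).
  - apply Rmult_le_compat_l; [left; apply Rinv_0_lt_compat; lra | apply H; lra].
  - replace (/ h * (eps / (norm x + 1) * h * norm x)) with (eps * (norm x / (norm x + 1))) by (field; lra).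
    assert (norm x / (norm x + 1) < 1).
    { apply (Rmult_lt_reg_r (norm x + 1)); [lra|]; unfold Rdiv; rewrite Rmult_assoc, Rinv_l; lra. }
    nra. }
assert (HE : forall x, L x = A (S z x)) by (intros; symmetry; apply HA).
split; [intros; apply HA|]; split; [|split].
- split; intros; rewrite <- !HE; apply HL.
- destruct HLb as [K HK]; exists K; intros x; cbv beta; rewrite <- HE; apply HK.
- intros eps Heps; destruct (Hd eps Heps) as (d & Hd0 & H); exists d; split; [exact Hd0|].
  intros h x Hh; rewrite <- HE; now apply H.
Qed.

Section Laplace.
Variables (M w : R) (h lam : C).
Hypothesis HM : 1 <= M.
Hypothesis HMw : forall z, cone kappa z -> bnd (S z) (M * exp (w * Re z)).
Hypothesis Hh : cone kappa h.
Hypothesis Hh0 : h <> RtoC 0.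
Let rho := Re lam - w * Re h.
Hypothesis Hrho : 0 < rho.

Let ray (t : R) : C := (RtoC t * h)%C.

Lemma cone_ray t : 0 <= t -> cone kappa (ray t).
Proof. intros Ht; now apply cone_scal. Qed.

(** Constant at negative times, so that it is continuous on the whole line. *)
Definition orbit x (t : R) : X := S (RtoC (Rmax 0 t) * h)%C x.

Lemma damped_bnd t x : 0 <= t -> norm (cexp (- lam * t) *: S (ray t) x)%V <= M * exp (- rho * t) * norm x.
Proof.
intros Ht; rewrite norm_scalC, Cmod_cexp.
replace (Re (- lam * t)) with (- Re lam * t) by (destruct lam; simpl; ring).
eapply Rle_trans; [apply Rmult_le_compat_l; [left; apply exp_pos | apply HMw, cone_ray, Ht]|].
replace (Re (ray t)) with (t * Re h) by (unfold ray; destruct h; simpl; ring).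
right; replace (- rho * t) with (- Re lam * t + w * (t * Re h)) by (unfold rho; ring).
rewrite exp_plus; ring.
Qed.

Lemma orbit_cont x t : cont (orbit x) t.
Proof.
assert (Hhm : 0 < Cmod h) by now apply Cmod_gt_0.
assert (Hgen : forall t, 0 <= t -> forall eps, 0 < eps -> exists d, 0 < d /\
  forall s, 0 <= s -> Rabs (s - t) < d -> norm (S (ray s) x - S (ray t) x)%V < eps).
{ clear t; intros t Ht eps Heps; destruct Ht as [Ht|<-].
  - assert (Hr0 : ray t <> RtoC 0).
    { unfold ray; intros E; apply (f_equal Cmod) in E; rewrite Cmod_mult, Cmod_R, Cmod_0, Rabs_right in E by lra; nra. }
    destruct (holo_dom (ray t) (cone_ray t (Rlt_le _ _ Ht)) Hr0) as (_ & _ & [K HK] & Hd).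
    destruct (Hd 1 Rlt_0_1) as (d & Hd0 & H).
    assert (Hx := norm_ge_0 x).
    set (b := (1 + Rabs K) * norm x * Cmod h + 1).
    assert (Hb : 0 < b).
    { assert (0 <= (1 + Rabs K) * norm x * Cmod h); [|unfold b; lra].
      generalize (Rabs_pos K); intros; repeat apply Rmult_le_pos; lra. }
    exists (Rmin (d / Cmod h) (eps / b)); split.
    { apply Rmin_glb_lt; apply Rdiv_lt_0_compat; lra. }
    intros s Hs Hst; apply Rmin_Rgt_l in Hst; destruct Hst as [H1 H2].
    assert (Hm : Cmod (RtoC (s - t) * h) = Rabs (s - t) * Cmod h) by (rewrite Cmod_mult, Cmod_R; ring).
    specialize (H (RtoC (s - t) * h)%C x).
    replace (ray t + RtoC (s - t) * h)%C with (ray s) in H by (unfold ray; rewrite RtoC_minus; ring).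
    rewrite Hm in H.
    assert (H3 : Rabs (s - t) * Cmod h < d).
    { apply (Rmult_lt_compat_r (Cmod h)) in H1; [|exact Hhm].
      unfold Rdiv in H1; rewrite Rmult_assoc, Rinv_l in H1 by lra; lra. }
    specialize (H H3).
    set (L := A (S (ray t) x)) in *.
    replace (S (ray s) x - S (ray t) x)%V with
      ((S (ray s) x - S (ray t) x - (RtoC (s - t) * h) *: L) + (RtoC (s - t) * h) *: L)%V by vec.
    assert (H4 : norm ((RtoC (s - t) * h) *: L)%V <= Rabs (s - t) * Cmod h * (Rabs K * norm x)).
    { apply norm_scal_le; [rewrite Hm; lra|].
      eapply Rle_trans; [apply HK|]; apply Rmult_le_compat_r; [exact Hx | apply Rle_abs]. }
    eapply Rle_lt_trans; [exact (norm_plus_le _ _ _ _ H H4)|].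
    apply Rle_lt_trans with (Rabs (s - t) * b).
    + assert (0 <= Rabs (s - t)) by apply Rabs_pos; unfold b; nra.
    + apply (Rmult_lt_compat_r b) in H2; [|exact Hb].
      unfold Rdiv in H2; rewrite Rmult_assoc, Rinv_l in H2 by lra; lra.
  - destruct (holo_cont _ _ _ HS x eps Heps) as (d & Hd & H).
    exists (d / Cmod h); split; [now apply Rdiv_lt_0_compat|].
    intros s Hs Hsd; rewrite Rminus_0_r, Rabs_right in Hsd by lra.
    replace (S (ray 0) x) with x.
    2: { unfold ray; replace (0 * h)%C with (RtoC 0) by ring; symmetry; apply (holo_0 _ _ _ HS). }
    apply H; [now apply cone_ray|].
    unfold ray; rewrite Cmod_mult, Cmod_R, Rabs_right by lra.
    apply (Rmult_lt_compat_r (Cmod h)) in Hsd; [|exact Hhm].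
    unfold Rdiv in Hsd; rewrite Rmult_assoc, Rinv_l in Hsd by lra; lra. }
intros eps Heps; destruct (Hgen (Rmax 0 t) (Rmax_l _ _) eps Heps) as (d & Hd & H).
exists d; split; [exact Hd|]; intros s Hs; apply H; [apply Rmax_l|].
eapply Rle_lt_trans; [|exact Hs].
unfold Rmax; destruct (Rle_dec 0 s), (Rle_dec 0 t); unfold Rabs;
  repeat destruct Rcase_abs; lra.
Qed.

Lemma shifted_deriv (e t : R) x : 0 < e -> 0 <= t ->
  has_deriv (fun s => S (ray s + RtoC e)%C x) t (h *: A (S (ray t + RtoC e)%C x))%V.
Proof.
intros He Ht eps Heps.
assert (Hhm : 0 < Cmod h) by now apply Cmod_gt_0.
assert (Hce : cone kappa e) by (apply cone_real; lra).
assert (He0 : RtoC e <> RtoC 0) by (apply RtoC_ne; lra).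
assert (Hz : cone kappa (ray t + e)) by (apply cone_plus; [now apply cone_ray | exact Hce]).
assert (Hz0 : (ray t + e)%C <> RtoC 0).
{ rewrite Cplus_comm; apply (cone_plus_ne kappa); trivial; now apply cone_ray. }
destruct (holo_dom _ Hz Hz0) as (_ & _ & _ & Hd).
assert (Hx := norm_ge_0 x).
destruct (Hd (eps / (Cmod h * (norm x + 1)))) as (d & Hd0 & H); [apply Rdiv_lt_0_compat; nra|].
exists (d / Cmod h); split; [now apply Rdiv_lt_0_compat|]; intros s Hs.
assert (Hm : Cmod (RtoC s * h) = Rabs s * Cmod h) by (rewrite Cmod_mult, Cmod_R; ring).
specialize (H (RtoC s * h)%C x); rewrite Hm in H.
assert (H3 : Rabs s * Cmod h < d).
{ apply (Rmult_lt_compat_r (Cmod h)) in Hs; [|exact Hhm].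
  unfold Rdiv in Hs; rewrite Rmult_assoc, Rinv_l in Hs by lra; lra. }
specialize (H H3).
replace (ray t + e + RtoC s * h)%C with (ray (t + s) + e)%C in H by (unfold ray; rewrite RtoC_plus; ring).
replace (S (ray (t + s) + e)%C x - S (ray t + e)%C x - RtoC s *: (h *: A (S (ray t + e)%C x)))%V with
 (S (ray (t + s) + e)%C x - S (ray t + e)%C x - (RtoC s * h) *: A (S (ray t + e)%C x))%V by vec.
eapply Rle_trans; [exact H|].
replace (eps / (Cmod h * (norm x + 1)) * (Rabs s * Cmod h) * norm x) with
  (eps * Rabs s * (norm x / (norm x + 1))) by (field; lra).
assert (norm x / (norm x + 1) <= 1).
{ apply (Rmult_le_reg_r (norm x + 1)); [lra|]; unfold Rdiv; rewrite Rmult_assoc, Rinv_l; lra. }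
assert (0 <= eps * Rabs s) by (apply Rmult_le_pos; [lra | apply Rabs_pos]); nra.
Qed.

Lemma damped_ftc (e a : R) x : 0 < e -> 0 <= a ->
  vint (fun t => cexp (- lam * t) *: (- lam *: S e (orbit x t) + h *: A (S e (orbit x t))))%V 0 a =
  (cexp (- lam * a) *: S e (S (ray a) x) - S e x)%V.
Proof.
intros He Ha.
assert (Hce : cone kappa e) by (apply cone_real; lra).
assert (He0 : RtoC e <> RtoC 0) by (apply RtoC_ne; lra).
destruct (holo_dom e Hce He0) as (_ & HAl & [KA HAb] & _).
destruct (holo_bnd _ _ _ HS e Hce) as [KS HSb].
assert (HSl := holo_lin _ _ _ HS e Hce).
assert (Hadd : forall t, 0 <= t -> S (ray t + e)%C x = S e (S (ray t) x)).
{ intros t Ht; rewrite Cplus_comm; apply (holo_add _ _ _ HS); [exact Hce | now apply cone_ray]. }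
assert (Horb : forall t, 0 <= t -> orbit x t = S (ray t) x).
{ intros t Ht; unfold orbit; now rewrite Rmax_right. }
rewrite (vint_ftc (fun t => cexp (- lam * t) *: S (ray t + e)%C x)%V).
- rewrite !Hadd by lra; f_equal.
  replace (- lam * 0)%C with (RtoC 0) by ring; rewrite cexp_0.
  unfold ray; replace (0 * h)%C with (RtoC 0) by ring; rewrite (holo_0 _ _ _ HS); vec.
- exact Ha.
- intros t [Ht _]; rewrite Horb, <- Hadd by exact Ht.
  apply (cexp_deriv (- lam) (fun s => S (ray s + e)%C x) t).
  now apply shifted_deriv.
- intros t [Ht _].
  apply (cexp_cont (- lam) (fun t => - lam *: S e (orbit x t) + h *: A (S e (orbit x t)))%V t).
  apply (cont_plus (fun t => - lam *: S e (orbit x t))%V (fun t => h *: A (S e (orbit x t)))%V t).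
  + apply (cont_lin (fun y => - lam *: S e y)%V (Cmod (- lam) * KS) (orbit x) t).
    * now apply lin_scal_comp.
    * now apply bnd_scal_comp.
    * apply orbit_cont.
  + apply (cont_lin (fun y => h *: A (S e y))%V (Cmod h * KA) (orbit x) t).
    * exact (lin_scal_comp h _ HAl).
    * exact (bnd_scal_comp h _ _ HAb).
    * apply orbit_cont.
Qed.

Lemma laplace (a : R) x : 0 <= a -> exists p, dom A p /\
  (lam *: p - h *: A p)%V = (x - cexp (- lam * a) *: S (ray a) x)%V /\
  norm p <= a * (M * norm x).
Proof.
intros Ha; set (f := fun t : R => (cexp (- lam * t) *: orbit x t)%V).
assert (Hf : forall t, cont f t) by (intros; apply cexp_cont, orbit_cont).
set (p := vint f 0 a); exists p.
set (w0 := (/ h *: (lam *: p + (cexp (- lam * a) *: S (ray a) x - x)))%V).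
assert (Hp : dom A p /\ A p = w0).
{ pose (F := within (fun e : R => 0 < e) (locally (0 : R))).
  assert (Hce : forall e, 0 < e -> cone kappa e) by (intros; apply cone_real; lra).
  assert (He0 : forall e, 0 < e -> RtoC e <> RtoC 0)
    by (intros; apply RtoC_ne; lra).
  assert (HE : forall e, 0 < e -> A (S e p) = S e w0).
  { intros e He.
    destruct (holo_dom e (Hce e He) (He0 e He)) as (_ & HAl & [KA HAb] & _).
    destruct (holo_bnd _ _ _ HS e (Hce e He)) as [KS HSb].
    assert (HSl := holo_lin _ _ _ HS e (Hce e He)).
    assert (HI := damped_ftc e a x He Ha).
    rewrite (vint_ext _ (fun t => - lam *: S e (f t) + h *: A (S e (f t)))%V) in HI; [|exact Ha|].
    2: { intros t _; unfold f; rewrite (lin_scal _ _ _ HAl), (lin_scal _ _ _ HSl); vec. }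
    assert (L1 := lin_scal_comp (- lam)%C _ HSl); assert (L2 := lin_scal_comp h _ HAl).
    assert (B1 := bnd_scal_comp (- lam)%C _ _ HSb); assert (B2 := bnd_scal_comp h _ _ HAb).
    rewrite vint_plus in HI.
    - rewrite (vint_lin (fun y => - lam *: S e y)%V _ f 0 a L1 B1 Hf) in HI.
      rewrite (vint_lin (fun y => h *: A (S e y))%V _ f 0 a L2 B2 Hf) in HI.
      fold p in HI; unfold w0.
      rewrite (lin_scal _ _ _ HSl), (lin_plus _ _ _ HSl), (lin_scal _ _ _ HSl), (lin_minus _ _ _ HSl).
      rewrite (lin_scal _ _ _ HSl), <- HI; vecf; exact Hh0.
    - intros t; now apply (cont_lin _ _ f t L1 B1).
    - intros t; now apply (cont_lin _ _ f t L2 B2). }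
  assert (Hu : forall i : nat, 0 < 1 / 2 ^ i) by (intros; apply Rdiv_lt_0_compat; [lra | apply pow_2_pos]).
  assert (Hc : forall v : X, tends eventually (fun i => S (RtoC (1 / 2 ^ i)) v) v).
  { intros v eps Heps; destruct (holo_cont _ _ _ HS v eps Heps) as (d & Hd & H).
    destruct (geom_small 1 d Hd) as [N HN]; exists N; intros n Hn; apply H; [apply Hce, Hu|].
    rewrite Cmod_R, Rabs_right by (apply Rle_ge; left; apply Hu); now apply HN. }
  apply (semi_closed A _ holo_semi eventually (fun i => S (RtoC (1 / 2 ^ i)) p)).
  - intros i; apply (holo_dom _ (Hce _ (Hu i)) (He0 _ (Hu i))).
  - apply Hc.
  - apply (tends_ext eventually (fun i => S (RtoC (1 / 2 ^ i)) w0)); [|apply Hc].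
    intros i; symmetry; apply HE, Hu. }
destruct Hp as [Hp1 Hp2]; split; [exact Hp1 | split].
- rewrite Hp2; unfold w0; vecf; exact Hh0.
- replace a with (a - 0) by ring; apply vint_norm; [exact Ha | exact Hf|].
  intros t Ht; unfold f, orbit; rewrite Rmax_right by apply Ht.
  eapply Rle_trans; [apply damped_bnd, Ht|].
  apply Rmult_le_compat_r; [apply norm_ge_0|].
  rewrite <- (Rmult_1_r M) at 2; apply Rmult_le_compat_l; [lra|].
  rewrite <- exp_0; assert (Hrt : - rho * t <= 0) by nra.
  now apply exp_le_mono.
Qed.

(** If [lam d = h A d], then [exp (- lam t) S (t h) d] does not depend on [t]
    although it decays, which forces [d = 0]. *)
Lemma damped_zero (a : R) d : 0 <= a -> dom A d -> (lam *: d = h *: A d)%V ->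
  forall e, 0 < e -> S e d = (cexp (- lam * a) *: S (ray a) (S e d))%V.
Proof.
intros Ha Hd Hld e He.
assert (Hce : cone kappa e) by (apply cone_real; lra).
assert (HI := damped_ftc e a d He Ha).
rewrite (vint_ext _ (fun _ => 0%V)) in HI; [|exact Ha|].
- assert (H0 : vint (fun _ : R => 0%V : X) 0 a = 0%V).
  { unfold vint; etransitivity; [apply (RInt_const (V := realify X))|].
    exact (scal_zero_r (V := realify X) (a - 0)). }
  rewrite H0 in HI.
  rewrite <- (holo_add _ _ _ HS _ e), Cplus_comm, (holo_add _ _ _ HS) by (trivial; now apply cone_ray).
  transitivity (S e d + 0)%V; [vec | rewrite HI; vec].
- intros t [Ht _]; unfold orbit; rewrite Rmax_right by lra; fold (ray t).
  assert (Hz : cone kappa (ray t)) by (apply cone_ray; lra).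
  assert (Hcomm : forall z, cone kappa z -> A (S z d) = S z (A d)).
  { intros z Hzc; destruct (holo_bnd _ _ _ HS z Hzc) as [K HK].
    apply (semi_commuting A _ holo_semi (S z) K); [now apply (holo_lin _ _ _ HS) | exact HK | | exact Hd].
    intros s Hs; assert (cone kappa s) by (apply cone_real; lra).
    now rewrite <- !(holo_add _ _ _ HS), Cplus_comm. }
  assert (Hez : cone kappa (e + ray t)) by now apply cone_plus.
  assert (Hl := holo_lin _ _ _ HS _ Hez).
  rewrite <- (holo_add _ _ _ HS), Hcomm by assumption.
  transitivity (cexp (- lam * t) *: S (e + ray t)%C (h *: A d - lam *: d))%V.
  + rewrite (lin_minus _ _ _ Hl), !(lin_scal _ _ _ Hl); vec.
  + replace (h *: A d - lam *: d)%V with (0%V : X) by (rewrite Hld; vec).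
    rewrite (lin_zero _ Hl); vec.
Qed.

Definition laplace_const := 2 * (M * ln (2 * M)).

Lemma laplace_resolvent :
  (forall y, exists u, dom A u /\ (lam *: u - h *: A u)%V = y) /\
  (forall u, dom A u -> rho * norm u <= laplace_const * norm (lam *: u - h *: A u)%V).
Proof.
assert (Hln : 0 < ln (2 * M)) by (rewrite <- ln_1; apply ln_increasing; lra).
set (a := ln (2 * M) / rho); assert (Ha : 0 <= a) by (left; now apply Rdiv_lt_0_compat).
pose (V := fun y => (cexp (- lam * a) *: S (ray a) y)%V).
assert (Hra : cone kappa (ray a)) by now apply cone_ray.
assert (HVl : lin V).
{ exact (lin_scal_comp _ _ (holo_lin _ _ _ HS _ Hra)). }
assert (HVb : bnd V (/ 2)).
{ intros y; eapply Rle_trans; [now apply damped_bnd|].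
  apply Rmult_le_compat_r; [apply norm_ge_0|].
  replace (- rho * a) with (- ln (2 * M)) by (unfold a; field; lra).
  rewrite exp_Ropp, exp_ln by lra; right; field; lra. }
assert (Hsolve : forall y, exists u, dom A u /\ (lam *: u - h *: A u)%V = y /\
  rho * norm u <= laplace_const * norm y).
{ intros y; destruct (near_identity_surjective V (/ 2) HVl HVb (Rle_refl _) y) as [x Hx].
  destruct (laplace a x Ha) as (p & Hp1 & Hp2 & Hp3).
  exists p; split; [exact Hp1|]; split; [rewrite Hp2; exact Hx|].
  assert (Hxy : norm x <= 2 * norm y).
  { assert (H1 : norm (y + V x)%V <= norm y + / 2 * norm x) by (apply norm_plus_le; [lra | apply HVb]).
    replace (y + V x)%V with x in H1 by (rewrite <- Hx; vec); lra. }
  apply (Rmult_le_compat_l rho) in Hp3; [|lra].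
  eapply Rle_trans; [exact Hp3|].
  replace (rho * (a * (M * norm x))) with (M * ln (2 * M) * norm x) by (unfold a; field; lra).
  unfold laplace_const; assert (0 < M * ln (2 * M)) by nra; nra. }
split.
- intros y; destruct (Hsolve y) as (u & H1 & H2 & _); now exists u.
- intros u Hu; set (y := (lam *: u - h *: A u)%V).
  destruct (Hsolve y) as (p & Hp1 & Hp2 & Hp3).
  enough (E : u = p) by (rewrite E at 1; exact Hp3).
  assert (HSem := holo_semi).
  set (d := (u + RtoC (-1) *: p)%V).
  destruct (semi_gen_scal A _ (RtoC (-1)) p HSem Hp1) as [Hm1 Hm2].
  destruct (semi_gen_plus A _ u _ HSem Hu Hm1) as [Hd1 Hd2]; rewrite Hm2 in Hd2; fold d in Hd1, Hd2.
  assert (Hd3 : (lam *: d = h *: A d)%V).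
  { rewrite Hd2; unfold d.
    transitivity ((lam *: u - h *: A u) - (lam *: p - h *: A p) + h *: (A u + RtoC (-1) *: A p))%V; [vec|].
    rewrite Hp2; unfold y; vec. }
  assert (Hd0 : d = 0%V).
  { apply (tends_unique (at_right 0) (fun e => S (RtoC e) d)); [apply (semi_cont _ _ HSem)|].
    intros eps Heps; apply at_right_0; exists 1; split; [lra|]; intros e He.
    assert (H1 := damped_zero a d Ha Hd1 Hd3 e (proj1 He)).
    assert (H2 := HVb (S (RtoC e) d)); unfold V in H2; rewrite <- H1 in H2.
    replace (S (RtoC e) d - 0)%V with (S (RtoC e) d) by vec.
    generalize (norm_ge_0 (S (RtoC e) d)); lra. }
  replace u with (d + p)%V by (unfold d; vec); rewrite Hd0; vec.
Qed.

End Laplace.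
End OneFamily.
End Holomorphic.

(** * Relatively bounded perturbations *)

Section Perturbation.
Context {X : CompleteNormedModule C_AbsRing}.
Implicit Types x y u : X.

(** Multiplication by [1 + i kappa] or [1 - i kappa] moves [mu] away from the
    imaginary axis and keeps [h] in the larger cone. *)
Lemma rotation kappa kappa0 h mu : 0 < kappa <= / 2 -> 4 * kappa <= kappa0 ->
  cone kappa h -> h <> RtoC 0 -> 0 < Re mu ->
  exists rot : C, rot <> RtoC 0 /\ Cmod rot <= 2 /\ cone kappa0 (h * rot) /\ (h * rot)%C <> RtoC 0 /\
    kappa / 2 * (Cmod mu + Cmod h) <= Re (mu * rot) + Re (h * rot).
Proof.
intros Hk Hk0 Hh Hh0 Hmu.
assert (Hre := cone_Re_pos kappa h (proj1 Hk) Hh Hh0).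
assert (Hs : exists s, (s = 1 \/ s = -1) /\ s * Im mu = Rabs (Im mu)).
{ destruct (Rle_dec 0 (Im mu)) as [H|H].
  - exists 1; split; [now left|]; rewrite Rabs_right; lra.
  - exists (-1); split; [now right|]; rewrite Rabs_left; lra. }
destruct Hs as (s & Hs & Hsm).
exists (1, - (s * kappa)).
assert (H1 := Cmod_le_sum mu); assert (H2 := Cmod_le_sum h).
unfold cone in *.
assert (Hre1 : 3 / 4 * Re h <= Re h + s * kappa * Im h).
{ assert (Rabs (s * kappa * Im h) <= / 4 * Re h).
  { rewrite !Rabs_mult, (Rabs_right kappa) by lra.
    replace (Rabs s) with 1 by (destruct Hs as [-> | ->]; unfold Rabs; destruct Rcase_abs; lra).
    rewrite Rmult_1_l; apply Rle_trans with (kappa * (kappa * Re h)); [apply Rmult_le_compat_l; lra|].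
    assert (kappa * kappa <= / 4) by nra; nra. }
  generalize (Rle_abs (- (s * kappa * Im h))); rewrite Rabs_Ropp; lra. }
assert (E1 : Re (h * (1, - (s * kappa))) = Re h + s * kappa * Im h) by (destruct h; simpl; ring).
assert (E2 : Im (h * (1, - (s * kappa))) = Im h - s * kappa * Re h) by (destruct h; simpl; ring).
assert (E3 : Re (mu * (1, - (s * kappa))) = Re mu + kappa * Rabs (Im mu)).
{ rewrite <- Hsm; destruct mu; simpl; ring. }
split; [|split; [|split; [|split]]].
- intros E; apply (f_equal Re) in E; simpl in E; lra.
- eapply Rle_trans; [apply Cmod_le_sum|]; simpl.
  rewrite Rabs_R1, Rabs_Ropp, Rabs_mult, (Rabs_right kappa) by lra.
  replace (Rabs s) with 1 by (destruct Hs as [-> | ->]; unfold Rabs; destruct Rcase_abs; lra); lra.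
- rewrite E1, E2; apply Rle_trans with (2 * kappa * Re h); [|nra].
  eapply Rle_trans; [apply Rabs_triang|]; rewrite Rabs_Ropp, !Rabs_mult.
  rewrite (Rabs_right kappa), (Rabs_right (Re h)) by lra.
  replace (Rabs s) with 1 by (destruct Hs as [-> | ->]; unfold Rabs; destruct Rcase_abs; lra); lra.
- intros E; rewrite E in E1; simpl in E1; lra.
- rewrite E1, E3; rewrite (Rabs_right (Re mu)) in H1 by lra.
  rewrite (Rabs_right (Re h)) in H2 by lra.
  assert (Hi := Rabs_pos (Im mu)).
  assert (B1 : kappa / 2 * Cmod mu <= Re mu + kappa * Rabs (Im mu)).
  { apply Rle_trans with (kappa / 2 * (Re mu + Rabs (Im mu))); [apply Rmult_le_compat_l; lra|]; nra. }
  assert (B2 : kappa / 2 * Cmod h <= 3 / 4 * Re h).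
  { apply Rle_trans with (/ 4 * (Re h + kappa * Re h)); [|nra].
    apply Rmult_le_compat; [lra | apply Cmod_ge_0 | lra | lra]. }
  lra.
Qed.

Definition shifted (A D : poperator X) (c : R) : poperator X :=
  POperator (dom A) (fun x => A x + D x + RtoC (- c) *: x)%V.

Definition zero_op : poperator X := POperator (fun _ => True) (fun _ => 0%V).

Record resolvent_data (A : poperator X) (kappa c K : R) : Prop := {
  rd_kappa : 0 < kappa;
  rd_c : 0 <= c;
  rd_K : 1 <= K;
  rd_dense : forall x eps, 0 < eps -> exists y, dom A y /\ norm (x - y)%V <= eps;
  rd_dom0 : dom A 0%V;
  rd_plus : forall x y, dom A x -> dom A y -> dom A (x + y)%V /\ A (x + y)%V = (A x + A y)%V;
  rd_scal : forall b x, dom A x -> dom A (b *: x)%V /\ A (b *: x)%V = (b *: A x)%V;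
  rd_bound : forall h mu u, cone kappa h -> h <> RtoC 0 -> 0 < Re mu -> dom A u ->
    (Cmod mu + Cmod h) * norm u <= K * norm (mu *: u - h *: (A u + RtoC (- c) *: u))%V;
  rd_surj : forall h mu y, cone kappa h -> h <> RtoC 0 -> 0 < Re mu ->
    exists u, dom A u /\ (mu *: u - h *: (A u + RtoC (- c) *: u))%V = y
}.

Lemma holo_resolvent_data kappa0 (A : poperator X) S : holo kappa0 A S ->
  exists kappa c K, resolvent_data A kappa c K.
Proof.
intros HS; assert (Hk0 := holo_kappa _ _ _ HS).
assert (HSem := holo_semi kappa0 A S HS).
destruct (holo_growth kappa0 A S HS) as (M & w & HM & Hw & HB).
set (kappa := Rmin (/ 2) (kappa0 / 4)).
assert (Hk : 0 < kappa <= / 2) by (split; [apply Rmin_glb_lt; lra | apply Rmin_l]).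
assert (Hk4 : 4 * kappa <= kappa0) by (generalize (Rmin_r (/ 2) (kappa0 / 4)); fold kappa; lra).
set (K0 := laplace_const M).
assert (HK0 : 0 < K0).
{ unfold K0, laplace_const; assert (0 < ln (2 * M)) by (rewrite <- ln_1; apply ln_increasing; lra); nra. }
assert (Hdom : forall x eps, 0 < eps -> exists y, dom A y /\ norm (x - y)%V <= eps).
{ intros x eps Heps; destruct (holo_cont _ _ _ HS x eps Heps) as (d & Hd & H).
  assert (Hc : cone kappa0 (d / 2)%R) by (apply cone_real; lra).
  exists (S (d / 2)%R x); split.
  - apply (holo_dom kappa0 A S HS); [exact Hc | apply RtoC_ne; lra].
  - rewrite norm_minus_sym; left; apply H; [exact Hc | rewrite Cmod_R, Rabs_right; lra]. }
assert (Hmain : forall h mu, cone kappa h -> h <> RtoC 0 -> 0 < Re mu ->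
  (forall u, dom A u -> (Cmod mu + Cmod h) * norm u <=
     (4 * K0 / kappa + 1) * norm (mu *: u - h *: (A u + RtoC (- (w + 1)) *: u))%V) /\
  (forall y, exists u, dom A u /\ (mu *: u - h *: (A u + RtoC (- (w + 1)) *: u))%V = y)).
{ intros h mu Hh Hh0 Hmu.
  destruct (rotation kappa kappa0 h mu Hk Hk4 Hh Hh0 Hmu) as (rot & Hr0 & Hr2 & Hhr & Hhr0 & Hre).
  set (lam := ((mu + (w + 1)%R * h) * rot)%C).
  assert (Hrho : Re lam - w * Re (h * rot) = Re (mu * rot) + Re (h * rot)).
  { unfold lam; destruct mu, h, rot; simpl; ring. }
  assert (Hmu0 : 0 <= Cmod mu) by apply Cmod_ge_0.
  assert (Hhm : 0 < Cmod h) by now apply Cmod_gt_0.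
  assert (Hpos : 0 < Re lam - w * Re (h * rot)) by (rewrite Hrho; nra).
  assert (Heq : forall u, (lam *: u - (h * rot) *: A u = rot *: (mu *: u - h *: (A u + RtoC (- (w + 1)) *: u)))%V).
  { intros u; unfold lam; rewrite RtoC_opp; vec. }
  destruct (laplace_resolvent kappa0 A S HS M w (h * rot) lam HM HB Hhr Hhr0 Hpos) as [L1 L2].
  split.
  - intros u Hu; specialize (L2 u Hu); rewrite Heq, norm_scalC, Hrho in L2; fold K0 in L2.
    set (N := norm (mu *: u - h *: (A u + RtoC (- (w + 1)) *: u))%V) in *.
    assert (HN : 0 <= N) by apply norm_ge_0; assert (Hu0 := norm_ge_0 u).
    assert (H1 : kappa / 2 * (Cmod mu + Cmod h) * norm u <= K0 * (2 * N)).
    { apply Rle_trans with ((Re (mu * rot) + Re (h * rot)) * norm u); [now apply Rmult_le_compat_r|].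
      eapply Rle_trans; [exact L2|]; apply Rmult_le_compat_l; [lra|]; now apply Rmult_le_compat_r. }
    apply Rle_trans with (4 * K0 / kappa * N); [|nra].
    apply (Rmult_le_reg_l (kappa / 2)); [lra|].
    replace (kappa / 2 * (4 * K0 / kappa * N)) with (K0 * (2 * N)) by (field; lra); lra.
  - intros y; destruct (L1 (rot *: y)%V) as (u & Hu1 & Hu2); exists u; split; [exact Hu1|].
    rewrite Heq in Hu2.
    transitivity (/ rot *: (rot *: (mu *: u - h *: (A u + RtoC (- (w + 1)) *: u))))%V; [vecf; exact Hr0|].
    rewrite Hu2; vecf; exact Hr0. }
exists kappa, (w + 1), (4 * K0 / kappa + 1); split.
- apply Hk.
- lra.
- assert (0 < 4 * K0 / kappa) by (apply Rdiv_lt_0_compat; lra); lra.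
- exact Hdom.
- destruct (Hdom 0%V 1 Rlt_0_1) as (y & Hy & _).
  replace (0%V : X) with (RtoC 0 *: y)%V by vec; now apply (semi_gen_scal A _ _ _ HSem).
- intros x y; now apply (semi_gen_plus A _ _ _ HSem).
- intros b x; now apply (semi_gen_scal A _ _ _ HSem).
- intros h mu u H1 H2 H3; apply (Hmain h mu H1 H2 H3).
- intros h mu y H1 H2 H3; apply (Hmain h mu H1 H2 H3).
Qed.

Section Perturbed.
Variables (A D : poperator X) (kappa c K alpha beta : R).
Hypothesis HA : resolvent_data A kappa c K.
Hypothesis Hplus : forall x y, dom A x -> dom A y -> D (x + y)%V = (D x + D y)%V.
Hypothesis Hscal : forall b x, dom A x -> D (b *: x)%V = (b *: D x)%V.
Hypothesis Halpha : 0 <= alpha.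
Hypothesis Hbeta : 0 <= beta.
Hypothesis HD : forall x, dom A x -> norm (D x) <= alpha * norm (A x) + beta * norm x.

Definition eta := alpha * (K + 1) + (beta + alpha * c) * K.
Hypothesis Heta : eta <= / 2.

Let base h mu u : X := (mu *: u - h *: (A u + RtoC (- c) *: u))%V.
Let full h mu u : X := (mu *: u - h *: shifted A D c u)%V.

Lemma base_full h mu u : base h mu u = (full h mu u + h *: D u)%V.
Proof. unfold base, full, shifted; simpl; vec. Qed.

Lemma eta_ge_0 : 0 <= eta.
Proof.
assert (HK := rd_K _ _ _ _ HA); assert (Hc := rd_c _ _ _ _ HA).
unfold eta; assert (0 <= alpha * c) by nra; nra.
Qed.

Lemma pert_bound h mu u : cone kappa h -> h <> RtoC 0 -> 0 < Re mu -> dom A u ->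
  norm (h *: D u)%V <= eta * norm (base h mu u).
Proof.
intros H1 H2 H3 Hu; assert (HB := rd_bound _ _ _ _ HA h mu u H1 H2 H3 Hu).
assert (HK := rd_K _ _ _ _ HA); assert (Hc := rd_c _ _ _ _ HA).
change ((Cmod mu + Cmod h) * norm u <= K * norm (base h mu u)) in HB.
set (N := norm (base h mu u)) in *.
assert (HN : 0 <= N) by apply norm_ge_0; assert (Hu0 := norm_ge_0 u).
assert (Hm := Cmod_ge_0 mu); assert (Hhm := Cmod_ge_0 h).
assert (HAu : Cmod h * norm (A u) <= (K + 1) * N + c * (Cmod h * norm u)).
{ rewrite <- norm_scalC.
  replace (h *: A u)%V with ((mu *: u - base h mu u) + RtoC c *: (h *: u))%V
    by (unfold base; rewrite RtoC_opp; vec).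
  apply norm_plus_le.
  - replace ((K + 1) * N) with (K * N + N) by ring; apply norm_minus_le; [|apply Rle_refl].
    rewrite norm_scalC; nra.
  - rewrite !norm_scalC, Cmod_R, Rabs_right by lra; lra. }
rewrite norm_scalC; apply Rle_trans with (Cmod h * (alpha * norm (A u) + beta * norm u)).
- apply Rmult_le_compat_l; [exact Hhm | now apply HD].
- assert (Hhu : Cmod h * norm u <= K * N) by nra.
  assert (B1 : alpha * (Cmod h * norm (A u)) <= alpha * ((K + 1) * N + c * (Cmod h * norm u)))
    by (now apply Rmult_le_compat_l).
  assert (B2 : (beta + alpha * c) * (Cmod h * norm u) <= (beta + alpha * c) * (K * N)).
  { apply Rmult_le_compat_l; [nra | exact Hhu]. }
  unfold eta; nra.
Qed.

Lemma base_le_full h mu u : cone kappa h -> h <> RtoC 0 -> 0 < Re mu -> dom A u ->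
  norm (base h mu u) <= 2 * norm (full h mu u).
Proof.
intros H1 H2 H3 Hu; assert (HP := pert_bound h mu u H1 H2 H3 Hu).
assert (HN := norm_ge_0 (base h mu u)).
assert (HT : norm (base h mu u) <= norm (full h mu u) + eta * norm (base h mu u)).
{ rewrite base_full at 1; apply norm_plus_le; [apply Rle_refl | exact HP]. }
nra.
Qed.

Lemma shifted_sectorial : sectorial kappa (2 * K) (shifted A D c).
Proof.
assert (HK := rd_K _ _ _ _ HA); split.
- apply (rd_kappa _ _ _ _ HA).
- lra.
- apply (rd_dom0 _ _ _ _ HA).
- intros x y Hx Hy; simpl in *; destruct (rd_plus _ _ _ _ HA x y Hx Hy) as [H1 H2].
  split; [exact H1|]; rewrite H2, Hplus by assumption; vec.
- intros b x Hx; simpl in *; destruct (rd_scal _ _ _ _ HA b x Hx) as [H1 H2].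
  split; [exact H1|]; rewrite H2, Hscal by assumption; vec.
- apply (rd_dense _ _ _ _ HA).
- intros h mu u H1 H2 H3 Hu; simpl in Hu.
  assert (HB := rd_bound _ _ _ _ HA h mu u H1 H2 H3 Hu).
  assert (HF := base_le_full h mu u H1 H2 H3 Hu).
  change ((Cmod mu + Cmod h) * norm u <= K * norm (base h mu u)) in HB.
  change (Cmod mu * norm u <= 2 * K * norm (full h mu u)).
  assert (0 <= Cmod h * norm u) by (apply Rmult_le_pos; [apply Cmod_ge_0 | apply norm_ge_0]); nra.
- intros h mu y H1 H2 H3; simpl.
  destruct (choice (fun y u => dom A u /\ base h mu u = y)) as [r Hr].
  { intros v; exact (rd_surj _ _ _ _ HA h mu v H1 H2 H3). }
  assert (Hmu : 0 < Cmod mu).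
  { apply Rlt_le_trans with (Re mu); [exact H3|]; eapply Rle_trans; [apply Rle_abs | apply re_le_Cmod]. }
  assert (Huniq : forall u v, dom A u -> dom A v -> base h mu u = base h mu v -> u = v).
  { intros u v Hu Hv E.
    destruct (rd_scal _ _ _ _ HA (RtoC (-1)) v Hv) as [S1 S2].
    destruct (rd_plus _ _ _ _ HA u _ Hu S1) as [S3 S4].
    assert (HB := rd_bound _ _ _ _ HA h mu _ H1 H2 H3 S3).
    replace (mu *: (u + RtoC (-1) *: v) - h *: (A (u + RtoC (-1) *: v) + RtoC (- c) *: (u + RtoC (-1) *: v)))%V
      with (base h mu u - base h mu v)%V in HB by (rewrite S4, S2; unfold base; vec).
    rewrite E, norm_minus_diag, Rmult_0_r in HB.
    apply eq_of_norm; replace (u - v)%V with (u + RtoC (-1) *: v)%V by vec.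
    assert (Hh0 := Cmod_ge_0 h); assert (Hn := norm_ge_0 (u + RtoC (-1) *: v)%V).
    nra. }
  assert (Hrl : lin r).
  { split.
    - intros u v; destruct (Hr u) as [A1 A2], (Hr v) as [B1 B2], (Hr (u + v)%V) as [C1 C2].
      destruct (rd_plus _ _ _ _ HA _ _ A1 B1) as [S1 S2].
      apply Huniq; [exact C1 | exact S1|]; rewrite C2.
      transitivity (base h mu (r u) + base h mu (r v))%V; [now rewrite A2, B2|].
      unfold base; rewrite S2; vec.
    - intros b u; destruct (Hr u) as [A1 A2], (Hr (b *: u)%V) as [C1 C2].
      destruct (rd_scal _ _ _ _ HA b _ A1) as [S1 S2].
      apply Huniq; [exact C1 | exact S1|]; rewrite C2.
      transitivity (b *: base h mu (r u))%V; [now rewrite A2|].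
      unfold base; rewrite S2; vec. }
  destruct (near_identity_surjective (fun v => h *: D (r v))%V eta) with (y := y) as [v Hv].
  + split; intros; rewrite ?(lin_plus _ _ _ Hrl), ?(lin_scal _ _ _ Hrl);
      [rewrite Hplus | rewrite Hscal]; try apply Hr; vec.
  + intros v; destruct (Hr v) as [A1 A2]; rewrite <- A2 at 2; now apply pert_bound.
  + exact Heta.
  + destruct (Hr v) as [A1 A2]; exists (r v); split; [exact A1|].
    transitivity (base h mu (r v) - h *: D (r v))%V; [|rewrite A2; exact Hv].
    change (full h mu (r v) = (base h mu (r v) - h *: D (r v))%V).
    rewrite base_full; vec.
Qed.

Lemma shifted_resolvent_difference (HA0 : sectorial kappa (2 * K) (shifted A zero_op c)) h mu y :
  cone kappa h -> h <> RtoC 0 -> 0 < Re mu ->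
  norm (res (shifted A D c) h mu y - res (shifted A zero_op c) h mu y)%V <=
  2 * K * eta / Cmod mu * norm y.
Proof.
intros H1 H2 H3; assert (HK := rd_K _ _ _ _ HA); assert (He := eta_ge_0).
destruct (res_spec kappa (2 * K) _ shifted_sectorial h mu H1 H2 H3 y) as [A1 A2].
destruct (res_spec kappa (2 * K) _ HA0 h mu H1 H2 H3 y) as [B1 B2].
set (u := res (shifted A D c) h mu y) in *; set (v := res (shifted A zero_op c) h mu y) in *.
simpl in A1, B1.
assert (Hmu : 0 < Cmod mu).
{ apply Rlt_le_trans with (Re mu); [exact H3|]; eapply Rle_trans; [apply Rle_abs | apply re_le_Cmod]. }
destruct (rd_scal _ _ _ _ HA (RtoC (-1)) v B1) as [S1 S2].
destruct (rd_plus _ _ _ _ HA u _ A1 S1) as [S3 S4].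
assert (HB := rd_bound _ _ _ _ HA h mu _ H1 H2 H3 S3).
assert (E : (mu *: (u + RtoC (-1) *: v) - h *: (A (u + RtoC (-1) *: v) + RtoC (- c) *: (u + RtoC (-1) *: v)))%V
   = (h *: D u)%V).
{ rewrite S4, S2.
  transitivity ((full h mu u + h *: D u) - (mu *: v - h *: shifted A zero_op c v))%V.
  - unfold full, shifted, zero_op; simpl; vec.
  - rewrite B2; unfold full; rewrite A2; vec. }
rewrite E in HB.
assert (HP := pert_bound h mu u H1 H2 H3 A1); assert (HF := base_le_full h mu u H1 H2 H3 A1).
assert (Hfy : full h mu u = y) by exact A2; rewrite Hfy in HF.
replace (u - v)%V with (u + RtoC (-1) *: v)%V by vec.
set (n := norm (u + RtoC (-1) *: v)%V) in *; assert (Hn : 0 <= n) by apply norm_ge_0.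
apply (Rmult_le_reg_l (Cmod mu)); [exact Hmu|].
replace (Cmod mu * (2 * K * eta / Cmod mu * norm y)) with (K * (eta * (2 * norm y))) by (field; lra).
apply Rle_trans with (K * norm (h *: D u)%V).
- generalize (Cmod_ge_0 h); intros; nra.
- apply Rmult_le_compat_l; [lra|]; eapply Rle_trans; [exact HP|].
  now apply Rmult_le_compat_l.
Qed.

End Perturbed.
End Perturbation.

(** * Stability of the sampled-data system *)

Section SampledData.
Context {X : CompleteNormedModule C_AbsRing}.
Implicit Types x y v : X.

Definition after0 (S : R -> X -> X) y (t : R) : X := S (Rmax 0 t) y.

Lemma semi_orbit_cont (A : poperator X) S y t : semi A S -> cont (after0 S y) t.
Proof.
intros HS eps Heps; set (t0 := Rmax 0 t); assert (Ht0 : 0 <= t0) by apply Rmax_l.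
destruct (semi_bnd _ _ HS (t0 + 1) ltac:(lra)) as (M & HM1 & HM).
destruct (proj1 (at_right_0 _) (semi_cont _ _ HS y (eps / M) ltac:(apply Rdiv_lt_0_compat; lra)))
  as (d & Hd & H).
assert (Hgen : forall a b, 0 <= a <= b -> b <= t0 + 1 -> b - a < d -> norm (S b y - S a y)%V < eps).
{ intros a b Ha Hb Hab; destruct (Req_dec a b) as [->|Hne]; [rewrite norm_minus_diag; lra|].
  replace b with (a + (b - a)) by ring; rewrite (semi_add _ _ HS) by lra.
  assert (Hl := semi_lin _ _ HS a (proj1 Ha)); rewrite <- (lin_minus _ _ _ Hl).
  eapply Rle_lt_trans; [apply HM; lra|].
  specialize (H (b - a) ltac:(lra)).
  apply (Rmult_lt_compat_l M) in H; [|lra].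
  replace (M * (eps / M)) with eps in H by (field; lra); exact H. }
exists (Rmin d 1); split; [apply Rmin_glb_lt; lra|]; intros s Hs.
apply Rmin_Rgt_l in Hs; destruct Hs as [Hs1 Hs2].
assert (Hst : Rabs (Rmax 0 s - t0) <= Rabs (s - t)).
{ unfold t0, Rmax; destruct (Rle_dec 0 s), (Rle_dec 0 t); unfold Rabs; repeat destruct Rcase_abs; lra. }
unfold after0; fold t0; assert (H0 := Rmax_l 0 s).
apply (Rle_lt_trans _ _ _ Hst) in Hs1; apply (Rle_lt_trans _ _ _ Hst) in Hs2.
apply Rabs_lt_between in Hs1; apply Rabs_lt_between in Hs2.
destruct (Rle_dec t0 (Rmax 0 s)) as [Hle|Hle].
- apply Hgen; lra.
- rewrite norm_minus_sym; apply Hgen; lra.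
Qed.

Section Step.
Variables (A : poperator X) (S : R -> X -> X) (B : X -> X) (b : R).
Hypothesis HS : semi A S.
Hypothesis HB : lin B.
Hypothesis HBb : bnd B b.
Hypothesis Hb : 0 <= b.

Definition step (t : R) v : X := (S t v + vint (fun s => S s (B v)) 0 t)%V.

Lemma step_after0 t v : 0 <= t -> step t v = (S t v + vint (after0 S (B v)) 0 t)%V.
Proof.
intros Ht; unfold step; f_equal; apply vint_ext; [exact Ht|]; intros s Hs.
unfold after0; now rewrite Rmax_right by lra.
Qed.

Lemma step_lin t : 0 <= t -> lin (step t).
Proof.
intros Ht; assert (Hl := semi_lin _ _ HS t Ht).
assert (Hc : forall v s, cont (after0 S v) s) by (intros; now apply (semi_orbit_cont A)).
assert (Hm : forall s, lin (S (Rmax 0 s))) by (intros; apply (semi_lin _ _ HS), Rmax_l).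
split.
- intros x y; rewrite !step_after0, (lin_plus _ _ _ Hl) by exact Ht.
  replace (vint (after0 S (B (x + y)%V)) 0 t) with
    (vint (after0 S (B x)) 0 t + vint (after0 S (B y)) 0 t)%V; [vec|].
  rewrite <- vint_plus by apply Hc; apply vint_ext; [exact Ht|]; intros s _.
  unfold after0; now rewrite (lin_plus _ _ _ HB), (lin_plus _ _ _ (Hm s)).
- intros c x; rewrite !step_after0, (lin_scal _ _ _ Hl) by exact Ht.
  replace (vint (after0 S (B (c *: x)%V)) 0 t) with (c *: vint (after0 S (B x)) 0 t)%V; [vec|].
  rewrite <- (vint_lin (fun y => c *: y)%V (Cmod c)).
  + apply vint_ext; [exact Ht|]; intros s _.
    unfold after0; now rewrite (lin_scal _ _ _ HB), (lin_scal _ _ _ (Hm s)).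
  + split; intros; vec.
  + intros y; rewrite norm_scalC; lra.
  + apply Hc.
Qed.

Lemma step_bnd tau : 0 <= tau -> exists C, 1 <= C /\ forall t, 0 <= t <= tau -> bnd (step t) C.
Proof.
intros Htau; destruct (semi_bnd _ _ HS tau Htau) as (M & HM1 & HM).
exists (M + tau * (M * b)); split.
{ assert (0 <= tau * (M * b)) by (apply Rmult_le_pos; nra); lra. }
intros t Ht v; rewrite step_after0 by lra; assert (Hv := norm_ge_0 v).
rewrite Rmult_plus_distr_r; apply norm_plus_le; [apply HM, Ht|].
eapply Rle_trans; [apply (vint_norm _ 0 t (M * (b * norm v)))|].
- lra.
- intros s; now apply (semi_orbit_cont A).
- intros s Hs; unfold after0; rewrite Rmax_right by lra.
  apply bnd_le; [apply HM; lra | lra | apply HBb].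
- replace (tau * (M * b) * norm v) with (tau * (M * (b * norm v))) by ring.
  apply Rmult_le_compat_r; [|lra]; repeat apply Rmult_le_pos; lra.
Qed.

End Step.

Lemma step_difference (A1 A2 : poperator X) S1 S2 B b e tau t v :
  semi A1 S1 -> semi A2 S2 -> bnd B b -> 0 <= b -> 0 <= e -> 0 <= t <= tau ->
  (forall s, 0 <= s <= tau -> forall x, norm (S2 s x - S1 s x)%V <= e * norm x) ->
  norm (step S2 B t v - step S1 B t v)%V <= e * (1 + tau * b) * norm v.
Proof.
intros H1 H2 HB Hb He Ht Hd; assert (Hv := norm_ge_0 v).
rewrite !(step_after0) by lra.
assert (Hc1 := fun s => semi_orbit_cont A1 S1 (B v) s H1).
assert (Hc2 := fun s => semi_orbit_cont A2 S2 (B v) s H2).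
assert (Hm : lin (fun y : X => RtoC (-1) *: y)%V) by (split; intros; vec).
assert (Hmb : bnd (fun y : X => RtoC (-1) *: y)%V 1).
{ intros y; rewrite norm_scalC, Cmod_R, Rabs_left by lra; lra. }
replace (S2 t v + vint (after0 S2 (B v)) 0 t - (S1 t v + vint (after0 S1 (B v)) 0 t))%V with
  ((S2 t v - S1 t v) + (vint (after0 S2 (B v)) 0 t + RtoC (-1) *: vint (after0 S1 (B v)) 0 t))%V by vec.
rewrite <- (vint_lin (fun y => RtoC (-1) *: y)%V 1 _ _ _ Hm Hmb Hc1), <- vint_plus.
- replace (e * (1 + tau * b) * norm v) with (e * norm v + tau * (e * (b * norm v))) by ring.
  apply norm_plus_le; [now apply Hd|].
  eapply Rle_trans; [apply (vint_norm _ 0 t (e * (b * norm v)))|].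
  + lra.
  + intros s; apply (cont_plus (after0 S2 (B v)) (fun u => RtoC (-1) *: after0 S1 (B v) u)%V); [apply Hc2|].
    now apply (cont_lin (fun y => RtoC (-1) *: y)%V 1).
  + intros s Hs; unfold after0; rewrite Rmax_right by lra.
    replace (S2 s (B v) + RtoC (-1) *: S1 s (B v))%V with (S2 s (B v) - S1 s (B v))%V by vec.
    eapply Rle_trans; [apply Hd; lra|]; apply Rmult_le_compat_l; [exact He | apply HB].
  + apply Rmult_le_compat_r; [|lra]; repeat apply Rmult_le_pos; lra.
- exact Hc2.
- intros s; now apply (cont_lin (fun y => RtoC (-1) *: y)%V 1).
Qed.

(** The induction is on the bound for all [P ^ j Q ^ k], which amounts to working
    in the equivalent norm [sup_j q ^ - j |P ^ j x|]. *)
Lemma perturbed_power (P Q : X -> X) M q e : lin P -> 1 <= M -> 0 <= q -> 0 <= e ->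
  (forall k, bnd (Nat.iter k P) (M * q ^ k)) -> (forall x, norm (Q x - P x)%V <= e * norm x) ->
  forall k, bnd (Nat.iter k Q) (M * (q + M * e) ^ k).
Proof.
intros HP HM Hq He HPb HQ k x.
assert (Hp : 0 <= q + M * e) by nra.
enough (Hj : forall j, norm (Nat.iter j P (Nat.iter k Q x)) <= M * q ^ j * (q + M * e) ^ k * norm x).
{ generalize (Hj O); simpl; lra. }
induction k as [|k IH]; intros j.
- simpl; rewrite Rmult_1_r; apply HPb.
- assert (Hqj : 0 <= q ^ j) by now apply pow_le.
  set (y := Nat.iter k Q x) in *; change (Nat.iter (S k) Q x) with (Q y).
  assert (Hl := lin_iter P j HP).
  replace (Nat.iter j P (Q y)) with (Nat.iter (S j) P y + Nat.iter j P (Q y - P y))%V.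
  2: { rewrite (lin_minus _ _ _ Hl), iter_S_r; vec. }
  assert (H1 := IH (S j)); assert (H0 := IH O); simpl in H0; rewrite Rmult_1_r in H0.
  assert (H2 : norm (Nat.iter j P (Q y - P y)%V) <= M * q ^ j * (e * (M * (q + M * e) ^ k * norm x))).
  { apply bnd_le; [apply HPb | nra|]; eapply Rle_trans; [apply HQ|].
    now apply Rmult_le_compat_l. }
  eapply Rle_trans; [exact (norm_plus_le _ _ _ _ H1 H2)|].
  right; simpl; ring.
Qed.

Section Stability.
Context {U : CompleteNormedModule C_AbsRing}.
Variables (B0 : U -> X) (F : X -> U) (tau : R).
Hypothesis Htau : 0 < tau.
Hypothesis HB0 : is_linear B0.
Hypothesis HF : is_linear F.
Let B v : X := B0 (F v).

Lemma input_lin : lin B.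
Proof.
split; intros; unfold B.
- etransitivity; [|exact (linear_plus B0 HB0 (F x) (F y))].
  f_equal; exact (linear_plus F HF x y).
- etransitivity; [|exact (linear_scal B0 HB0 c (F x))].
  f_equal; exact (linear_scal F HF c x).
Qed.

Lemma input_bnd : exists b, 0 <= b /\ bnd B b.
Proof.
destruct (linear_norm B0 HB0) as (b1 & H1 & E1), (linear_norm F HF) as (b2 & H2 & E2).
exists (b1 * b2); split; [nra|]; intros v; rewrite Rmult_assoc.
eapply Rle_trans; [apply E1|]; apply Rmult_le_compat_l; [lra | apply E2].
Qed.

Lemma solution_step S x0 (x : R -> X) k t : is_solution S B0 F tau x0 x -> 0 < t <= tau ->
  x (INR k * tau + t) = step S B t (Nat.iter k (step S B tau) x0).
Proof.
intros [H0 H] Ht.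
assert (Hk : forall k : nat, x (INR k * tau) = Nat.iter k (step S B tau) x0).
{ clear k; induction k as [|k IH]; [simpl; rewrite Rmult_0_l; exact H0|].
  rewrite S_INR, Rmult_plus_distr_r, Rmult_1_l, H by lra; simpl; rewrite <- IH; reflexivity. }
rewrite H, <- Hk by exact Ht; reflexivity.
Qed.

Lemma solution_grid S x0 (x : R -> X) k : is_solution S B0 F tau x0 x ->
  x (INR k * tau) = Nat.iter k (step S B tau) x0.
Proof.
intros Hx; destruct k as [|k]; [simpl; rewrite Rmult_0_l; apply Hx|].
replace (INR (Datatypes.S k) * tau) with (INR k * tau + tau) by (rewrite S_INR; ring).
apply (solution_step S x0 x k tau Hx); lra.
Qed.

Lemma stability_transfer (A : poperator X) S omega : semi A S ->
  exp_stable S B0 F tau omega -> exists e, 0 < e /\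
  forall (A2 : poperator X) S2, semi A2 S2 ->
    (forall s, 0 <= s <= tau -> forall x, norm (S2 s x - S s x)%V <= e * norm x) ->
    exp_stable S2 B0 F tau omega.
Proof.
intros HS (M & w1 & HM & Hw & Hexp).
destruct input_bnd as (b & Hb & HBb); assert (HBl := input_lin).
set (w := (omega + w1) / 2); set (q := exp (- w1 * tau)); set (p := exp (- w * tau)).
assert (Hq : 0 < q) by apply exp_pos.
assert (Hqp : q < p) by (apply exp_increasing; unfold w; nra).
assert (HP : forall k, bnd (Nat.iter k (step S B tau)) (M * q ^ k)).
{ intros k x0; destruct (solution_exists S B0 F tau x0 Htau) as [x Hx].
  rewrite <- (solution_grid S x0 x k Hx).
  assert (Hk : 0 <= INR k * tau) by (apply Rmult_le_pos; [apply pos_INR | lra]).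
  eapply Rle_trans; [apply (Hexp x0 x Hx _ Hk)|]; right; f_equal; f_equal.
  unfold q; rewrite <- (Rpower_pow k) by apply exp_pos.
  unfold Rpower; rewrite ln_exp; f_equal; ring. }
set (e := (p - q) / (M * (1 + tau * b))).
assert (Htb : 0 < M * (1 + tau * b)) by (assert (0 <= tau * b) by nra; nra).
assert (He : 0 < e) by (apply Rdiv_lt_0_compat; lra).
exists e; split; [exact He|]; intros A2 S2 HS2 Hd.
assert (HQ : forall k, bnd (Nat.iter k (step S2 B tau)) (M * p ^ k)).
{ replace p with (q + M * (e * (1 + tau * b))).
  2: { unfold e; field; split; nra. }
  apply (perturbed_power (step S B tau)).
  - apply (step_lin A); [exact HS | exact HBl | lra].
  - exact HM.
  - lra.
  - assert (0 <= tau * b) by nra; nra.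
  - exact HP.
  - intros x; apply (step_difference A A2); trivial; lra. }
destruct (step_bnd A2 S2 B b HS2 HBb Hb tau ltac:(lra)) as (C & HC & HCb).
set (r := exp (Rabs w * tau)).
assert (Hr : 1 <= r).
{ unfold r; generalize (exp_ineq1_le (Rabs w * tau)) (Rabs_pos w); intros.
  assert (0 <= Rabs w * tau) by nra; lra. }
exists (C * M * r), w; split; [|split].
- assert (1 <= C * M) by nra; nra.
- unfold w; lra.
- intros x0 x Hx t Ht; assert (Hx0 := norm_ge_0 x0).
  destruct (Req_dec t 0) as [->|Hne].
  { rewrite Rmult_0_r, exp_0, (proj1 Hx).
    assert (1 <= C * M) by nra; assert (1 <= C * M * r) by nra.
    change (norm x0 <= C * M * r * 1 * norm x0); nra. }
  destruct (sampling_interval tau t Htau) as [k Hk]; [lra|].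
  set (s := t - INR k * tau) in *.
  replace t with (INR k * tau + s) at 1 by (unfold s; ring).
  rewrite (solution_step S2 x0 x k s Hx Hk).
  apply Rle_trans with (C * (M * p ^ k * norm x0)).
  { apply bnd_le; [apply HCb; lra | lra | apply HQ]. }
  assert (Hpk : p ^ k <= r * exp (- w * t)).
  { unfold p, r; rewrite <- (Rpower_pow k) by apply exp_pos.
    unfold Rpower; rewrite ln_exp, <- exp_plus.
    assert (Hle : INR k * (- w * tau) <= Rabs w * tau + - w * t).
    { replace t with (INR k * tau + s) by (unfold s; ring).
      generalize (Rle_abs w) (Rabs_pos w); intros; nra. }
    now apply exp_le_mono. }
  replace (C * M * r * exp (- w * t) * norm x0) with (C * M * norm x0 * (r * exp (- w * t))) by ring.
  replace (C * (M * p ^ k * norm x0)) with (C * M * norm x0 * p ^ k) by ring.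
  apply Rmult_le_compat_l; [repeat apply Rmult_le_pos; lra | exact Hpk].
Qed.

End Stability.
End SampledData.

Section Assembly.
Context {X : CompleteNormedModule C_AbsRing}.
Implicit Types x y : X.

Lemma generator_tends (A : poperator X) (S S' : R -> X -> X) :
  (forall t x, 0 < t -> S' t x = S t x) -> (forall x, S' 0 x = S 0 x) -> is_generator A S ->
  forall x y, (dom A x /\ A x = y) <->
    tends (at_right 0) (fun h => RtoC (/ h) *: (S' h x - x))%V y.
Proof.
intros Heq Heq0 HG x y; etransitivity; [apply HG|].
etransitivity; [|symmetry; apply (tends_filterlim (at_right 0) (fun h => RtoC (/ h) *: (S' h x - x))%V y)].
assert (H : at_right 0 (fun h => (RtoC (/ h) *: (S' h x - x) = RtoC (/ h) *: (S h x - x))%V)).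
{ apply at_right_0; exists 1; split; [lra|]; intros h Hh; now rewrite Heq by lra. }
split; apply filterlim_ext_loc; revert H; apply filter_imp; intros h E; [symmetry|]; exact E.
Qed.

Lemma analytic_holo (A : poperator X) (T : R -> X -> X) :
  is_generator A T -> analytic_semigroup T ->
  exists kappa S, holo kappa A S /\ forall t x, 0 <= t -> S (RtoC t) x = T t x.
Proof.
intros HG (_ & delta & S & Hdelta & (Hlin & H0 & Hadd & Hder & Hcont) & HT).
exists (tan (delta / 2)), S; split; [|exact HT].
assert (Hk : 0 < tan (delta / 2)) by (apply tan_gt_0; lra).
assert (Hat : atan (tan (delta / 2)) = delta / 2) by (apply atan_tan; lra).
assert (Hcl : forall z, cone (tan (delta / 2)) z -> z <> RtoC 0 -> closed_sector (delta / 2) z).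
{ intros z Hz Hz0; rewrite <- Hat; now apply cone_closed_sector. }
assert (Hop : forall z, cone (tan (delta / 2)) z -> z <> RtoC 0 -> open_sector delta z).
{ intros z Hz Hz0; apply (closed_sector_open _ (delta / 2)); [lra | now apply Hcl]. }
assert (Hidx : forall z, cone (tan (delta / 2)) z -> open_sector delta z \/ z = RtoC 0).
{ intros z Hz; destruct (Ceq_dec z 0) as [Hz0|Hz0]; [now right | left; now apply Hop]. }
split.
- exact Hk.
- intros z Hz; exact (lin_of_is_linear _ (Hlin z (Hidx z Hz))).
- intros z Hz; destruct (bnd_of_is_linear _ (Hlin z (Hidx z Hz))) as (K & _ & HK); now exists K.
- exact H0.
- intros a b x Ha Hb; apply Hadd; now apply Hidx.
- intros z Hz Hz0; destruct (Hder z (Hop z Hz Hz0)) as (L & HL & Hd).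
  exists L; split; [exact (lin_of_is_linear _ HL) | split].
  + destruct (bnd_of_is_linear _ HL) as (K & _ & HK); now exists K.
  + intros eps Heps; destruct (Hd (mkposreal eps Heps)) as [d Hd'].
    exists d; split; [apply cond_pos|]; intros h x Hh; exact (Hd' h Hh x).
- intros x eps Heps.
  assert (Hc := Hcont x (delta / 2) ltac:(lra)).
  apply (proj2 (tends_filterlim _ (fun z => S z x) x)) in Hc.
  specialize (Hc eps Heps); apply locally_C_0 in Hc; destruct Hc as (d & Hd & H).
  exists d; split; [exact Hd|]; intros z Hz Hzd.
  destruct (Ceq_dec z 0) as [->|Hz0].
  + assert (E : S 0 x = x) by exact (H0 x); rewrite E, norm_minus_diag; exact Heps.
  + apply H; [exact Hzd | now apply Hcl].
- apply (generator_tends A T); [intros; apply HT; lra | intros; apply HT; lra | exact HG].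
Qed.

Lemma td_semi kappa K (G Gc : poperator X) c : sectorial kappa K G ->
  (forall x, dom Gc x <-> dom G x) -> (forall x, dom G x -> Gc x = (G x + RtoC c *: x)%V) ->
  semi Gc (td G c).
Proof.
intros HG Hdom Happ; assert (Hk := sect_kappa _ _ _ HG).
assert (Hc : forall t, 0 <= t -> cone kappa t) by (intros; apply cone_real; lra).
split.
- intros t Ht; now apply (tdz_lin kappa K G c HG), Hc.
- apply (tdz_0 kappa K G c HG).
- intros s t x Hs Ht; unfold td; rewrite RtoC_plus; apply (tdz_add kappa K G c HG); now apply Hc.
- intros a Ha; assert (HP := KP_ge_1 kappa K G HG).
  assert (H1 : 1 <= exp (Rabs c * a)).
  { generalize (exp_ineq1_le (Rabs c * a)) (Rabs_pos c); intros; assert (0 <= Rabs c * a) by nra; lra. }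
  exists (exp (Rabs c * a) * KP K); split; [nra|]; intros t Ht x.
  eapply Rle_trans; [apply (tdz_bnd kappa K G c HG), Hc, Ht|].
  apply Rmult_le_compat_r; [apply norm_ge_0|]; apply Rmult_le_compat_r; [lra|].
  simpl Re; assert (Hle : c * t <= Rabs c * a).
  { apply Rle_trans with (Rabs c * t); [apply Rmult_le_compat_r; [lra | apply Rle_abs]|].
    apply Rmult_le_compat_l; [apply Rabs_pos | lra]. }
  now apply exp_le_mono.
- intros x; destruct (td_C0 kappa K G c HG) as (_ & _ & _ & H).
  apply (tends_filterlim (at_right 0) (fun t => td G c t x) x), H.
- apply (generator_tends Gc (td G c)); [reflexivity | reflexivity|].
  now apply (td_generator kappa K G c HG).
Qed.

Lemma semi_eq_td kappa K (A : poperator X) c T t x : semi A T ->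
  sectorial kappa K (shifted A zero_op c) -> 0 <= t -> T t x = td (shifted A zero_op c) c t x.
Proof.
intros HT HG Ht; set (G := shifted A zero_op c) in *.
assert (HTd : semi A (td G c)).
{ apply (td_semi kappa K G A c HG); [reflexivity|]; intros y _.
  unfold G, shifted; simpl; rewrite RtoC_opp; vec. }
destruct (semi_bnd _ _ HT t Ht) as (M1 & HM1 & B1), (semi_bnd _ _ HTd t Ht) as (M2 & HM2 & B2).
revert x; apply (lin_eq_on_dense _ _ (M1 + M2) (dom2 G)).
- lra.
- now apply (semi_lin _ _ HT).
- now apply (semi_lin _ _ HTd).
- intros x; eapply Rle_trans; [apply B1; lra|]; apply Rmult_le_compat_r; [apply norm_ge_0 | lra].
- intros x; eapply Rle_trans; [apply B2; lra|]; apply Rmult_le_compat_r; [apply norm_ge_0 | lra].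
- apply (dom2_dense kappa K G HG).
- intros x [H1 H2]; apply (semi_unique A); [exact HT | exact HTd | exact Ht | exact H1|].
  replace (A x) with (G x + RtoC c *: x)%V by (unfold G, shifted; simpl; rewrite RtoC_opp; vec).
  apply (semi_gen_plus A T _ _ HT); [exact H2 | now apply (semi_gen_scal A T _ _ HT)].
Qed.

End Assembly.

Theorem theorem1p3 (X U : CompleteNormedModule C_AbsRing) (tau : R)
    (A : poperator X) (T : R -> X -> X) (B0 : U -> X) (F : X -> U)
    (omega : R) :
  0 < tau ->
  C0_semigroup T -> is_generator A T ->
  is_linear B0 -> is_linear F ->
  exp_stable T B0 F tau omega ->
  analytic_semigroup T ->
  exists alpha beta : R, 0 < alpha /\ 0 < beta /\
    forall D : poperator X,
      linear_operator D ->
      (forall x, dom A x -> dom D x) ->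
      (forall x, dom A x -> norm (D x) <= alpha * norm (A x) + beta * norm x) ->
      exists TD : R -> X -> X,
        C0_semigroup TD /\ is_generator (perturbed A D) TD /\
        analytic_semigroup TD /\
        exp_stable TD B0 F tau omega.
Proof.
intros Htau HC0 HG HB0 HF Hexp Hana.
destruct (analytic_holo A T HG Hana) as (kappa0 & S & HS & HST).
destruct (holo_resolvent_data kappa0 A S HS) as (kappa & c & K & HR).
assert (HT : semi A T).
{ assert (HSem := holo_semi kappa0 A S HS); destruct HC0 as (C1 & C2 & C3 & C4).
  split.
  - intros t Ht; exact (lin_of_is_linear _ (C1 t Ht)).
  - exact C2.
  - exact C3.
  - intros a Ha; destruct (semi_bnd _ _ HSem a Ha) as (M & HM1 & HM).
    exists M; split; [exact HM1|]; intros t Ht x; rewrite <- HST by apply Ht; now apply HM.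
  - intros x; apply (tends_filterlim (at_right 0) (fun t => T t x) x), C4.
  - apply (generator_tends A T); [reflexivity | reflexivity | exact HG]. }
destruct (stability_transfer B0 F tau Htau HB0 HF A T omega HT Hexp) as (e & He & Hstab).
assert (HK := rd_K _ _ _ _ HR); assert (Hc := rd_c _ _ _ _ HR).
set (k := exp (c * tau) * (180 * (2 * K) * (2 * K + 2) ^ 2)).
assert (Hk : 0 < k).
{ apply Rmult_lt_0_compat; [apply exp_pos|]; apply Rmult_lt_0_compat; [lra | apply pow_lt; lra]. }
set (t := Rmin (/ 2) (e / k)).
assert (Ht : 0 < t) by (apply Rmin_glb_lt; [lra | now apply Rdiv_lt_0_compat]).
assert (HcK : 0 <= c * K) by nra.
exists (t / (2 * (K + 1 + c * K))), (t / (2 * K)).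
assert (Halpha : 0 < t / (2 * (K + 1 + c * K))) by (apply Rdiv_lt_0_compat; lra).
assert (Hbeta : 0 < t / (2 * K)) by (apply Rdiv_lt_0_compat; lra).
split; [exact Halpha | split; [exact Hbeta|]].
intros D (HD0 & HDplus & HDscal) Hsub HD.
assert (Heta : eta c K (t / (2 * (K + 1 + c * K))) (t / (2 * K)) = t) by (unfold eta; field; lra).
assert (Hplus : forall x y : X, dom A x -> dom A y -> D (x + y)%V = (D x + D y)%V).
{ intros x y Hx Hy; exact (proj2 (HDplus x y (Hsub x Hx) (Hsub y Hy))). }
assert (Hscal : forall (b : C) (x : X), dom A x -> D (b *: x)%V = (b *: D x)%V).
{ intros b x Hx; exact (proj2 (HDscal b x (Hsub x Hx))). }
assert (Ht2 : t <= / 2) by apply Rmin_l.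
assert (HGD : sectorial kappa (2 * K) (shifted A D c)).
{ apply (shifted_sectorial A D kappa c K _ _ HR Hplus Hscal (Rlt_le _ _ Halpha) (Rlt_le _ _ Hbeta) HD).
  now rewrite Heta. }
assert (HG0 : sectorial kappa (2 * K) (shifted A zero_op c)).
{ apply (shifted_sectorial A zero_op kappa c K 0 0 HR).
  - intros x y _ _; simpl; vec.
  - intros b x _; simpl; vec.
  - lra.
  - lra.
  - intros x _; simpl; rewrite norm_zeroX; lra.
  - unfold eta; lra. }
assert (Happ : forall x, dom (shifted A D c) x ->
   perturbed A D x = (shifted A D c x + RtoC c *: x)%V).
{ intros x _; unfold perturbed, shifted; simpl; rewrite RtoC_opp; vec. }
exists (td (shifted A D c) c).
split; [exact (td_C0 kappa (2 * K) _ c HGD)|].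
split; [apply (td_generator kappa (2 * K) _ c HGD); [reflexivity | exact Happ]|].
split; [exact (td_analytic kappa (2 * K) _ c HGD)|].
apply (Hstab (perturbed A D)).
{ apply (td_semi kappa (2 * K) (shifted A D c)); [exact HGD | reflexivity | exact Happ]. }
intros s Hs x; rewrite (semi_eq_td kappa (2 * K) A c T s x HT HG0) by lra.
assert (Hcs : cone kappa s) by (apply cone_real; [left; apply (rd_kappa _ _ _ _ HR) | lra]).
unfold td, tdz.
replace (cexp (c * s) *: sg (shifted A D c) s x - cexp (c * s) *: sg (shifted A zero_op c) s x)%V with
  (cexp (c * s) *: (sg (shifted A D c) s x - sg (shifted A zero_op c) s x))%V by vec.
apply Rle_trans with (exp (c * tau) * (180 * (2 * K * t) * (2 * K + 2) ^ 2 * norm x)).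
- apply norm_scal_le.
  + rewrite Cmod_cexp; simpl Re.
    replace (c * s - 0 * 0) with (c * s) by ring.
    assert (Hle : c * s <= c * tau) by (apply Rmult_le_compat_l; lra).
    now apply exp_le_mono.
  + apply (sg_difference kappa (2 * K)); [exact HGD | exact HG0 | nra | | exact Hcs].
    intros h mu y H1 H2 H3; rewrite <- Heta at 1.
    apply (shifted_resolvent_difference A D kappa c K _ _ HR Hplus Hscal (Rlt_le _ _ Halpha)
      (Rlt_le _ _ Hbeta) HD); trivial.
    now rewrite Heta.
- replace (exp (c * tau) * (180 * (2 * K * t) * (2 * K + 2) ^ 2 * norm x)) with (k * t * norm x)
    by (unfold k; ring).
  apply Rmult_le_compat_r; [apply norm_ge_0|].
  apply Rle_trans with (k * (e / k)); [apply Rmult_le_compat_l; [lra | apply Rmin_r]|].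
  right; field; lra.
Qed.
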